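(* Let $g$ be monotone increasing and satisfy hypothesis (H), let $h\ge0$, and assume $u=\phi(x+c_*t)$, $c_*>c_\#$, is a pushed traveling front of $u_t=u_{xx}-u+g(u(t-h,x))$; write $c=c_*$. Let $w_0$ satisfy all conditions (IC) with constants $A,B>0$, $\sigma\in(0,\kappa)$, $\mu>\lambda_1(c)$, and fix $\lambda\in(\lambda_1(c),\lambda_2(c))$ with $\lambda<\mu$. Then for some $z_0\in\mathbb{R}$ the classical solution $w$ of $$w_t(t,z)=w_{zz}(t,z)-cw_z(t,z)-w(t,z)+g(w(t-h,z-ch)),\ t>0;\qquad w(s,z)=w_0(s,z-cs),\ s\in[-h,0],\ z\in\mathbb{R},$$ satisfies $\lim_{t\to\infty}|w(t,\cdot)-\phi(\cdot+z_0)|_\lambda=0$.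
   Context: Hypothesis (H) on $g:\mathbb{R}_+\to\mathbb{R}_+$: $g(x)=x$ has exactly two nonnegative solutions $0$ and $\kappa>0$; $g$ is $C^1$ in a $\delta_0$-neighbourhood of $0$ and of $\kappa$, with $g'(0)>1$, $g'(\kappa)<1$; $|g(u)-g(v)|\le L_g|u-v|$ for $u,v\in[0,\kappa]$; there are $C>0,\theta\in(0,1]$ with $|g'(u)-g'(0)|+|g'(\kappa)-g'(\kappa-u)|\le Cu^\theta$ for $u\in(0,\delta_0]$; $g$ is extended linearly and $C^1$-smoothly to $(-\infty,0]$ and $[\kappa,\infty)$. Characteristic function $\chi(z,c)=z^2-cz-1+g'(0)e^{-zch}$; $c_\#$ is the unique real $c$ for which $\chi(\cdot,c)$ has a positive double zero; for $c>c_\#$ its two positive simple zeros are $\lambda_1(c)<\lambda_2(c)$. A wavefront is a solution $u=\phi(x+ct)$ with $\phi>0$, $\phi(-\infty)=0$, $\phi(+\infty)=\kappa$; $c_*$ is the minimal wavefront speed; the minimal wavefront is pushed if $c_*>c_\#$. $w_0:[-h,0]\times\mathbb{R}\to\mathbb{R}$ is continuous, locally Hölder in $x$ uniformly in $s$, and satisfies (IC): (IC1) $0\le w_0(s,x)\le\kappa$; (IC2) $w_0(s,x)\le Ae^{\mu x}$; (IC3) $w_0(s,x)>\kappa-\sigma$ for $x\ge B$ (all for $s\in[-h,0]$). $\eta(z)=\min\{e^{\lambda z},1\}$, $|y|_\lambda=\sup_{z}|y(z)|/\eta(z)$. *)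

(* Defs.v *)
From Stdlib Require Import Reals Lra.
From Coquelicot Require Import Coquelicot.
Open Scope R_scope.

(* Hypothesis (H) on g : R -> R (g already extended to all of R). *)
Definition hypH (g : R -> R) (kappa : R) : Prop :=
  0 < kappa /\
  (forall x, 0 <= x -> 0 <= g x) /\
  (forall x, 0 <= x -> (g x = x <-> (x = 0 \/ x = kappa))) /\
  exists delta0, 0 < delta0 /\
    (forall x, Rabs x < delta0 -> ex_derive g x /\ continuous (Derive g) x) /\
    (forall x, Rabs (x - kappa) < delta0 -> ex_derive g x /\ continuous (Derive g) x) /\
    1 < Derive g 0 /\ Derive g kappa < 1 /\
    (exists Lg, forall u v, 0 <= u <= kappa -> 0 <= v <= kappa ->
        Rabs (g u - g v) <= Lg * Rabs (u - v)) /\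
    (exists C theta, 0 < C /\ 0 < theta <= 1 /\
       forall u, 0 < u <= delta0 ->
         Rabs (Derive g u - Derive g 0) + Rabs (Derive g kappa - Derive g (kappa - u))
           <= C * Rpower u theta) /\
    (* linear (C^1) extension to (-oo,0] and [kappa,+oo) *)
    (forall x, x <= 0 -> g x = Derive g 0 * x) /\
    (forall x, kappa <= x -> g x = kappa + Derive g kappa * (x - kappa)).

Definition chi (g : R -> R) (h z c : R) : R :=
  z ^ 2 - c * z - 1 + Derive g 0 * exp (- z * c * h).

Definition is_c_sharp (g : R -> R) (h c : R) : Prop :=
  exists z, 0 < z /\ chi g h z c = 0 /\ Derive (fun y => chi g h y c) z = 0.

(* wavefront u = phi(x + c t) of u_t = u_xx - u + g(u(t-h,x)) *)
Definition is_wavefront (g : R -> R) (kappa h c : R) (phi : R -> R) : Prop :=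
  (forall s, ex_derive phi s /\ ex_derive (Derive phi) s) /\
  (forall s, c * Derive phi s = Derive (Derive phi) s - phi s + g (phi (s - c * h))) /\
  (forall s, 0 < phi s) /\
  is_lim phi m_infty 0 /\ is_lim phi p_infty kappa.

Definition is_min_speed (g : R -> R) (kappa h c : R) : Prop :=
  (exists phi, is_wavefront g kappa h c phi) /\
  (forall c', (exists phi, is_wavefront g kappa h c' phi) -> c <= c').

Definition cont2_on (D : R -> R -> Prop) (f : R -> R -> R) (s x : R) : Prop :=
  forall eps, 0 < eps -> exists d, 0 < d /\
    forall s' x', D s' x' -> Rabs (s' - s) < d -> Rabs (x' - x) < d ->
      Rabs (f s' x' - f s x) < eps.

Definition admissible_w0 (h : R) (w0 : R -> R -> R) : Prop :=
  (forall s x, -h <= s <= 0 -> cont2_on (fun s' _ => -h <= s' <= 0) w0 s x) /\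
  (forall M, 0 < M -> exists alpha K, 0 < alpha <= 1 /\ 0 <= K /\
     forall s x y, -h <= s <= 0 -> Rabs x <= M -> Rabs y <= M -> x <> y ->
       Rabs (w0 s x - w0 s y) <= K * Rpower (Rabs (x - y)) alpha).

Definition IC (h kappa A B sigma mu : R) (w0 : R -> R -> R) : Prop :=
  forall s x, -h <= s <= 0 ->
    (0 <= w0 s x <= kappa) /\
    w0 s x <= A * exp (mu * x) /\
    (B <= x -> kappa - sigma < w0 s x).

Definition wt (w : R -> R -> R) (t z : R) : R := Derive (fun s => w s z) t.
Definition wz (w : R -> R -> R) (t z : R) : R := Derive (fun y => w t y) z.
Definition wzz (w : R -> R -> R) (t z : R) : R := Derive (fun y => wz w t y) z.

Definition classical_solution (g : R -> R) (h c : R) (w0 w : R -> R -> R) : Prop :=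
  (forall s z, -h <= s <= 0 -> w s z = w0 s (z - c * s)) /\
  (forall t z, -h <= t -> cont2_on (fun t' _ => -h <= t') w t z) /\
  (forall T, exists M, forall t z, -h <= t <= T -> Rabs (w t z) <= M) /\
  (forall t z, 0 < t ->
     ex_derive (fun s => w s z) t /\ ex_derive (fun y => w t y) z /\
     ex_derive (fun y => wz w t y) z) /\
  (forall t z, 0 < t ->
     cont2_on (fun t' _ => 0 < t') (wt w) t z /\
     cont2_on (fun t' _ => 0 < t') (wz w) t z /\
     cont2_on (fun t' _ => 0 < t') (wzz w) t z) /\
  (forall t z, 0 < t ->
     wt w t z = wzz w t z - c * wz w t z - w t z + g (w (t - h) (z - c * h))).

Definition eta (lam z : R) : R := Rmin (exp (lam * z)) 1.
Definition wnorm (lam : R) (y : R -> R) : Rbar :=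
  Lub_Rbar (fun r => exists z, r = Rabs (y z) / eta lam z).

(* Main.v *)
(* Pushedness enters through the tail of phi. If phi(z) >= d e^(lam z) near -oo, then for lam < l' < lambda_2
   min(phi, M e^(l' z)) is a supersolution, and the gap opened by one application of the profile map makes it
   remain one at a slightly smaller speed. Least fixed points of the profile map forced from below by small
   ramps lie under it, and their limit as the ramps vanish is a wavefront slower than c, against minimality. Hence phi decays faster than e^(lam z), which lets the sliding method give phi' > 0.
   Then, with s monotone and q exponentially small, phi(z + s(t)) +- q(t) eta are super- and subsolutions
   (Fife and McLeod), so translates of phi are stable and w is asymptotically squeezed between two of them. Let
   a be the supremum of the asymptotic lower shifts and b the infimum of the upper ones. If a < b, then w stays
   away from one of the two translates at z = 0 for arbitrarily large times; the gap spreads to any bounded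
   interval by comparison with the heat kernel, while outside it phi' is small relative to eta, so that one of
   the two shifts can be improved. Therefore a = b. *)
Require Import Defs.
From Stdlib Require Import Reals Lra Psatz Classical ClassicalEpsilon.
From Coquelicot Require Import Coquelicot.
From mathcomp Require filter.
Open Scope R_scope.

(** * Calculus *)

(** Every estimate is a comparison; neither parabolic regularity nor an expansion of phi at -oo is
    invoked. For c > c_# the characteristic function is negative on (lambda_1, lambda_2), and this
    fact is used twice. It makes an exponential of this range decay under the linearization at 0, so
    a perturbation weighted by eta is damped in the left tail, while g'(kappa) < 1 damps it in the
    right tail, where eta = 1; only a bounded middle part has to be paid for by phi' > 0. It also
    allows a comparison of phi with two exponents l < l' of the range: phi is either O(e^(l' z)) or
    at least a multiple of e^(l z), and this dichotomy replaces the asymptotic expansion. The weight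
    and the truncated front have kinks, concave in supersolutions and convex in subsolutions, so
    inequalities are stated through smooth functions touching at a point. The two sides differ:
    beyond kappa the slope of g stays below 1, so a large excess above the front is absorbed, but a
    deficit must be small; hence the lower bound starts only after w has come close to kappa on a
    half-line. The ramps are there because 0 is itself a fixed point of the profile map. *)

Lemma derive_plus (f g : R -> R) (x l m : R) :
  is_derive f x l -> is_derive g x m -> is_derive (fun y => f y + g y) x (l + m).
Proof. exact (is_derive_plus (K := R_AbsRing) (V := R_NormedModule) f g x l m). Qed.

Lemma derive_minus (f g : R -> R) (x l m : R) :
  is_derive f x l -> is_derive g x m -> is_derive (fun y => f y - g y) x (l - m).
Proof. exact (is_derive_minus (K := R_AbsRing) (V := R_NormedModule) f g x l m). Qed.

Lemma derive_opp (f : R -> R) (x l : R) : is_derive f x l -> is_derive (fun y => - f y) x (- l).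
Proof. exact (is_derive_opp (K := R_AbsRing) (V := R_NormedModule) f x l). Qed.

Lemma derive_const (a x : R) : is_derive (fun _ => a) x 0.
Proof. exact (is_derive_const (K := R_AbsRing) (V := R_NormedModule) a x). Qed.

Lemma derive_mult (f g : R -> R) (x l m : R) :
  is_derive f x l -> is_derive g x m -> is_derive (fun y => f y * g y) x (l * g x + f x * m).
Proof.
  intros Hf Hg. exact (is_derive_mult (K := R_AbsRing) f g x l m Hf Hg Rmult_comm).
Qed.

Lemma cont_plus {T : UniformSpace} (f g : T -> R) (x : T) :
  continuous f x -> continuous g x -> continuous (fun y => f y + g y) x.
Proof. exact (continuous_plus (V := R_NormedModule) f g x). Qed.

Lemma cont_minus {T : UniformSpace} (f g : T -> R) (x : T) :
  continuous f x -> continuous g x -> continuous (fun y => f y - g y) x.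
Proof. exact (continuous_minus (V := R_NormedModule) f g x). Qed.

Lemma cont_opp {T : UniformSpace} (f : T -> R) (x : T) :
  continuous f x -> continuous (fun y => - f y) x.
Proof. exact (continuous_opp (V := R_NormedModule) f x). Qed.

Lemma cont_mult {T : UniformSpace} (f g : T -> R) (x : T) :
  continuous f x -> continuous g x -> continuous (fun y => f y * g y) x.
Proof. exact (continuous_mult (K := R_AbsRing) f g x). Qed.

Lemma is_derive_cont (f : R -> R) (x l : R) : is_derive f x l -> continuous f x.
Proof. intros H. apply (ex_derive_continuous (V := R_NormedModule)). exists l; exact H. Qed.

Lemma continuous_fst2 {U V : UniformSpace} (p : U * V) : continuous fst p.
Proof. intros P [d Hd]. exists d. intros q [Hq _]. apply Hd, Hq. Qed.

Lemma continuous_snd2 {U V : UniformSpace} (p : U * V) : continuous snd p.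
Proof. intros P [d Hd]. exists d. intros q [_ Hq]. apply Hd, Hq. Qed.

Ltac smooth := apply (ex_derive_continuous (V := R_NormedModule)); auto_derive; try lra; trivial.

Ltac cont :=
  cbv beta;
  first [assumption | lazymatch goal with
  | |- continuous (fun _ => ?a) _ => apply continuous_const
  | |- continuous (fun p => fst p) _ => apply continuous_fst2
  | |- continuous (fun p => snd p) _ => apply continuous_snd2
  | |- continuous (fun p => @?f p + @?g p) _ => apply (cont_plus f g); cont
  | |- continuous (fun p => @?f p - @?g p) _ => apply (cont_minus f g); cont
  | |- continuous (fun p => @?f p * @?g p) _ => apply (cont_mult f g); cont
  | |- continuous (fun p => - @?f p) _ => apply (cont_opp f); cont
  | |- continuous (fun p => (@?f p) ^ 2) _ => apply (continuous_comp f (fun x => x ^ 2)); [cont|smooth]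
  | |- continuous (fun p => exp (@?f p)) _ => apply (continuous_comp f exp); [cont|smooth]
  | |- continuous (fun p => fst (@?f p)) _ => apply (continuous_comp f fst); [cont|apply continuous_fst2]
  | |- continuous (fun p => snd (@?f p)) _ => apply (continuous_comp f snd); [cont|apply continuous_snd2]
  | |- continuous (fun p => ?h (@?f p)) _ => apply (continuous_comp f h); [cont|auto]
  | |- _ => auto
  end].

(** * Exponentials, small constants and conditions at a maximum *)

Lemma exp_mono (x y : R) : x <= y -> exp x <= exp y.
Proof.
  intros [H| ->]; [left; apply exp_increasing, H|apply Rle_refl].
Qed.

Lemma exp_ge1 (x : R) : 0 <= x -> 1 <= exp x.
Proof. intros H. rewrite <- exp_0. apply exp_mono, H. Qed.

Lemma exp_le1 (x : R) : x <= 0 -> exp x <= 1.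
Proof. intros H. rewrite <- exp_0. apply exp_mono, H. Qed.

Lemma exp_decay_le1 (b t : R) : 0 <= b -> 0 <= t -> exp (- b * t) <= 1.
Proof. intros. apply exp_le1. nra. Qed.

Lemma exp_decay_ge1 (b t : R) : 0 <= b -> t <= 0 -> 1 <= exp (- b * t).
Proof. intros. apply exp_ge1. nra. Qed.

Lemma eta_pos l z : 0 < eta l z.
Proof. apply Rmin_pos; [apply exp_pos|lra]. Qed.

Lemma exp_opp_mul (x : R) : exp (- x) * exp x = 1.
Proof. rewrite <- exp_plus, Rplus_opp_l. apply exp_0. Qed.

Lemma is_lub_approx (E : R -> Prop) (l e : R) : is_lub E l -> 0 < e -> exists x, E x /\ l - e < x.
Proof.
  intros [_ Hlub] He. apply NNPP; intros Hn. assert (l <= l - e); [|lra].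
  apply Hlub. intros x Hx. apply Rnot_lt_le; intros Hlt. apply Hn. exists x; split; assumption.
Qed.

Lemma small_factor (K b r : R) : 0 <= K -> 0 < b -> 0 < r -> exists x, 0 < x <= b /\ K * x <= r.
Proof.
  intros HK Hb Hr. exists (Rmin b (r / (K + 1))).
  assert (0 < r / (K + 1)) by (apply Rdiv_lt_0_compat; lra).
  assert (0 < Rmin b (r / (K + 1))) by (apply Rmin_pos; assumption).
  split; [split; [assumption|apply Rmin_l]|].
  apply Rle_trans with ((K + 1) * (r / (K + 1))); [|right; field; lra].
  apply Rmult_le_compat; try lra. apply Rmin_r.
Qed.

Ltac pos :=
  match goal with
  | |- 0 < _ * _ => apply Rmult_lt_0_compat; pos
  | |- 0 <= _ * _ => apply Rmult_le_pos; pos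
  | |- 0 < exp _ => apply exp_pos
  | |- 0 <= exp _ => left; apply exp_pos
  | |- 0 <= _ ^ 2 => apply pow2_ge_0
  | |- 0 < eta _ _ => apply eta_pos
  | |- 0 <= eta _ _ => left; apply eta_pos
  | |- _ => lra
  end.

(** Only the past enters, because at a first touching time nothing is known about later times. *)
Lemma derive_ge0_of_left_max (f : R -> R) (t a d : R) :
  0 < d -> is_derive f t a ->
  (forall s, t - d < s < t -> f s <= f t) -> 0 <= a.
Proof.
  intros Hd Hf Hle.
  apply Rnot_lt_le; intros Ha.
  apply is_derive_Reals in Hf.
  destruct (Hf (- a / 2)) as [e He]; [lra|].
  pose (k := - Rmin (d / 2) (e / 2)).
  assert (Hm : 0 < Rmin (d / 2) (e / 2)).
  { apply Rmin_pos; [lra|]. pose proof (cond_pos e); lra. }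
  assert (Hk : k < 0) by (unfold k; lra).
  pose proof (Rmin_l (d / 2) (e / 2)); pose proof (Rmin_r (d / 2) (e / 2)).
  assert (Hak : Rabs k < e) by (unfold k; rewrite Rabs_Ropp, Rabs_right; lra).
  specialize (He k ltac:(lra) Hak).
  specialize (Hle (t + k) ltac:(unfold k; lra)).
  apply Rabs_def2 in He.
  assert (0 <= (f (t + k) - f t) / k).
  { replace ((f (t + k) - f t) / k) with ((f t - f (t + k)) * / (- k)) by (field; lra).
    apply Rmult_le_pos; [lra|]. left; apply Rinv_0_lt_compat; lra. }
  lra.
Qed.

Lemma derive_le0_of_right_max (f : R -> R) (t a d : R) :
  0 < d -> is_derive f t a ->
  (forall s, t < s < t + d -> f s <= f t) -> a <= 0.
Proof.
  intros Hd Hf Hle.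
  assert (H : is_derive (fun s => f (- s)) (- t) (- a)).
  { replace (- a) with (scal (-1) a) by (unfold scal; simpl; unfold mult; simpl; ring).
    apply (is_derive_comp f Ropp).
    - rewrite Ropp_involutive; exact Hf.
    - auto_derive; [trivial|ring]. }
  apply derive_ge0_of_left_max with (d := d) in H; [lra|exact Hd|].
  intros s Hs; rewrite Ropp_involutive; apply Hle; lra.
Qed.

Lemma mean_value (f f1 : R -> R) (a b : R) :
  (forall z, a <= z <= b -> is_derive f z (f1 z)) -> a <= b ->
  exists x, a <= x <= b /\ f b - f a = f1 x * (b - a).
Proof.
  intros Hf Hab. destruct (MVT_gen f a b f1) as [x [Hx Hm]].
  - intros x Hx. rewrite Rmin_left, Rmax_right in Hx by lra. apply Hf; lra.
  - intros x Hx. rewrite Rmin_left, Rmax_right in Hx by lra.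
    apply continuity_pt_filterlim, (is_derive_cont _ _ (f1 x)), Hf; lra.
  - rewrite Rmin_left, Rmax_right in Hx by lra. exists x; split; assumption.
Qed.

(** If l were positive, f1 would be positive just to the right of z and f would rise above its local
    maximum. *)
Lemma second_order_max (f f1 : R -> R) (z l : R) :
  locally z (fun y => f y <= f z) ->
  locally z (fun y => is_derive f y (f1 y)) ->
  is_derive f1 z l -> f1 z = 0 /\ l <= 0.
Proof.
  intros [d1 H1] [d2 H2] Hl.
  pose (d := Rmin d1 d2).
  assert (Hd : 0 < d) by (apply Rmin_pos; apply cond_pos).
  assert (Hb : forall y, Rabs (y - z) < d -> f y <= f z /\ is_derive f y (f1 y)).
  { intros y Hy. split; [apply H1|apply H2];
      (eapply Rlt_le_trans; [exact Hy|]); [apply Rmin_l|apply Rmin_r]. }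
  assert (H0 : f1 z = 0).
  { assert (Hz : is_derive f z (f1 z)).
    { apply Hb. rewrite Rminus_diag, Rabs_R0; exact Hd. }
    apply Rle_antisym.
    - apply (derive_le0_of_right_max f z (f1 z) d); auto.
      intros s Hs; apply Hb; apply Rabs_def1; lra.
    - apply (derive_ge0_of_left_max f z (f1 z) d); auto.
      intros s Hs; apply Hb; apply Rabs_def1; lra. }
  split; [exact H0|].
  apply Rnot_lt_le; intros Hpos.
  apply is_derive_Reals in Hl.
  destruct (Hl (l / 2)) as [e He]; [lra|].
  pose (k := Rmin (d / 2) (e / 2)).
  assert (Hk : 0 < k) by (apply Rmin_pos; [lra|pose proof (cond_pos e); lra]).
  assert (Hk1 : k <= d / 2) by apply Rmin_l.
  assert (Hk2 : k <= e / 2) by apply Rmin_r.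
  assert (Hpos1 : forall s, 0 < s <= k -> 0 < f1 (z + s)).
  { intros s Hs. specialize (He s ltac:(lra)).
    rewrite Rabs_right in He by lra. specialize (He ltac:(lra)).
    rewrite H0 in He. apply Rabs_def2 in He.
    replace (f1 (z + s)) with ((f1 (z + s) - 0) / s * s) by (field; lra).
    apply Rmult_lt_0_compat; lra. }
  assert (Hmvt : forall u v, 0 <= u < v -> v <= k ->
    exists x, u <= x <= v /\ f (z + v) - f (z + u) = f1 (z + x) * (v - u)).
  { intros u v Huv Hvk.
    destruct (mean_value f f1 (z + u) (z + v)) as [x [Hx Hm]]; [|lra|].
    { intros x Hx. apply Hb; apply Rabs_def1; lra. }
    exists (x - z). split; [lra|].
    replace (z + (x - z)) with x by ring. rewrite Hm; ring. }
  (* The intermediate point may be z itself, where f1 vanishes; the second half of the interval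
     gives the strict increase. *)
  destruct (Hmvt 0 (k / 2)) as [x [Hx Hm]]; [lra|lra|].
  destruct (Hmvt (k / 2) k) as [x2 [Hx2 Hm2]]; [lra|lra|].
  assert (Hfk : f (z + k) <= f z) by (apply Hb; apply Rabs_def1; lra).
  assert (0 < f1 (z + x2) * (k - k / 2)) by (apply Rmult_lt_0_compat; [apply Hpos1|]; lra).
  assert (0 <= f1 (z + x) * (k / 2 - 0)).
  { apply Rmult_le_pos; [|lra].
    destruct (Req_dec x 0) as [->|Hne]; [rewrite Rplus_0_r; lra|].
    left; apply Hpos1; lra. }
  rewrite Rplus_0_r in Hm. lra.
Qed.

(** * First touching *)

(** The second space variable serves the doubling of variables in the gradient bound; in the
    comparison principle it is confined to one point. *)
Lemma first_touch (D : R -> R -> R -> R) (T a b a' b' : R) :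
  a <= b -> a' <= b' ->
  (forall p : R * (R * R),
     continuous (fun p => D (fst p) (fst (snd p)) (snd (snd p))) p) ->
  (forall x y, a <= x <= b -> a' <= y <= b' -> D 0 x y < 0) ->
  (forall t x y, 0 <= t <= T -> a <= x <= b -> a' <= y <= b' -> D t x y < 0) \/
  (exists t x y, 0 < t <= T /\ a <= x <= b /\ a' <= y <= b' /\ D t x y = 0 /\
     (forall s x' y', 0 <= s < t -> a <= x' <= b -> a' <= y' <= b' -> D s x' y' < 0) /\
     (forall x' y', a <= x' <= b -> a' <= y' <= b' -> D t x' y' <= 0)).
Proof.
  intros Hab Hab' HD H0.
  destruct (Rlt_le_dec T 0) as [HT|HT].
  { left; intros; lra. }
  assert (Hcont : forall t x y e, 0 < e -> exists d : posreal, forall s x' y',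
     Rabs (s - t) < d -> Rabs (x' - x) < d -> Rabs (y' - y) < d ->
     Rabs (D s x' y' - D t x y) < e).
  { intros t x y e He.
    assert (Hl := HD (t, (x, y))). unfold continuous in Hl.
    assert (Hl' := proj1 (filterlim_locally _ _) Hl (mkposreal e He)).
    destruct Hl' as [d Hd]. exists d. intros s x' y' h1 h2 h3.
    apply (Hd (s, (x', y'))). repeat split; assumption. }
  pose (P := fun t => forall s x y, 0 <= s <= t -> a <= x <= b -> a' <= y <= b' -> D s x y < 0).
  (* by compactness of the box, negativity at one time persists near that time *)
  assert (Htube : forall t, (forall x y, a <= x <= b -> a' <= y <= b' -> D t x y < 0) ->
     exists d, 0 < d /\ forall s x y, Rabs (s - t) < d -> a <= x <= b -> a' <= y <= b' ->
       D s x y < 0).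
  { intros t Ht.
    assert (Hdel : forall x y, exists d : posreal, a <= x <= b -> a' <= y <= b' ->
      forall s x' y', Rabs (s - t) < d -> Rabs (x' - x) < d -> Rabs (y' - y) < d ->
        D s x' y' < 0).
    { intros x y.
      destruct (classic (a <= x <= b /\ a' <= y <= b')) as [[Hx Hy]|Hn].
      - destruct (Hcont t x y (- D t x y)) as [d Hd].
        { specialize (Ht x y Hx Hy); lra. }
        exists d. intros _ _ s x' y' h1 h2 h3.
        specialize (Hd s x' y' h1 h2 h3). apply Rabs_def2 in Hd. lra.
      - exists (mkposreal 1 Rlt_0_1). intros Hx Hy; exfalso; auto. }
    pose (del := fun x y => proj1_sig (ClassicalEpsilon.constructive_indefinite_description _ (Hdel x y))).
    assert (Hdel' : forall x y, a <= x <= b -> a' <= y <= b' ->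
      forall s x' y', Rabs (s - t) < del x y -> Rabs (x' - x) < del x y ->
        Rabs (y' - y) < del x y -> D s x' y' < 0).
    { intros x y. exact (proj2_sig (ClassicalEpsilon.constructive_indefinite_description _ (Hdel x y))). }
    clearbody del.
    destruct (classic (exists d, 0 < d /\ forall s x y, Rabs (s - t) < d -> a <= x <= b ->
      a' <= y <= b' -> D s x y < 0)) as [|Hn]; [assumption|exfalso].
    destruct (compactness_value_2d a b a' b' del) as [d Hd].
    apply Hn. exists d. split; [apply cond_pos|].
    intros s x y Hs Hx Hy.
    apply NNPP; intros Hneg.
    apply (Hd x y Hx Hy).
    intros (u & v & Hu & Hv & h1 & h2 & h3).
    apply Hneg. apply (Hdel' u v Hu Hv); auto.
    eapply Rlt_le_trans; [exact Hs|exact h3]. }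
  destruct (classic (P T)) as [HPT|HPT]; [left; exact HPT|right].
  pose (E := fun t => 0 <= t <= T /\ P t).
  destruct (completeness E) as [ts [Hub Hlub]].
  { exists T. intros t [Ht _]. lra. }
  { exists 0. split; [lra|]. intros s x y Hs Hx Hy.
    replace s with 0 by lra. auto. }
  assert (Hts0 : 0 <= ts).
  { apply Hub. split; [lra|]. intros s x y Hs Hx Hy. replace s with 0 by lra. auto. }
  assert (HtsT : ts <= T). { apply Hlub. intros t [Ht _]; lra. }
  assert (Hbefore : forall s x y, 0 <= s < ts -> a <= x <= b -> a' <= y <= b' -> D s x y < 0).
  { intros s x y Hs Hx Hy.
    apply NNPP; intros Hneg.
    assert (ts <= s); [|lra].
    apply Hlub. intros t [Ht HPt].
    apply Rnot_lt_le; intros Hst. apply Hneg. apply HPt; auto; lra. }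
  assert (Hat : forall x y, a <= x <= b -> a' <= y <= b' -> D ts x y <= 0).
  { intros x y Hx Hy. apply Rnot_lt_le; intros Hpos.
    destruct (Req_dec ts 0) as [Hz|Hz].
    { rewrite Hz in Hpos. specialize (H0 x y Hx Hy). lra. }
    destruct (Hcont ts x y (D ts x y) Hpos) as [d Hd].
    pose proof (cond_pos d).
    pose (s := Rmax 0 (ts - d / 2)).
    assert (Hs : 0 <= s < ts).
    { unfold s. split; [apply Rmax_l|]. apply Rmax_lub_lt; lra. }
    assert (ts - d / 2 <= s) by apply Rmax_r.
    specialize (Hd s x y).
    rewrite !Rminus_diag, Rabs_R0 in Hd.
    specialize (Hd ltac:(apply Rabs_def1; lra) ltac:(lra) ltac:(lra)).
    specialize (Hbefore s x y Hs Hx Hy). apply Rabs_def2 in Hd. lra. }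
  (* If [D] were still negative on the whole box at [ts], it would stay so a little longer, and [ts]
     would not be the supremum. *)
  destruct (classic (forall x y, a <= x <= b -> a' <= y <= b' -> D ts x y < 0)) as [Hall|Hex].
  - exfalso. destruct (Htube ts Hall) as [d [Hd Hds]].
    assert (HPd : forall s x y, 0 <= s < ts + d -> a <= x <= b -> a' <= y <= b' -> D s x y < 0).
    { intros s x y Hs Hx Hy. destruct (Rlt_le_dec s ts) as [h|h].
      - apply Hbefore; auto; lra.
      - apply Hds; auto. apply Rabs_def1; lra. }
    destruct (Rlt_le_dec T (ts + d)) as [h|h].
    + apply HPT. intros s x y Hs Hx Hy. apply HPd; auto; lra.
    + assert (ts + d / 2 <= ts); [|lra].
      apply Hub. split; [lra|]. intros s x y Hs Hx Hy. apply HPd; auto; lra.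
  - apply not_all_ex_not in Hex as [x Hex].
    apply not_all_ex_not in Hex as [y Hex].
    apply imply_to_and in Hex as [Hx Hex].
    apply imply_to_and in Hex as [Hy Hex].
    assert (Hxy := Hat x y Hx Hy).
    assert (HDz : D ts x y = 0) by lra.
    exists ts, x, y. repeat split; try lra; auto.
    destruct (Req_dec ts 0) as [Hz|Hz]; [|lra].
    rewrite Hz in HDz. specialize (H0 x y Hx Hy). lra.
Qed.

(** * Comparison principle for delayed reaction-diffusion inequalities *)

(* [P] is the value at [(t, z)] of the operator U_t - U_zz + c U_z + U. *)
Definition jet (c : R) (U : R -> R -> R) (t z P : R) : Prop :=
  exists (U1 : R -> R) (ut uzz : R),
    is_derive (fun s => U s z) t ut /\
    locally z (fun y => is_derive (U t) y (U1 y)) /\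
    is_derive U1 z uzz /\
    P = ut - uzz + c * U1 z + U t z.

(** A smooth function touching [u] from below carries the inequality, as for a maximum of smooth
    subsolutions, so convex kinks are allowed. In time only the past is compared. [super_test] is
    the mirror image, for minima. *)
Definition sub_test (c : R) (u : R -> R -> R) (t z P : R) : Prop :=
  exists U, jet c U t z P /\ U t z = u t z /\
    (exists d, 0 < d /\ forall s, t - d < s < t -> U s z <= u s z) /\
    locally z (fun y => U t y <= u t y).

Definition super_test (c : R) (v : R -> R -> R) (t z P : R) : Prop :=
  exists V, jet c V t z P /\ V t z = v t z /\
    (exists d, 0 < d /\ forall s, t - d < s < t -> v s z <= V s z) /\
    locally z (fun y => v t y <= V t y).

Lemma jet_sub_test c u t z P : jet c u t z P -> sub_test c u t z P.
Proof.
  intros H. exists u. split; [exact H|]. split; [reflexivity|]. split.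
  - exists 1. split; [lra|]. intros; lra.
  - apply filter_forall. intros; lra.
Qed.

Lemma jet_super_test c u t z P : jet c u t z P -> super_test c u t z P.
Proof.
  intros H. exists u. split; [exact H|]. split; [reflexivity|]. split.
  - exists 1. split; [lra|]. intros; lra.
  - apply filter_forall. intros; lra.
Qed.

(* The growing barrier e^(K t) (1 + z^2), with K large, makes the supersolution strict and forces contact points to be bounded. *)
Lemma comparison (c b h L T : R) (u v : R -> R -> R) :
  0 <= c -> 0 <= h -> 0 <= L ->
  (forall p : R * R, continuous (fun p => u (fst p) (snd p) - v (fst p) (snd p)) p) ->
  (exists M, forall t z, 0 <= t <= T -> u t z - v t z <= M) ->
  (forall t z, - h <= t <= 0 -> u t z <= v t z) ->
  (forall t z, 0 < t <= T -> u t z <= v t z \/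
     exists pu pv, sub_test c u t z pu /\ super_test c v t z pv /\
       forall y, 0 <= y -> u (t - h) (z - b) <= v (t - h) (z - b) + y -> pu - pv <= L * y) ->
  forall t z, - h <= t <= T -> u t z <= v t z.
Proof.
  intros Hc Hh HL Hcont [M HM] Hinit Htest t1 z1 Ht1.
  destruct (Rle_lt_dec t1 0) as [Hneg|Hpos]; [apply Hinit; lra|].
  apply Rnot_lt_le; intros Hlt.
  pose (K := 3 + c + L * (2 + 2 * b ^ 2)).
  assert (HK : 0 <= K).
  { unfold K. pose proof (pow2_ge_0 b). assert (0 <= L * (2 + 2 * b ^ 2)) by pos. lra. }
  pose (B := fun t z : R => exp (K * t) * (1 + z ^ 2)).
  assert (HB1 : forall t z, 0 < B t z).
  { intros t z. unfold B. apply Rmult_lt_0_compat; [apply exp_pos|]. pose proof (pow2_ge_0 z); lra. }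
  (* Half the size at which the barrier would cancel the assumed excess at (t1, z1). *)
  pose (e := (u t1 z1 - v t1 z1) / (2 * B t1 z1)).
  assert (He : 0 < e).
  { unfold e. apply Rdiv_lt_0_compat; [lra|]. specialize (HB1 t1 z1). lra. }
  assert (He1 : e * B t1 z1 < u t1 z1 - v t1 z1).
  { unfold e. replace (_ / _ * _) with ((u t1 z1 - v t1 z1) / 2).
    - lra.
    - field. apply Rgt_not_eq, HB1. }
  pose (D := fun t x (y : R) => u t x - v t x - e * B t x).
  (* Beyond [Rb] the barrier exceeds the bound M of u - v, so contact can only occur inside. *)
  pose (Rb := 1 + Rabs z1 + Rabs M / e).
  assert (HMe : 0 <= Rabs M / e).
  { apply Rdiv_le_0_compat; [apply Rabs_pos|exact He]. }
  assert (HRb : 1 + Rabs z1 <= Rb) by (unfold Rb; lra).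
  assert (Hout : forall t z y, 0 <= t <= T -> Rb <= Rabs z -> D t z y < 0).
  { intros t z y Ht Hz. unfold D, B.
    assert (M < e * (exp (K * t) * (1 + z ^ 2))).
    { apply Rle_lt_trans with (Rabs M); [apply Rle_abs|].
      assert (1 <= exp (K * t)) by (apply exp_ge1; nra).
      assert (Rabs M / e < 1 + z ^ 2).
      { rewrite <- (pow2_abs z).
        pose proof (Rabs_pos z1).
        assert (Rabs M / e <= Rabs z) by (unfold Rb in Hz; lra).
        nra. }
      apply Rlt_le_trans with (e * (1 + z ^ 2)).
      - apply Rmult_lt_reg_r with (/ e); [apply Rinv_0_lt_compat, He|].
        replace (e * (1 + z ^ 2) * / e) with (1 + z ^ 2) by (field; lra). exact H0.
      - apply Rmult_le_compat_l; [lra|]. nra. }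
    specialize (HM t z Ht). lra. }
  destruct (first_touch D T (- Rb) Rb 0 0) as [Hall|(t & x & y & Ht & Hx & Hy & HD0 & Hbef & Hat)].
  - pose proof (Rabs_pos z1). lra.
  - lra.
  - intros p. unfold D, B. apply (cont_minus (fun p : R * (R * R) => u (fst p) (fst (snd p)) - v (fst p) (fst (snd p)))).
    + apply (continuous_comp (fun p : R * (R * R) => (fst p, fst (snd p)))
        (fun q : R * R => u (fst q) (snd q) - v (fst q) (snd q))); [|apply Hcont].
      intros P [d Hd]. exists d. intros q [h1 [h2 h3]]. apply Hd. split; assumption.
    + cont.
  - intros x y Hx Hy. unfold D.
    assert (u 0 x <= v 0 x) by (apply Hinit; lra).
    assert (0 < e * B 0 x) by (apply Rmult_lt_0_compat; auto). lra.
  - assert (D t1 z1 0 < 0).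
    { apply Hall; [lra| |lra]. pose proof (Rabs_pos z1).
      split; [apply Rle_trans with (- Rabs z1); [lra|]|apply Rle_trans with (Rabs z1); [|lra]].
      - pose proof (Rle_abs (- z1)). rewrite Rabs_Ropp in H0. lra.
      - apply Rle_abs. }
    unfold D in H. lra.
  - assert (HxR : Rabs x < Rb).
    { apply Rnot_le_lt; intros Hn. specialize (Hout t x y ltac:(lra) Hn). lra. }
    assert (Hbef' : forall s z, 0 <= s < t -> u s z - v s z - e * B s z < 0).
    { intros s z Hs. destruct (Rlt_le_dec (Rabs z) Rb) as [h1|h1].
      - apply Rabs_def2 in h1. apply (Hbef s z 0); lra.
      - apply (Hout s z 0); [lra|exact h1]. }
    assert (Hat' : forall z, u t z - v t z - e * B t z <= 0).
    { intros z. destruct (Rlt_le_dec (Rabs z) Rb) as [h1|h1].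
      - apply Rabs_def2 in h1. apply (Hat z 0); lra.
      - left. apply (Hout t z 0); [lra|exact h1]. }
    unfold D in HD0.
    assert (HBx : 0 < e * B t x) by (apply Rmult_lt_0_compat; auto).
    destruct (Htest t x ltac:(lra)) as [Hle|(pu & pv & HU & HV & Hp)]; [lra|].
    destruct HU as (U & (U1 & ut & uzz & HUt & HU1 & HUzz & HPU) & HUe & (d1 & Hd1 & HUs) & HUz).
    destruct HV as (V & (V1 & vt & vzz & HVt & HV1 & HVzz & HPV) & HVe & (d2 & Hd2 & HVs) & HVz).
    assert (Ht' : 0 <= ut - vt - e * (K * B t x)).
    { pose (d := Rmin (Rmin d1 d2) t).
      assert (Hd : 0 < d) by (apply Rmin_pos; [apply Rmin_pos; lra|lra]).
      assert (d <= d1) by (eapply Rle_trans; [apply Rmin_l|apply Rmin_l]).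
      assert (d <= d2) by (eapply Rle_trans; [apply Rmin_l|apply Rmin_r]).
      assert (d <= t) by apply Rmin_r.
      apply (derive_ge0_of_left_max (fun s => U s x - V s x - e * B s x) t _ d Hd).
      - apply (derive_minus (fun s => U s x - V s x)).
        + apply derive_minus; assumption.
        + unfold B. auto_derive; [trivial|ring].
      - intros s Hs. specialize (HUs s ltac:(lra)). specialize (HVs s ltac:(lra)).
        specialize (Hbef' s x ltac:(lra)). lra. }
    destruct (second_order_max (fun z => U t z - V t z - e * B t z)
       (fun z => U1 z - V1 z - e * (exp (K * t) * (2 * z))) x
       (uzz - vzz - e * (exp (K * t) * 2))) as [Hz1 Hz2].
    { generalize (filter_and _ _ HUz HVz). apply filter_imp. intros z [h1 h2].
      specialize (Hat' z). lra. }
    { generalize (filter_and _ _ HU1 HV1). apply filter_imp. intros z [h1 h2].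
      apply (derive_minus (fun s => U t s - V t s)).
      - apply derive_minus; assumption.
      - unfold B. auto_derive; [trivial|ring]. }
    { apply (derive_minus (fun s => U1 s - V1 s)).
      - apply derive_minus; assumption.
      - auto_derive; [trivial|ring]. }
    specialize (Hp (e * B (t - h) (x - b))).
    assert (Hy0 : 0 < e * B (t - h) (x - b)) by (apply Rmult_lt_0_compat; auto).
    assert (Hle : u (t - h) (x - b) <= v (t - h) (x - b) + e * B (t - h) (x - b)).
    { destruct (Rle_lt_dec (t - h) 0) as [h1|h1].
      - assert (u (t - h) (x - b) <= v (t - h) (x - b)) by (apply Hinit; lra). lra.
      - destruct (Req_dec h 0) as [h2|h2].
        + rewrite h2, Rminus_0_r. specialize (Hat' (x - b)). lra.
        + specialize (Hbef' (t - h) (x - b) ltac:(lra)). lra. }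
    specialize (Hp ltac:(lra) Hle).
    assert (HBd : B (t - h) (x - b) <= (2 + 2 * b ^ 2) * B t x).
    { unfold B.
      replace ((2 + 2 * b ^ 2) * (exp (K * t) * (1 + x ^ 2)))
        with (exp (K * t) * ((2 + 2 * b ^ 2) * (1 + x ^ 2))) by ring.
      apply Rmult_le_compat.
      - left; apply exp_pos.
      - pose proof (pow2_ge_0 (x - b)); lra.
      - apply exp_mono. nra.
      - pose proof (pow2_ge_0 (x + b)). pose proof (pow2_ge_0 (b * x)). nra. }
    assert (L * (e * B (t - h) (x - b)) <= e * (L * (2 + 2 * b ^ 2)) * B t x).
    { replace (e * (L * (2 + 2 * b ^ 2)) * B t x) with (L * (e * ((2 + 2 * b ^ 2) * B t x))) by ring.
      apply Rmult_le_compat_l; [exact HL|]. apply Rmult_le_compat_l; lra. }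
    assert (Hcz : - c * (exp (K * t) * (2 * x)) <= c * B t x).
    { unfold B. replace (c * (exp (K * t) * (1 + x ^ 2))) with (c * exp (K * t) * (1 + x ^ 2)) by ring.
      replace (- c * (exp (K * t) * (2 * x))) with (c * exp (K * t) * (- (2 * x))) by ring.
      apply Rmult_le_compat_l.
      - apply Rmult_le_pos; [lra|left; apply exp_pos].
      - pose proof (pow2_ge_0 (x + 1)). nra. }
    assert (H2B : exp (K * t) * 2 <= 2 * B t x).
    { unfold B. pose proof (exp_pos (K * t)). pose proof (pow2_ge_0 x). nra. }
    assert (Hcz' : - (c * (U1 x - V1 x)) <= e * (c * B t x)).
    { replace (U1 x - V1 x) with (e * (exp (K * t) * (2 * x))) by lra.
      replace (- (c * (e * (exp (K * t) * (2 * x))))) with (e * (- c * (exp (K * t) * (2 * x)))) by ring.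
      apply Rmult_le_compat_l; lra. }
    assert (H2B' : e * (exp (K * t) * 2) <= e * (2 * B t x)) by (apply Rmult_le_compat_l; lra).
    assert (HKB : e * (K * B t x) = 3 * (e * B t x) + e * (c * B t x) + e * (L * (2 + 2 * b ^ 2)) * B t x).
    { unfold K. ring. }
    lra.
Qed.

(** * Stationary inequalities *)

(* The time-dependent supersolution M e^(-t) reduces the stationary maximum principle to [comparison]. *)
Lemma steady_max (c : R) (D : R -> R) :
  0 <= c -> (forall z, continuous D z) -> (exists M, forall z, D z <= M) ->
  (forall z, 0 < D z -> exists (U U1 : R -> R) (uzz : R),
     locally z (fun y => is_derive U y (U1 y)) /\ is_derive U1 z uzz /\
     U z = D z /\ locally z (fun y => U y <= D y) /\ 0 <= uzz - c * U1 z - U z) ->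
  forall z, D z <= 0.
Proof.
  intros Hc Hcont [M HM] Ht z.
  pose (M' := Rmax M 0).
  assert (HM' : forall z, D z <= M') by (intros; eapply Rle_trans; [apply HM|apply Rmax_l]).
  assert (HM0 : 0 <= M') by apply Rmax_r.
  assert (Hcmp : forall T, 0 <= T -> D z <= M' * exp (- T)).
  { intros T HT.
    apply (comparison c 0 0 0 T (fun _ z => D z) (fun t _ => M' * exp (- t))); try lra.
    - intros p. cont.
    - exists M'. intros t y _. specialize (HM' y). assert (0 <= M' * exp (- t)) by pos. lra.
    - intros t y H. replace (- t) with 0 by lra. rewrite exp_0. specialize (HM' y). lra.
    - intros t y H.
      destruct (Rle_lt_dec (D y) 0) as [h|h].
      { left. assert (0 <= M' * exp (- t)) by pos. lra. }
      right. destruct (Ht y h) as (U & U1 & uzz & h1 & h2 & h3 & h4 & h5).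
      exists (0 - uzz + c * U1 y + U y), 0. split; [|split].
      + exists (fun _ => U). split; [|split; [exact h3|split; [|exact h4]]].
        * exists U1, 0, uzz. split; [|split; [exact h1|split; [exact h2|reflexivity]]].
          apply derive_const.
        * exists 1. split; [lra|]. intros. lra.
      + apply jet_super_test. exists (fun _ => 0), (- (M' * exp (- t))), 0. split; [|split; [|split]].
        * auto_derive; [trivial|ring].
        * apply filter_forall. intros. apply derive_const.
        * apply derive_const.
        * ring.
      + intros; lra. }
  apply Rnot_lt_le; intros Hpos.
  assert (HMp : 0 < M') by (specialize (HM' z); lra).
  specialize (Hcmp (Rmax 0 (ln (2 * M' / D z))) (Rmax_l _ _)).
  assert (exp (- Rmax 0 (ln (2 * M' / D z))) <= D z / (2 * M')).
  { apply Rle_trans with (exp (- ln (2 * M' / D z))).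
    - apply exp_mono. pose proof (Rmax_r 0 (ln (2 * M' / D z))). lra.
    - rewrite exp_Ropp, exp_ln.
      + right. field. lra.
      + apply Rdiv_lt_0_compat; lra. }
  assert (M' * exp (- Rmax 0 (ln (2 * M' / D z))) <= M' * (D z / (2 * M'))) by (apply Rmult_le_compat_l; lra).
  replace (M' * (D z / (2 * M'))) with (D z / 2) in H0 by (field; lra). lra.
Qed.

(** * Differential inequalities and the Harnack inequality *)

Lemma derive_le0_antitone (f f1 : R -> R) (a b : R) :
  (forall z, a <= z <= b -> is_derive f z (f1 z)) -> (forall z, a <= z <= b -> f1 z <= 0) ->
  a <= b -> f b <= f a.
Proof.
  intros Hf Hf1 Hab.
  destruct (mean_value f f1 a b Hf Hab) as [x [Hx Hm]].
  specialize (Hf1 x Hx). nra.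
Qed.

Lemma derive_ge0_monotone (f f1 : R -> R) (a b : R) :
  (forall z, a <= z <= b -> is_derive f z (f1 z)) -> (forall z, a <= z <= b -> 0 <= f1 z) ->
  a <= b -> f a <= f b.
Proof.
  intros Hf Hf1 Hab.
  assert (- f b <= - f a); [|lra].
  apply (derive_le0_antitone (fun x => - f x) (fun x => - f1 x)); auto.
  - intros z Hz. apply derive_opp. auto.
  - intros z Hz. specialize (Hf1 z Hz). lra.
Qed.

Lemma derive_bound_lip (f f1 : R -> R) (M a b : R) :
  (forall z, a <= z <= b -> is_derive f z (f1 z)) ->
  (forall z, a <= z <= b -> Rabs (f1 z) <= M) ->
  a <= b -> Rabs (f b - f a) <= M * (b - a).
Proof.
  intros Hf Hf1 Hab.
  destruct (mean_value f f1 a b Hf Hab) as [x [Hx Hm]].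
  rewrite Hm, Rabs_mult, (Rabs_right (b - a)) by lra.
  apply Rmult_le_compat_r; [lra|]. apply Hf1, Hx.
Qed.

(* y'' - c y' - y + F = 0, with [y1] the derivative of [y]. *)
Definition ode (c : R) (F y y1 : R -> R) : Prop :=
  (forall z, is_derive y z (y1 z)) /\
  (forall z, is_derive y1 z (c * y1 z + y z - F z)).

(** [nu1] and [nu2] are the roots of nu^2 - c nu - 1, the exponents of the homogeneous equation. *)
Definition nu1 (c : R) : R := (c - sqrt (c ^ 2 + 4)) / 2.
Definition nu2 (c : R) : R := (c + sqrt (c ^ 2 + 4)) / 2.

Lemma nu_facts (c : R) :
  nu1 c + nu2 c = c /\ nu1 c * nu2 c = -1 /\ nu1 c < 0 /\ 0 < nu2 c.
Proof.
  unfold nu1, nu2.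
  assert (Hs : sqrt (c ^ 2 + 4) * sqrt (c ^ 2 + 4) = c ^ 2 + 4).
  { apply sqrt_sqrt. pose proof (pow2_ge_0 c); lra. }
  assert (Rabs c < sqrt (c ^ 2 + 4)).
  { rewrite <- sqrt_Rsqr_abs. apply sqrt_lt_1_alt. unfold Rsqr. split; nra. }
  apply Rabs_def2 in H. repeat split; try lra; nra.
Qed.

Lemma ode_reflect (c : R) (F y y1 : R -> R) :
  ode c F y y1 -> ode (- c) (fun z => F (- z)) (fun z => y (- z)) (fun z => - y1 (- z)).
Proof.
  intros [Hy Hy1]. split; intros z.
  - evar_last; [apply (is_derive_comp y Ropp); [apply Hy|auto_derive; [trivial|reflexivity]]|].
    unfold scal; simpl; unfold mult; simpl. ring.
  - evar_last; [apply derive_opp, (is_derive_comp y1 Ropp); [apply Hy1|auto_derive; [trivial|reflexivity]]|].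
    unfold scal; simpl; unfold mult; simpl. ring.
Qed.

(* Factor the operator as (d/dz - nu1)(d/dz - nu2): if the second factor were negative somewhere, y would decrease linearly to -oo. *)
Lemma ode_harnack_left (c : R) (F y y1 : R -> R) :
  ode c F y y1 -> (forall z, 0 <= F z) -> (forall z, 0 <= y z) -> forall z, nu1 c * y z <= y1 z.
Proof.
  intros [Hy Hy1] HF Hpos z0.
  destruct (nu_facts c) as (Hs & Hp & Hn1 & Hn2).
  set (a := nu1 c) in *; set (b := nu2 c) in *.
  apply Rnot_lt_le; intros Hlt.
  set (u0 := y1 z0 - a * y z0) in *.
  assert (Hu0 : u0 < 0) by (unfold u0; lra).
  assert (Hu : forall z, z0 <= z -> y1 z - a * y z <= u0).
  { intros z Hz.
    assert (exp (- b * (z - z0)) * (y1 z - a * y z) <= u0).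
    { replace u0 with (exp (- b * (z0 - z0)) * (y1 z0 - a * y z0)).
      2:{ unfold u0. rewrite Rminus_diag, Rmult_0_r, exp_0. ring. }
      apply (derive_le0_antitone (fun z => exp (- b * (z - z0)) * (y1 z - a * y z))
        (fun z => - (exp (- b * (z - z0)) * F z))); [| |exact Hz].
      - intros x _. evar_last.
        + apply (derive_mult (fun z => exp (- b * (z - z0))) (fun z => y1 z - a * y z)).
          * auto_derive; [trivial|reflexivity].
          * apply derive_minus; [apply Hy1|]. apply is_derive_scal, Hy.
        + replace c with (a + b) by lra.
          apply Rminus_diag_uniq. transitivity ((a * b + 1) * (exp (- b * (x - z0)) * y x)); [unfold Rminus; ring|].
          rewrite Hp; ring.
      - intros x _. pose proof (exp_pos (- b * (x - z0))). specialize (HF x). nra. }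
    assert (exp (- b * (z - z0)) <= 1) by (apply exp_le1; nra).
    pose proof (exp_pos (- b * (z - z0))).
    apply Rnot_lt_le; intros Hn. nra. }
  (* Decreasing with slope at most [u0], y would reach -1 at this point. *)
  pose (z1 := z0 + (y z0 + 1) / (- u0)).
  assert (Hz1 : 0 < (y z0 + 1) / (- u0)).
  { apply Rdiv_lt_0_compat; specialize (Hpos z0); lra. }
  assert (y z1 - u0 * z1 <= y z0 - u0 * z0).
  { apply (derive_le0_antitone (fun z => y z - u0 * z) (fun z => y1 z - u0)).
    - intros z _. apply derive_minus; [apply Hy|]. auto_derive; [trivial|ring].
    - intros z Hz. specialize (Hu z ltac:(lra)). specialize (Hpos z). nra.
    - unfold z1; lra. }
  specialize (Hpos z1). unfold z1 in H at 2.
  replace (u0 * (z0 + (y z0 + 1) / - u0)) with (u0 * z0 - (y z0 + 1)) in H by (field; lra). lra.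
Qed.

(** The reflection z -> -z exchanges [nu2 c] with minus [nu1 (- c)], so the upper bound is a lower
    bound for the reflected equation. This control of y' by y replaces derivative estimates for
    profiles and fronts. *)
Lemma ode_harnack (c : R) (F y y1 : R -> R) :
  ode c F y y1 -> (forall z, 0 <= F z) -> (forall z, 0 <= y z) ->
  forall z, nu1 c * y z <= y1 z <= nu2 c * y z.
Proof.
  intros Ho HF Hpos z. split; [apply (ode_harnack_left c F); assumption|].
  pose proof (ode_harnack_left _ _ _ _ (ode_reflect c F y y1 Ho) (fun z => HF (- z)) (fun z => Hpos (- z)) (- z)) as H.
  cbv beta in H. rewrite !Ropp_involutive in H.
  replace (nu1 (- c)) with (- nu2 c) in H; [lra|].
  unfold nu1, nu2. replace ((- c) ^ 2) with (c ^ 2) by ring. field.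
Qed.

Lemma log_derivative_growth (y y1 : R -> R) (k a b : R) :
  (forall z, is_derive y z (y1 z)) -> (forall z, y1 z <= k * y z) -> a <= b ->
  y b <= y a * exp (k * (b - a)).
Proof.
  intros Hy Hk Hab.
  assert (exp (- k * (b - a)) * y b <= exp (- k * (a - a)) * y a).
  { apply (derive_le0_antitone (fun z => exp (- k * (z - a)) * y z)
      (fun z => exp (- k * (z - a)) * (y1 z - k * y z))); [| |exact Hab].
    - intros x _. evar_last.
      + apply (derive_mult (fun z => exp (- k * (z - a))) y);
          [auto_derive; [trivial|reflexivity]|apply Hy].
      + unfold plus, mult; simpl. unfold Rminus; ring.
    - intros x _. pose proof (exp_pos (- k * (x - a))). specialize (Hk x). nra. }
  rewrite Rminus_diag, Rmult_0_r, exp_0, Rmult_1_l in H.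
  replace (y b) with (exp (- k * (b - a)) * y b * exp (k * (b - a))).
  - apply Rmult_le_compat_r; [left; apply exp_pos|exact H].
  - replace (exp (- k * (b - a)) * y b * exp (k * (b - a)))
      with (y b * (exp (- k * (b - a)) * exp (k * (b - a)))) by ring.
    rewrite <- exp_plus. replace (- k * (b - a) + k * (b - a)) with 0 by ring.
    rewrite exp_0; ring.
Qed.

Lemma log_derivative_decay (y y1 : R -> R) (k a b : R) :
  (forall z, is_derive y z (y1 z)) -> (forall z, k * y z <= y1 z) -> a <= b ->
  y a * exp (k * (b - a)) <= y b.
Proof.
  intros Hy Hk Hab.
  assert (- y b <= - y a * exp (k * (b - a))); [|lra].
  apply (log_derivative_growth (fun z => - y z) (fun z => - y1 z)); auto.
  - intros z. apply derive_opp. auto.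
  - intros z. specialize (Hk z). lra.
Qed.

(** Strong maximum principle: the logarithmic derivative of y is bounded by the Harnack inequality,
    so a zero propagates both ways. *)
Lemma ode_zero (c : R) (F y y1 : R -> R) (z0 : R) :
  ode c F y y1 -> (forall z, 0 <= F z) -> (forall z, 0 <= y z) -> y z0 = 0 ->
  forall z, y z = 0.
Proof.
  intros Ho HF Hpos H0 z.
  assert (Hh := ode_harnack c F y y1 Ho HF Hpos). destruct Ho as [Hy _].
  apply Rle_antisym; [|apply Hpos].
  destruct (Rle_lt_dec z0 z) as [h|h].
  - assert (H := log_derivative_growth y y1 (nu2 c) z0 z Hy (fun z => proj2 (Hh z)) h).
    rewrite H0, Rmult_0_l in H. exact H.
  - assert (H := log_derivative_decay y y1 (nu1 c) z z0 Hy (fun z => proj1 (Hh z)) ltac:(lra)).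
    rewrite H0 in H. pose proof (exp_pos (nu1 c * (z0 - z))).
    apply Rnot_lt_le; intros Hn. nra.
Qed.

(** * The nonlinearity *)

(* What is used of hypothesis (H): [p] is g'(0) and [L] a global Lipschitz constant; the one-sided bounds hold on half-lines because g is linear beyond [0] and [kappa]. *)
Record monostable (g : R -> R) (kappa p L : R) : Prop := {
  ms_kappa : 0 < kappa;
  ms_mono : forall x y, x <= y -> g x <= g y;
  ms_0 : g 0 = 0;
  ms_kappa_fixed : g kappa = kappa;
  ms_L : 0 < L;
  ms_lip : forall u v, u <= v -> g v - g u <= L * (v - u);
  ms_p : 1 < p;
  ms_near0 : forall e, 0 < e -> exists d, 0 < d /\
    forall u v, u <= v -> v <= d -> g v - g u <= (p + e) * (v - u);
  ms_above : forall u, 0 < u < kappa -> u < g u;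
  ms_near_kappa : exists gam d, 0 <= gam < 1 /\ 0 < d < kappa /\
    forall u v, kappa - d <= u -> u <= v -> g v - g u <= gam * (v - u) }.

Arguments ms_kappa {g kappa p L}.
Arguments ms_mono {g kappa p L}.
Arguments ms_0 {g kappa p L}.
Arguments ms_kappa_fixed {g kappa p L}.
Arguments ms_lip {g kappa p L}.
Arguments ms_p {g kappa p L}.
Arguments ms_near0 {g kappa p L}.
Arguments ms_above {g kappa p L}.
Arguments ms_near_kappa {g kappa p L}.

Lemma lipschitz_continuous (f : R -> R) (L : R) :
  (forall x y, Rabs (f y - f x) <= L * Rabs (y - x)) -> forall x, continuous f x.
Proof.
  intros Hf x. apply continuity_pt_filterlim.
  intros e He. exists (e / (Rabs L + 1)).
  assert (0 < Rabs L + 1) by (pose proof (Rabs_pos L); lra).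
  split; [apply Rdiv_lt_0_compat; lra|].
  intros y [_ Hy]. simpl in *. unfold R_dist in *.
  apply Rle_lt_trans with (1 := Hf x y).
  apply Rle_lt_trans with ((Rabs L + 1) * Rabs (y - x)).
  - apply Rmult_le_compat_r; [apply Rabs_pos|]. pose proof (Rle_abs L); lra.
  - replace e with ((Rabs L + 1) * (e / (Rabs L + 1))) at 1 by (field; lra).
    apply Rmult_lt_compat_l; auto.
Qed.

Lemma monotone_lipschitz (f : R -> R) (L : R) :
  (forall x y, x <= y -> f x <= f y) -> (forall x y, x <= y -> f y - f x <= L * (y - x)) ->
  forall x y, Rabs (f y - f x) <= L * Rabs (y - x).
Proof.
  intros Hmono Hlip x y. destruct (Rle_lt_dec x y) as [h|h].
  - specialize (Hmono x y h). rewrite (Rabs_right (y - x)), Rabs_right by lra. apply Hlip, h.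
  - specialize (Hmono y x ltac:(lra)). rewrite Rabs_minus_sym, (Rabs_minus_sym y).
    rewrite (Rabs_right (x - y)), Rabs_right by lra. apply Hlip. lra.
Qed.

Lemma derive_close_increment (g : R -> R) (x0 d e : R) :
  0 < d -> 0 < e ->
  (forall x, Rabs (x - x0) < d -> ex_derive g x /\ continuous (Derive g) x) ->
  exists r, 0 < r /\ forall u v, x0 - r <= u -> u <= v -> v <= x0 + r ->
    (Derive g x0 - e) * (v - u) <= g v - g u <= (Derive g x0 + e) * (v - u).
Proof.
  intros Hd He Hg.
  destruct (Hg x0) as [_ Hc]; [rewrite Rminus_diag, Rabs_R0; exact Hd|].
  assert (Hl := proj1 (filterlim_locally _ _) Hc (mkposreal e He)).
  destruct Hl as [r Hr].
  exists (Rmin r d / 2).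
  assert (0 < Rmin r d) by (apply Rmin_pos; [apply cond_pos|exact Hd]).
  pose proof (Rmin_l r d); pose proof (Rmin_r r d).
  split; [lra|]. intros u v Hu Huv Hv.
  destruct (mean_value g (Derive g) u v) as [x [Hx Hm]]; [|exact Huv|].
  { intros x Hx. apply Derive_correct, Hg, Rabs_def1; lra. }
  assert (Hb : Rabs (Derive g x - Derive g x0) < e).
  { apply Hr. apply Rabs_def1; simpl; unfold minus, plus, opp; simpl; lra. }
  apply Rabs_def2 in Hb. rewrite Hm. split; apply Rmult_le_compat_r; lra.
Qed.

(** Increment bounds on the pieces are glued at 0 and kappa. Between them g x > x: the slope at 0
    puts the graph above the diagonal near 0, and a later crossing would be a third fixed point. *)
Lemma hypH_monostable (g : R -> R) (kappa : R) :
  (forall x y, x <= y -> g x <= g y) -> hypH g kappa ->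
  exists L, monostable g kappa (Derive g 0) L.
Proof.
  intros Hmono (Hk & Hpos & Hfix & d0 & Hd0 & Hd1 & Hd2 & Hp & Hpk & [Lg HLg] & _ & Hneg & Hbig).
  set (p := Derive g 0) in *. set (q := Derive g kappa) in *.
  assert (H0 : g 0 = 0) by (rewrite Hneg; lra).
  assert (Hkk : g kappa = kappa) by (rewrite Hbig; lra).
  assert (Hd1' : forall x, Rabs (x - 0) < d0 -> ex_derive g x /\ continuous (Derive g) x).
  { intros x Hx. apply Hd1. rewrite Rminus_0_r in Hx; exact Hx. }
  assert (Hq0 : 0 <= q).
  { assert (g kappa <= g (kappa + 1)) by (apply Hmono; lra).
    rewrite (Hbig (kappa + 1)) in H by lra. lra. }
  pose (L := p + Rabs Lg + q).
  assert (HL : 0 < L) by (unfold L; pose proof (Rabs_pos Lg); lra).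
  assert (HLa : Lg <= L) by (unfold L; pose proof (Rle_abs Lg); lra).
  assert (HLb : p <= L) by (unfold L; pose proof (Rabs_pos Lg); lra).
  assert (Hlip : forall u v, u <= v -> g v - g u <= L * (v - u)).
  { assert (A : forall u v, u <= v -> v <= 0 -> g v - g u <= L * (v - u)).
    { intros u v Huv Hv. rewrite (Hneg u), (Hneg v) by lra. nra. }
    assert (B : forall u v, 0 <= u -> u <= v -> v <= kappa -> g v - g u <= L * (v - u)).
    { intros u v Hu Huv Hv. specialize (HLg v u ltac:(lra) ltac:(lra)).
      rewrite (Rabs_right (v - u)) in HLg by lra.
      pose proof (Rle_abs (g v - g u)). nra. }
    assert (C : forall u v, kappa <= u -> u <= v -> g v - g u <= L * (v - u)).
    { intros u v Hu Huv. rewrite (Hbig u), (Hbig v) by lra. nra. }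
    assert (AB : forall u v, u <= v -> v <= kappa -> g v - g u <= L * (v - u)).
    { intros u v Huv Hv. destruct (Rle_lt_dec v 0); [apply A; lra|].
      destruct (Rle_lt_dec 0 u); [apply B; lra|].
      specialize (A u 0 ltac:(lra) ltac:(lra)). specialize (B 0 v ltac:(lra) ltac:(lra) ltac:(lra)). lra. }
    intros u v Huv. destruct (Rle_lt_dec v kappa); [apply AB; lra|].
    destruct (Rle_lt_dec kappa u); [apply C; lra|].
    specialize (AB u kappa ltac:(lra) ltac:(lra)). specialize (C kappa v ltac:(lra) ltac:(lra)). lra. }
  assert (Hup : forall e, 0 < e -> exists d, 0 < d /\
    forall u v, u <= v -> v <= d -> g v - g u <= (p + e) * (v - u)).
  { intros e He. destruct (derive_close_increment g 0 d0 e Hd0 He Hd1') as [r [Hr Hi]].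
    exists r. split; [exact Hr|]. intros u v Huv Hv.
    fold p in Hi.
    destruct (Rle_lt_dec v 0).
    - rewrite (Hneg u), (Hneg v) by lra. nra.
    - destruct (Rle_lt_dec 0 u).
      + apply Hi; lra.
      + specialize (Hi 0 v ltac:(lra) ltac:(lra) ltac:(lra)).
        rewrite (Hneg u) by lra. rewrite H0 in Hi. nra. }
  assert (Hin : exists d, 0 < d /\ forall u v, 0 <= u -> u <= v -> v <= d ->
     (1 + p) / 2 * (v - u) <= g v - g u).
  { destruct (derive_close_increment g 0 d0 ((p - 1) / 2) Hd0 ltac:(lra) Hd1') as [r [Hr Hi]].
    exists r. split; [exact Hr|]. intros u v Hu Huv Hv. fold p in Hi.
    specialize (Hi u v ltac:(lra) ltac:(lra) ltac:(lra)).
    replace ((1 + p) / 2) with (p - (p - 1) / 2) by field. lra. }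
  exists L. constructor; auto.
  - intros u Hu.
    apply Rnot_le_lt; intros Hgu.
    assert (g u <> u). { intros He. apply Hfix in He; lra. }
    destruct Hin as [d [Hd Hi]].
    pose (x0 := Rmin (u / 2) d).
    assert (Hx0 : 0 < x0) by (apply Rmin_pos; lra).
    assert (x0 <= u / 2) by apply Rmin_l. assert (x0 <= d) by apply Rmin_r.
    specialize (Hi 0 x0 ltac:(lra) ltac:(lra) ltac:(lra)). rewrite H0 in Hi.
    assert (Hgx : x0 < g x0) by nra.
    destruct (IVT (fun x => x - g x) x0 u) as [z [Hz Hz0]].
    + intros x. apply continuity_pt_minus; [apply continuity_pt_id|].
      apply continuity_pt_filterlim. apply (lipschitz_continuous g L), monotone_lipschitz; assumption.
    + lra.
    + lra.
    + lra.
    + assert (g z = z) by lra. apply Hfix in H3; lra.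
  - destruct (derive_close_increment g kappa d0 ((1 - q) / 2) Hd0 ltac:(lra) Hd2) as [r [Hr Hi]].
    fold q in Hi.
    (* The midpoint of g'(kappa) and 1 bounds the slope near kappa and on the linear part beyond
       it. *)
    exists ((1 + q) / 2), (Rmin r (kappa / 2)).
    assert (0 < Rmin r (kappa / 2)) by (apply Rmin_pos; lra).
    pose proof (Rmin_l r (kappa / 2)); pose proof (Rmin_r r (kappa / 2)).
    split; [lra|]. split; [lra|].
    intros u v Hu Huv.
    assert (C : forall u v, kappa <= u -> u <= v -> g v - g u <= (1 + q) / 2 * (v - u)).
    { intros u' v' Hu' Huv'. rewrite (Hbig u'), (Hbig v') by lra. nra. }
    assert (B : forall u v, kappa - r <= u -> u <= v -> v <= kappa -> g v - g u <= (1 + q) / 2 * (v - u)).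
    { intros u' v' Hu' Huv' Hv'. specialize (Hi u' v' Hu' Huv' ltac:(lra)).
      replace ((1 + q) / 2) with (q + (1 - q) / 2) by field. lra. }
    destruct (Rle_lt_dec v kappa); [apply B; lra|].
    destruct (Rle_lt_dec kappa u); [apply C; lra|].
    specialize (B u kappa ltac:(lra) ltac:(lra) ltac:(lra)). specialize (C kappa v ltac:(lra) ltac:(lra)). lra.
Qed.

Lemma monostable_lip {g kappa p L} :
  monostable g kappa p L -> forall x y, Rabs (g y - g x) <= L * Rabs (y - x).
Proof. intros Hg. apply monotone_lipschitz; apply Hg. Qed.

Lemma monostable_continuous {g : R -> R} {kappa p L : R} :
  monostable g kappa p L -> forall x, continuous g x.
Proof. intros Hg. apply (lipschitz_continuous g L), (monostable_lip Hg). Qed.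

Lemma continuous_Rmin {T : UniformSpace} (f1 f2 : T -> R) (z : T) :
  continuous f1 z -> continuous f2 z -> continuous (fun x => Rmin (f1 x) (f2 x)) z.
Proof.
  intros H1 H2.
  apply (continuous_ext (fun x => (f1 x + f2 x - Rabs (f1 x - f2 x)) * / 2)).
  { intros t. unfold Rmin. destruct (Rle_dec (f1 t) (f2 t)).
    - rewrite Rabs_left1; lra.
    - rewrite Rabs_right; lra. }
  apply cont_mult; [|apply continuous_const].
  apply cont_minus.
  - apply cont_plus; assumption.
  - apply (continuous_comp (fun x => f1 x - f2 x) Rabs); [|apply continuous_Rabs].
    apply cont_minus; assumption.
Qed.

(** * The characteristic function *)

(** The characteristic function with the slope at 0 as a parameter, so that p + e can absorb the
    error of linearization. *)
Definition symbol (p c h z : R) : R := z ^ 2 - c * z - 1 + p * exp (- z * c * h).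

(* Strict convexity of the characteristic function. *)
Lemma symbol_neg_between (p c h l1 l2 l : R) :
  0 <= p -> symbol p c h l1 = 0 -> symbol p c h l2 = 0 -> l1 < l < l2 -> symbol p c h l < 0.
Proof.
  intros Hp H1 H2 Hl. unfold symbol in *.
  set (E := exp (- l * c * h)) in *.
  assert (A : forall z, E * (1 + (- z * c * h - - l * c * h)) <= exp (- z * c * h)).
  { intros z. replace (exp (- z * c * h)) with (E * exp (- z * c * h - - l * c * h)).
    - apply Rmult_le_compat_l; [left; apply exp_pos|]. apply exp_ineq1_le.
    - unfold E. rewrite <- exp_plus. f_equal; ring. }
  pose proof (A l1) as A1. pose proof (A l2) as A2.
  apply (Rmult_le_compat_l p) in A1; [|exact Hp].
  apply (Rmult_le_compat_l p) in A2; [|exact Hp].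
  set (e1 := p * exp (- l1 * c * h)) in *. set (e2 := p * exp (- l2 * c * h)) in *.
  assert (0 < (l - l1) * (l2 - l) * (l2 - l1)) by (apply Rmult_lt_0_compat; [apply Rmult_lt_0_compat|]; lra).
  apply Rnot_le_lt; intros Hn.
  nra.
Qed.

(** For c <= 0 and z > 0 the exponential factor is at least 1 and z^2 - c z > 0, so chi cannot
    vanish. *)
Lemma c_sharp_pos (g : R -> R) (h cs : R) :
  0 <= h -> 1 < Derive g 0 -> is_c_sharp g h cs -> 0 < cs.
Proof.
  intros Hh Hp (z & Hz & Hchi & _). unfold chi in Hchi.
  apply Rnot_le_lt; intros Hn.
  assert (1 <= exp (- z * cs * h)).
  { apply exp_ge1.
    replace (- z * cs * h) with (z * (- cs) * h) by ring.
    apply Rmult_le_pos; [apply Rmult_le_pos; lra|exact Hh]. }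
  nra.
Qed.

(** * The resolvent of y'' - c y' - y *)

Lemma exp_small (r e : R) : 0 < r -> 0 < e -> exists N, 0 <= N /\ forall x, N <= x -> exp (- r * x) < e.
Proof.
  intros Hr He.
  exists (Rmax 0 ((1 - ln e) / r)). split; [apply Rmax_l|].
  intros x Hx.
  assert ((1 - ln e) / r <= x) by (eapply Rle_trans; [apply Rmax_r|exact Hx]).
  rewrite <- (exp_ln e He) at 1. apply exp_increasing.
  apply (Rmult_le_compat_l r) in H; [|lra].
  replace (r * ((1 - ln e) / r)) with (1 - ln e) in H by (field; lra). lra.
Qed.

(** A(z) is the integral of e^(-r (z - s)) F(s) over s <= z. The improper integral is reached as the
    limit of the primitive [I] at -n, which is a Cauchy sequence because M e^(r s) / r majorizes the
    increments of [I]. *)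
Lemma damped_primitive (r M : R) (F : R -> R) :
  0 < r -> (forall z, continuous F z) -> (forall z, Rabs (F z) <= M) ->
  exists A, (forall z, is_derive A z (F z - r * A z)) /\ forall z, Rabs (A z) <= M / r.
Proof.
  intros Hr HF HM.
  pose (f := fun s => exp (r * s) * F s).
  assert (Hf : forall z, continuous f z).
  { intros z. apply (cont_mult (fun s => exp (r * s)) F); [|apply HF].
    smooth. }
  pose (I := fun z : R => (RInt (V := R_CompleteNormedModule) f 0 z) : R).
  assert (HI : forall z, is_derive I z (f z)).
  { intros z. apply (is_derive_RInt (V := R_NormedModule) f I 0 z); [|apply Hf].
    apply filter_forall. intros y. unfold I. apply (RInt_correct (V := R_CompleteNormedModule)).
    apply (ex_RInt_continuous (V := R_CompleteNormedModule)). intros; apply Hf. }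
  assert (HM0 : 0 <= M) by (apply Rle_trans with (Rabs (F 0)); [apply Rabs_pos|apply HM]).
  assert (HE : forall z, is_derive (fun s => M / r * exp (r * s)) z (M * exp (r * z))).
  { intros z. auto_derive; [trivial|]. field. lra. }
  assert (Hfb : forall z, - (M * exp (r * z)) <= f z <= M * exp (r * z)).
  { intros z. specialize (HM z). apply Rabs_le_between in HM. pose proof (exp_pos (r * z)).
    unfold f. split; nra. }
  assert (HIb : forall a b, a <= b -> Rabs (I b - I a) <= M / r * (exp (r * b) - exp (r * a))).
  { intros a b Hab. apply Rabs_le_between. split.
    - assert (I a + M / r * exp (r * a) <= I b + M / r * exp (r * b)); [|lra].
      apply (derive_ge0_monotone (fun z => I z + M / r * exp (r * z))
        (fun z => f z + M * exp (r * z))); [| |exact Hab].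
      + intros z _. apply derive_plus; [apply HI|apply HE].
      + intros z _. specialize (Hfb z). lra.
    - assert (I b - M / r * exp (r * b) <= I a - M / r * exp (r * a)); [|lra].
      apply (derive_le0_antitone (fun z => I z - M / r * exp (r * z))
        (fun z => f z - M * exp (r * z))); [| |exact Hab].
      + intros z _. apply derive_minus; [apply HI|apply HE].
      + intros z _. specialize (Hfb z). lra. }
  assert (HMr : 0 <= M / r) by (apply Rdiv_le_0_compat; lra).
  destruct (proj2 (ex_lim_seq_cauchy_corr (fun n => I (- INR n)))) as [l Hl].
  { intros [e He]. simpl.
    destruct (exp_small r (e / (M / r + 1)) Hr) as [N [_ HN]].
    { apply Rdiv_lt_0_compat; lra. }
    destruct (nfloor_ex (Rmax 0 N)) as [n Hn]; [apply Rmax_l|].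
    exists (S n).
    assert (Hall : forall a b : R, N <= a -> a <= b -> Rabs (I (- a) - I (- b)) < e).
    { intros a b Ha Hab. eapply Rle_lt_trans; [apply HIb; lra|].
      pose proof (exp_pos (r * - b)). specialize (HN a Ha).
      replace (- r * a) with (r * - a) in HN by ring.
      apply Rle_lt_trans with ((M / r + 1) * exp (r * - a)).
      - pose proof (exp_pos (r * - a)). nra.
      - replace e with ((M / r + 1) * (e / (M / r + 1))) by (field; lra).
        apply Rmult_lt_compat_l; lra. }
    assert (HNn : forall k, (S n <= k)%nat -> N <= INR k).
    { intros k Hk. apply le_INR in Hk. rewrite S_INR in Hk.
      pose proof (Rmax_r 0 N). lra. }
    intros n1 m1 h1 h2.
    destruct (Rle_lt_dec (INR n1) (INR m1)) as [h|h].
    - apply Hall; auto.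
    - rewrite Rabs_minus_sym. apply Hall; auto; lra. }
  exists (fun z => exp (- (r * z)) * (I z - l)). split.
  - intros z. evar_last.
    + apply (derive_mult (fun z => exp (- (r * z))) (fun z => I z - l)).
      * auto_derive; [trivial|reflexivity].
      * apply derive_minus; [apply HI|].
        apply derive_const.
    + unfold plus, mult, minus, plus, opp, zero; simpl. unfold f.
      assert (exp (- (r * z)) * exp (r * z) = 1) by apply exp_opp_mul.
      unfold Rminus.
      replace (exp (- (r * z)) * (exp (r * z) * F z + - 0))
        with (exp (- (r * z)) * exp (r * z) * F z) by ring. rewrite H. ring.
  - intros z.
    assert (Hz : Rabs (I z - l) <= M / r * exp (r * z)).
    { assert (Hlim : is_lim_seq (fun n => Rabs (I z - I (- INR n))) (Rabs (I z - l))).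
      { apply (is_lim_seq_abs _ (Finite (I z - l))).
        apply is_lim_seq_minus'; [apply is_lim_seq_const|exact Hl]. }
      apply (is_lim_seq_le_loc (fun n => Rabs (I z - I (- INR n))) (fun _ => M / r * exp (r * z))
        (Rabs (I z - l)) (M / r * exp (r * z))); [|exact Hlim|apply is_lim_seq_const].
      destruct (nfloor_ex (Rmax 0 (- z))) as [n Hn]; [apply Rmax_l|].
      exists (S n). intros k Hk. apply le_INR in Hk. rewrite S_INR in Hk.
      pose proof (Rmax_r 0 (- z)).
      eapply Rle_trans; [apply HIb; lra|].
      apply Rmult_le_compat_l; [exact HMr|]. pose proof (exp_pos (r * - INR k)). lra. }
    rewrite Rabs_mult, Rabs_right by (left; apply exp_pos).
    replace (M / r) with (exp (- (r * z)) * (M / r * exp (r * z))).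
    + apply Rmult_le_compat_l; [left; apply exp_pos|exact Hz].
    + replace (exp (- (r * z)) * (M / r * exp (r * z))) with (M / r * (exp (- (r * z)) * exp (r * z))) by ring.
      rewrite exp_opp_mul; ring.
Qed.

Definition bounded_fun (y : R -> R) : Prop := exists M, forall z, Rabs (y z) <= M.

(** The two halves of the Green function: A integrates F from the left with exponent [nu1 c], the
    reflected B from the right with exponent [nu2 c], and their sum is divided by
    [nu2 c - nu1 c]. *)
Lemma resolvent_exists (c : R) (F : R -> R) :
  (forall z, continuous F z) -> bounded_fun F -> exists y y1, ode c F y y1 /\ bounded_fun y.
Proof.
  intros HF [M HM].
  destruct (nu_facts c) as (Hs & Hp & Hn1 & Hn2).
  destruct (damped_primitive (- nu1 c) M F) as [A [HA HAb]]; [lra|exact HF|exact HM|].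
  destruct (damped_primitive (nu2 c) M (fun z => F (- z))) as [B [HB HBb]]; [lra| |intros; apply HM|].
  { intros z. apply (continuous_comp Ropp F); [|apply HF].
    apply (cont_opp (fun x => x)), continuous_id. }
  set (a := nu1 c) in *; set (b := nu2 c) in *.
  assert (HB' : forall z, is_derive (fun z => B (- z)) z (b * B (- z) - F z)).
  { intros z. evar_last.
    - apply (is_derive_comp B Ropp); [apply HB|]. auto_derive; [trivial|reflexivity].
    - unfold scal; simpl; unfold mult; simpl. rewrite Ropp_involutive. ring. }
  exists (fun z => (A z + B (- z)) * / (b - a)), (fun z => (a * A z + b * B (- z)) * / (b - a)).
  split; [split|].
  - intros z. evar_last.
    + apply (derive_mult (fun z => A z + B (- z)) (fun _ => / (b - a))).
      * apply derive_plus; [apply HA|apply HB'].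
      * apply derive_const.
    + unfold plus, mult, zero; simpl. field. lra.
  - intros z. evar_last.
    + apply (derive_mult (fun z => a * A z + b * B (- z)) (fun _ => / (b - a))).
      * apply derive_plus;
          apply is_derive_scal; [apply HA|apply HB'].
      * apply derive_const.
    + unfold plus, mult, zero; simpl.
      rewrite <- Hs.
      apply Rminus_diag_uniq.
      transitivity (- (a * b + 1) * (A z + B (- z)) / (b - a)); [field; lra|].
      rewrite Hp; field; lra.
  - exists ((M / - a + M / b) * / (b - a)). intros z.
    rewrite Rabs_mult, (Rabs_right (/ (b - a))).
    2:{ apply Rle_ge, Rlt_le, Rinv_0_lt_compat. lra. }
    apply Rmult_le_compat_r; [apply Rlt_le, Rinv_0_lt_compat; lra|].
    eapply Rle_trans; [apply Rabs_triang|]. apply Rplus_le_compat; auto.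
Qed.

(** A bounded solution picked by choice; it is used only through its specification and, for c >= 0,
    through uniqueness of bounded solutions. *)
Definition resolvent (c : R) (F : R -> R) : R -> R :=
  epsilon (inhabits (fun _ => 0)) (fun y => exists y1, ode c F y y1 /\ bounded_fun y).

Lemma resolvent_spec (c : R) (F : R -> R) :
  (forall z, continuous F z) -> bounded_fun F ->
  exists y1, ode c F (resolvent c F) y1 /\ bounded_fun (resolvent c F).
Proof.
  intros HF Hb. unfold resolvent. apply epsilon_spec.
  destruct (resolvent_exists c F HF Hb) as (y & y1 & h1 & h2). exists y, y1; auto.
Qed.

(** [steady_max] applied to y - Y, which y - V touches from below. The inequality is asked only
    where y exceeds Y, so a barrier may be valid on part of the line only. *)
Lemma ode_below (c : R) (F y y1 Y : R -> R) :
  0 <= c -> ode c F y y1 -> (forall z, continuous Y z) -> (exists M, forall z, y z - Y z <= M) ->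
  (forall z, Y z < y z -> exists (V V1 : R -> R) (vzz : R),
     locally z (fun x => is_derive V x (V1 x)) /\ is_derive V1 z vzz /\
     V z = Y z /\ locally z (fun x => Y x <= V x) /\ vzz - c * V1 z - V z + F z <= 0) ->
  forall z, y z <= Y z.
Proof.
  intros Hc [Hy Hy1] HY HM Ht z.
  assert (y z - Y z <= 0); [|lra].
  revert z. apply (steady_max c); auto.
  - intros z. apply cont_minus; [|apply HY].
    eapply is_derive_cont, Hy.
  - intros z Hz. destruct (Ht z ltac:(lra)) as (V & V1 & vzz & h1 & h2 & h3 & h4 & h5).
    exists (fun x => y x - V x), (fun x => y1 x - V1 x), (c * y1 z + y z - F z - vzz).
    split; [|split; [|split; [|split]]].
    + revert h1. apply filter_imp. intros x Hx.
      apply derive_minus; auto.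
    + apply derive_minus; auto.
    + rewrite h3. reflexivity.
    + revert h4. apply filter_imp. intros; lra.
    + lra.
Qed.

(** * Operations, order and uniqueness for stationary solutions *)

Lemma ode_opp (c : R) (F y y1 : R -> R) :
  ode c F y y1 -> ode c (fun z => - F z) (fun z => - y z) (fun z => - y1 z).
Proof.
  intros [h1 h2]. split; intros z.
  - apply derive_opp, h1.
  - evar_last; [apply derive_opp, h2|].
    unfold opp; simpl; ring.
Qed.

Lemma ode_minus (c : R) (F y y1 G z z1 : R -> R) :
  ode c F y y1 -> ode c G z z1 -> ode c (fun x => F x - G x) (fun x => y x - z x) (fun x => y1 x - z1 x).
Proof.
  intros [h1 h2] [h3 h4]. split; intros x.
  - apply derive_minus; auto.
  - evar_last; [apply derive_minus; [apply h2|apply h4]|].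
    unfold minus, plus, opp; simpl; ring.
Qed.

Lemma ode_const (c k : R) : ode c (fun _ => k) (fun _ => k) (fun _ => 0).
Proof.
  split; intros z.
  - apply derive_const.
  - replace (c * 0 + k - k) with 0 by ring. apply derive_const.
Qed.

Lemma ode_shift (c a : R) (F y y1 : R -> R) :
  ode c F y y1 -> ode c (fun z => F (z + a)) (fun z => y (z + a)) (fun z => y1 (z + a)).
Proof.
  intros [h1 h2]. split; intros z; evar_last.
  - apply (is_derive_comp y (fun z => z + a)); [apply h1|]. auto_derive; [trivial|reflexivity].
  - unfold scal; simpl; unfold mult; simpl. ring.
  - apply (is_derive_comp y1 (fun z => z + a)); [apply h2|]. auto_derive; [trivial|reflexivity].
  - unfold scal; simpl; unfold mult; simpl. ring.
Qed.

Lemma ode_mono (c : R) (F y y1 G z z1 : R -> R) :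
  0 <= c -> ode c F y y1 -> ode c G z z1 -> bounded_fun y -> bounded_fun z ->
  (forall x, F x <= G x) -> forall x, y x <= z x.
Proof.
  intros Hc Hy Hz [M1 HM1] [M2 HM2] HFG.
  apply (ode_below c F y y1 z Hc Hy).
  - intros x. exact (is_derive_cont _ _ _ (proj1 Hz x)).
  - exists (M1 + M2). intros x. specialize (HM1 x). specialize (HM2 x).
    apply Rabs_le_between in HM1. apply Rabs_le_between in HM2. lra.
  - intros x _. destruct Hz as [h1 h2]. exists z, z1, (c * z1 x + z x - G x).
    split; [apply filter_forall, h1|]. split; [apply h2|]. split; [reflexivity|].
    split; [apply filter_forall; intros; lra|]. specialize (HFG x). lra.
Qed.

Lemma ode_unique (c : R) (F y y1 z z1 : R -> R) :
  0 <= c -> ode c F y y1 -> ode c F z z1 -> bounded_fun y -> bounded_fun z -> forall x, y x = z x.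
Proof.
  intros Hc Hy Hz By Bz x. apply Rle_antisym.
  - apply (ode_mono c F y y1 F z z1); auto. intros; lra.
  - apply (ode_mono c F z z1 F y y1); auto. intros; lra.
Qed.

(** A rate r with r^2 + c r <= 1/2: the operator y'' - c y' - y maps e^(r z) and e^(-r z) below
    minus one half of themselves. *)
Definition loc_rate (c : R) : R := / (2 * (1 + c)).

(** Forcing at distance more than [R0] is felt at [z0] only through an exponentially small term. The
    barrier is m plus k times the two exponentials centred at [z0], with k such that half of this
    sum exceeds B beyond [R0]; at [z0] it equals m + 2 k. *)
Lemma ode_local_le (c B m R0 z0 : R) (F y y1 : R -> R) :
  0 <= c -> ode c F y y1 -> bounded_fun y -> 0 <= B -> 0 <= m ->
  (forall z, F z <= B) -> (forall z, Rabs (z - z0) <= R0 -> F z <= m) ->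
  y z0 <= m + 4 * B * exp (- loc_rate c * R0).
Proof.
  intros Hc Hy [M HM] HB Hm HFB HFm.
  set (r := loc_rate c).
  assert (Hr : 0 < r) by (apply Rinv_0_lt_compat; lra).
  assert (Hr2 : r ^ 2 + c * r <= 1 / 2).
  { assert (Hr1 : r * (2 * (1 + c)) = 1) by (unfold r, loc_rate; field; lra). nra. }
  set (k := 2 * B * exp (- r * R0)).
  assert (Hk : 0 <= k) by (unfold k; pose proof (exp_pos (- r * R0)); nra).
  pose (V := fun z => m + k * (exp (r * (z - z0)) + exp (- r * (z - z0)))).
  replace (m + 4 * B * exp (- r * R0)) with (V z0).
  2:{ unfold V, k. rewrite Rminus_diag, !Rmult_0_r, exp_0. ring. }
  pose (V1 := fun z => k * r * (exp (r * (z - z0)) - exp (- r * (z - z0)))).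
  pose (V2 := fun z => k * r ^ 2 * (exp (r * (z - z0)) + exp (- r * (z - z0)))).
  assert (HV : forall z, is_derive V z (V1 z)).
  { intros z. unfold V, V1. auto_derive; [trivial|]. unfold Rminus; ring. }
  assert (HV1 : forall z, is_derive V1 z (V2 z)).
  { intros z. unfold V1, V2. auto_derive; [trivial|]. unfold Rminus; ring. }
  revert z0 HFm V V1 V2 HV HV1. intros z0 HFm V V1 V2 HV HV1.
  apply (ode_below c F y y1 V Hc Hy).
  - intros z. eapply is_derive_cont, HV.
  - exists M. intros z. specialize (HM z). apply Rabs_le_between in HM.
    assert (0 <= V z); [|lra]. unfold V.
    pose proof (exp_pos (r * (z - z0))); pose proof (exp_pos (- r * (z - z0))). nra.
  - intros z _. exists V, V1, (V2 z).
    split; [apply filter_forall, HV|]. split; [apply HV1|]. split; [reflexivity|].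
    split; [apply filter_forall; intros; lra|].
    unfold V, V1, V2.
    set (e1 := exp (r * (z - z0))). set (e2 := exp (- r * (z - z0))).
    assert (He1 : 0 < e1) by apply exp_pos. assert (He2 : 0 < e2) by apply exp_pos.
    assert (Hmain : k * r ^ 2 * (e1 + e2) - c * (k * r * (e1 - e2)) - (m + k * (e1 + e2))
       <= - m - k / 2 * (e1 + e2)).
    { assert (k * e1 * (r ^ 2 - c * r - 1) <= k * e1 * (- (1 / 2))).
      { apply Rmult_le_compat_l; [nra|]. nra. }
      assert (k * e2 * (r ^ 2 + c * r - 1) <= k * e2 * (- (1 / 2))).
      { apply Rmult_le_compat_l; [nra|]. nra. }
      nra. }
    destruct (Rle_lt_dec (Rabs (z - z0)) R0) as [h|h].
    + specialize (HFm z h). nra.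
    + specialize (HFB z).
      assert (1 <= exp (- r * R0) * (e1 + e2)).
      { destruct (Rle_lt_dec 0 (z - z0)) as [h1|h1].
        - rewrite Rabs_right in h by lra.
          assert (1 <= exp (- r * R0) * e1).
          { unfold e1. rewrite <- exp_plus, <- exp_0. apply exp_mono. nra. }
          nra.
        - rewrite Rabs_left in h by lra.
          assert (1 <= exp (- r * R0) * e2).
          { unfold e2. rewrite <- exp_plus, <- exp_0. apply exp_mono. nra. }
          nra. }
      assert (B <= k / 2 * (e1 + e2)).
      { unfold k. replace (2 * B * exp (- r * R0) / 2 * (e1 + e2)) with (B * (exp (- r * R0) * (e1 + e2))) by field.
        rewrite <- (Rmult_1_r B) at 1. apply Rmult_le_compat_l; lra. }
      lra.
Qed.

Lemma ode_local (c B m R0 z0 : R) (F y y1 : R -> R) :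
  0 <= c -> ode c F y y1 -> bounded_fun y -> 0 <= B -> 0 <= m ->
  (forall z, Rabs (F z) <= B) -> (forall z, Rabs (z - z0) <= R0 -> Rabs (F z) <= m) ->
  Rabs (y z0) <= m + 4 * B * exp (- loc_rate c * R0).
Proof.
  intros Hc Hy Hb HB Hm H1 H2. apply Rabs_le. split.
  - assert (- y z0 <= m + 4 * B * exp (- loc_rate c * R0)); [|lra].
    apply (ode_local_le c B m R0 z0 (fun z => - F z) (fun z => - y z) (fun z => - y1 z)); auto.
    + apply ode_opp, Hy.
    + destruct Hb as [M HM]. exists M. intros; rewrite Rabs_Ropp; apply HM.
    + intros z. specialize (H1 z). apply Rabs_le_between in H1. lra.
    + intros z Hz. specialize (H2 z Hz). apply Rabs_le_between in H2. lra.
  - apply (ode_local_le c B m R0 z0 F y y1); auto.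
    + intros z. eapply Rle_trans; [apply Rle_abs|apply H1].
    + intros z Hz. eapply Rle_trans; [apply Rle_abs|apply H2, Hz].
Qed.

(** * Wavefronts *)

Lemma attains_max (f : R -> R) (x0 R0 : R) :
  (forall z, continuous f z) -> (forall z, R0 <= Rabs z -> f z <= f x0) ->
  exists zm, forall z, f z <= f zm.
Proof.
  intros Hf Hout.
  pose (R1 := Rmax R0 (Rabs x0)).
  assert (HR : Rabs x0 <= R1) by apply Rmax_r.
  assert (HR0 : R0 <= R1) by apply Rmax_l.
  pose proof (Rabs_pos x0).
  destruct (continuity_ab_maj f (- R1) R1) as [zm [Hm _]].
  - lra.
  - intros z _. apply continuity_pt_filterlim, Hf.
  - exists zm. intros z. destruct (Rle_lt_dec (Rabs z) R1) as [h|h].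
    + apply Hm. apply Rabs_le_between in h. lra.
    + apply Rle_trans with (f x0); [apply Hout; lra|].
      apply Hm. apply Rabs_le_between in HR. lra.
Qed.

Lemma continuous_pos_min (f : R -> R) (a b : R) :
  a <= b -> (forall z, continuous f z) -> (forall z, a <= z <= b -> 0 < f z) ->
  exists m, 0 < m /\ forall z, a <= z <= b -> m <= f z.
Proof.
  intros Hab Hf Hpos.
  destruct (continuity_ab_min f a b Hab) as [zm [Hm Hz]].
  - intros z _. apply continuity_pt_filterlim, Hf.
  - exists (f zm). split; auto.
Qed.

Record wave (g : R -> R) (kappa c h : R) (phi phi1 : R -> R) : Prop := {
  wv_ode : ode c (fun z => g (phi (z - c * h))) phi phi1;
  wv_pos : forall z, 0 < phi z;
  wv_lt : forall z, phi z < kappa;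
  wv_left : forall e, 0 < e -> exists Z, 0 < Z /\ forall z, z <= - Z -> phi z < e;
  wv_right : forall e, 0 < e -> exists Z, 0 < Z /\ forall z, Z <= z -> kappa - e < phi z }.

Arguments wv_ode {g kappa c h phi phi1}.
Arguments wv_pos {g kappa c h phi phi1}.
Arguments wv_lt {g kappa c h phi phi1}.
Arguments wv_left {g kappa c h phi phi1}.
Arguments wv_right {g kappa c h phi phi1}.

(** The bound by kappa has to be derived. At a maximum above kappa the equation gives phi <= g(phi),
    against the slope below 1 beyond kappa; equality at a point would spread by the strong maximum
    principle for kappa - phi. *)
Lemma wavefront_wave {g : R -> R} {kappa p L : R} (c h : R) (phi : R -> R) :
  monostable g kappa p L -> is_wavefront g kappa h c phi -> wave g kappa c h phi (Derive phi).
Proof.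
  intros Hg (Hd & Heq & Hpos & Hl & Hr).
  assert (Hode : ode c (fun z => g (phi (z - c * h))) phi (Derive phi)).
  { split; intros z; [apply Derive_correct, Hd|].
    specialize (Heq z). replace (c * Derive phi z + phi z - g (phi (z - c * h)))
      with (Derive (Derive phi) z) by lra. apply Derive_correct, Hd. }
  assert (Hcont : forall z, continuous phi z).
  { intros z. apply (ex_derive_continuous (V := R_NormedModule)), Hd. }
  assert (Hleft : forall e, 0 < e -> exists Z, 0 < Z /\ forall z, z <= - Z -> phi z < e).
  { intros e He. apply is_lim_spec in Hl. specialize (Hl (mkposreal e He)). destruct Hl as [M HM].
    exists (Rabs M + 1). pose proof (Rabs_pos M). split; [lra|].
    intros z Hz. specialize (HM z). simpl in HM.
    pose proof (Rle_abs (- M)). rewrite Rabs_Ropp in H0.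
    specialize (HM ltac:(lra)). apply Rabs_def2 in HM. lra. }
  assert (Hright : forall e, 0 < e -> exists Z, 0 < Z /\ forall z, Z <= z -> Rabs (phi z - kappa) < e).
  { intros e He. apply is_lim_spec in Hr. specialize (Hr (mkposreal e He)). destruct Hr as [M HM].
    exists (Rabs M + 1). pose proof (Rabs_pos M). split; [lra|].
    intros z Hz. apply HM. pose proof (Rle_abs M). lra. }
  assert (Hle : forall z, phi z <= kappa).
  { intros x0. apply Rnot_lt_le; intros Hx0.
    pose proof (ms_kappa Hg) as Hk.
    destruct (Hleft (phi x0) ltac:(lra)) as [Z1 [HZ1 HL1]].
    destruct (Hright (phi x0 - kappa) ltac:(lra)) as [Z2 [HZ2 HR2]].
    destruct (attains_max phi x0 (Rmax Z1 Z2) Hcont) as [zm Hzm].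
    { intros z Hz. pose proof (Rmax_l Z1 Z2). pose proof (Rmax_r Z1 Z2).
      destruct (Rle_lt_dec 0 z) as [h0|h0].
      - rewrite Rabs_right in Hz by lra. specialize (HR2 z ltac:(lra)). apply Rabs_def2 in HR2. lra.
      - rewrite Rabs_left in Hz by lra. specialize (HL1 z ltac:(lra)). lra. }
    destruct (second_order_max phi (Derive phi) zm (c * Derive phi zm + phi zm - g (phi (zm - c * h)))) as [h1 h2].
    - apply filter_forall. auto.
    - apply filter_forall. apply Hode.
    - apply Hode.
    - rewrite h1 in h2.
      assert (g (phi (zm - c * h)) <= g (phi zm)) by (apply (ms_mono Hg), Hzm).
      destruct (ms_near_kappa Hg) as (gam & d & Hgam & Hd' & Hnk).
      specialize (Hnk kappa (phi zm) ltac:(lra)). specialize (Hzm x0).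
      specialize (Hnk ltac:(lra)). rewrite (ms_kappa_fixed Hg) in Hnk. nra. }
  constructor; auto.
  - intros z. destruct (Hle z) as [h0|h0]; [exact h0|exfalso].
    assert (Hz : forall x, kappa - phi x = 0).
    { apply (ode_zero c (fun x => kappa - g (phi (x - c * h))) _ (fun x => 0 - Derive phi x) z).
      - apply (ode_minus c (fun _ => kappa) (fun _ => kappa) (fun _ => 0)); [apply ode_const|exact Hode].
      - intros x. rewrite <- (ms_kappa_fixed Hg) at 1.
        pose proof (ms_mono Hg _ _ (Hle (x - c * h))). lra.
      - intros x. specialize (Hle x). lra.
      - lra. }
    pose proof (ms_kappa Hg) as Hk.
    destruct (Hleft kappa Hk) as [Z [_ HZ]]. specialize (HZ (- Z) ltac:(lra)).
    specialize (Hz (- Z)). lra.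
  - intros e He. destruct (Hright e He) as [Z [HZ HR]]. exists Z. split; [exact HZ|].
    intros z Hz. specialize (HR z Hz). apply Rabs_def2 in HR. lra.
Qed.

Lemma wave_continuous {g kappa c h phi phi1} : wave g kappa c h phi phi1 -> forall z, continuous phi z.
Proof. intros W z. exact (is_derive_cont _ _ _ (proj1 (wv_ode W) z)). Qed.

Lemma wave_harnack {g kappa p L c h phi phi1} :
  monostable g kappa p L -> wave g kappa c h phi phi1 ->
  forall z, nu1 c * phi z <= phi1 z <= nu2 c * phi z.
Proof.
  intros Hg W. apply (ode_harnack c (fun z => g (phi (z - c * h)))); [apply W| |].
  - intros z. rewrite <- (ms_0 Hg). apply (ms_mono Hg). left; apply W.
  - intros z; left; apply W.
Qed.

(** Harnack inequality for kappa - phi; it makes phi' small wherever phi is close to kappa. *)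
Lemma wave_harnack_right {g kappa p L c h phi phi1} :
  monostable g kappa p L -> wave g kappa c h phi phi1 ->
  forall z, nu1 c * (kappa - phi z) <= - phi1 z.
Proof.
  intros Hg W z.
  replace (- phi1 z) with (0 - phi1 z) by ring.
  apply (ode_harnack c (fun x => kappa - g (phi (x - c * h))) (fun x => kappa - phi x)
    (fun x => 0 - phi1 x)).
  - apply (ode_minus c (fun _ => kappa) (fun _ => kappa) (fun _ => 0)); [apply ode_const|apply W].
  - intros x. rewrite <- (ms_kappa_fixed Hg) at 1.
    pose proof (ms_mono Hg _ _ (Rlt_le _ _ (wv_lt W (x - c * h)))). lra.
  - intros x. pose proof (wv_lt W x). lra.
Qed.

Lemma symbol_margin (p c h l : R) : symbol p c h l < 0 -> exists e, 0 < e /\ symbol (p + e) c h l < 0.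
Proof.
  unfold symbol. intros Hs. set (E := exp (- l * c * h)) in *.
  assert (0 < E) by apply exp_pos.
  exists (- (l ^ 2 - c * l - 1 + p * E) / (2 * E)). split.
  - apply Rdiv_lt_0_compat; lra.
  - replace (l ^ 2 - c * l - 1 + (p + - (l ^ 2 - c * l - 1 + p * E) / (2 * E)) * E)
      with ((l ^ 2 - c * l - 1 + p * E) / 2) by (field; lra). lra.
Qed.

Lemma symbol_mono_p (p q c h l : R) : p <= q -> symbol p c h l <= symbol q c h l.
Proof. unfold symbol. intros. pose proof (exp_pos (- l * c * h)). nra. Qed.

(** [V], the sum of the two exponentials, is a strict supersolution of the linearization with slope
    p + e. Where phi / V is maximal with value k > 1, the difference phi - k V has an interior
    maximum, which strictness excludes. *)
Lemma wave_tail_bound {g kappa p L c h phi phi1} e d l l' M e' a b :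
  monostable g kappa p L -> wave g kappa c h phi phi1 -> 0 <= c * h ->
  0 < e -> (forall u v, u <= v -> v <= d -> g v - g u <= (p + e) * (v - u)) ->
  symbol (p + e) c h l < 0 -> symbol (p + e) c h l' < 0 ->
  0 <= M -> 0 < e' -> a <= b ->
  (forall z, z <= b -> phi z <= d) ->
  (forall z, a - c * h <= z <= a -> phi z <= M * exp (l' * z) + e' * exp (l * z)) ->
  phi b <= M * exp (l' * b) + e' * exp (l * b) ->
  forall z, a <= z <= b -> phi z <= M * exp (l' * z) + e' * exp (l * z).
Proof.
  intros Hg W Hch He Hd Hl Hl' HM He' Hab Hsm Hleft Hb z0 Hz0.
  set (V := fun z => M * exp (l' * z) + e' * exp (l * z)) in *.
  assert (HVpos : forall z, 0 < V z).
  { intros z. unfold V. pose proof (exp_pos (l' * z)). pose proof (exp_pos (l * z)).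
    assert (0 <= M * exp (l' * z)) by (apply Rmult_le_pos; lra).
    assert (0 < e' * exp (l * z)) by (apply Rmult_lt_0_compat; lra). lra. }
  pose (V1 := fun z => M * l' * exp (l' * z) + e' * l * exp (l * z)).
  pose (V2 := fun z => M * l' ^ 2 * exp (l' * z) + e' * l ^ 2 * exp (l * z)).
  assert (HV : forall z, is_derive V z (V1 z)).
  { intros z. unfold V, V1. auto_derive; [trivial|ring]. }
  assert (HV1 : forall z, is_derive V1 z (V2 z)).
  { intros z. unfold V1, V2. auto_derive; [trivial|ring]. }
  assert (Hsup : forall z, V2 z - c * V1 z - V z + (p + e) * V (z - c * h) < 0).
  { intros z. unfold V, V1, V2.
    assert (Hx : forall k, exp (k * (z - c * h)) = exp (k * z) * exp (- k * c * h)).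
    { intros k. rewrite <- exp_plus. f_equal; ring. }
    rewrite !Hx. unfold symbol in Hl, Hl'.
    set (E' := exp (l' * z)). set (E := exp (l * z)).
    assert (0 < E') by apply exp_pos. assert (0 < E) by apply exp_pos.
    set (s := exp (- l * c * h)) in *. set (s' := exp (- l' * c * h)) in *.
    replace (M * l' ^ 2 * E' + e' * l ^ 2 * E - c * (M * l' * E' + e' * l * E) -
      (M * E' + e' * E) + (p + e) * (M * (E' * s') + e' * (E * s)))
      with (M * E' * (l' ^ 2 - c * l' - 1 + (p + e) * s') + e' * E * (l ^ 2 - c * l - 1 + (p + e) * s)) by ring.
    assert (M * E' * (l' ^ 2 - c * l' - 1 + (p + e) * s') <= 0).
    { assert (0 <= M * E') by (apply Rmult_le_pos; lra). nra. }
    assert (e' * E * (l ^ 2 - c * l - 1 + (p + e) * s) < 0).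
    { assert (0 < e' * E) by (apply Rmult_lt_0_compat; lra). nra. }
    lra. }
  assert (Hcont := wave_continuous W).
  assert (HcV : forall z, continuous V z) by (intros z; eapply is_derive_cont, HV).
  destruct (continuity_ab_maj (fun z => phi z * / V z) a b Hab) as [zm [Hzm Hzi]].
  { intros z _. apply continuity_pt_filterlim.
    apply (cont_mult phi (fun z => / V z)); [apply Hcont|].
    apply continuous_Rinv_comp; [apply HcV|]. apply Rgt_not_eq, HVpos. }
  simpl in Hzm.
  set (k := phi zm * / V zm) in *.
  assert (Hk : forall z, a <= z <= b -> phi z <= k * V z).
  { intros z Hz. specialize (Hzm z Hz). specialize (HVpos z).
    apply Rmult_le_reg_r with (/ V z); [apply Rinv_0_lt_compat, HVpos|].
    replace (k * V z * / V z) with k by (field; lra). exact Hzm. }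
  destruct (Rle_lt_dec k 1) as [h1|h1].
  { specialize (Hk z0 Hz0). specialize (HVpos z0). unfold V in *. nra. }
  exfalso.
  assert (Hkz : phi zm = k * V zm) by (unfold k; field; apply Rgt_not_eq, HVpos).
  assert (Hna : zm <> a).
  { intros E. rewrite E in Hkz. specialize (Hleft a ltac:(lra)). fold (V a) in Hleft.
    specialize (HVpos a). nra. }
  assert (Hnb : zm <> b).
  { intros E. rewrite E in Hkz. fold (V b) in Hb. specialize (HVpos b). nra. }
  destruct (wv_ode W) as [H1 H2].
  destruct (second_order_max (fun z => phi z - k * V z) (fun z => phi1 z - k * V1 z) zm
    (c * phi1 zm + phi zm - g (phi (zm - c * h)) - k * V2 zm)) as [E1 E2].
  - assert (Hr : 0 < Rmin (zm - a) (b - zm)) by (apply Rmin_pos; lra).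
    exists (mkposreal _ Hr). intros y Hy. apply Rabs_def2 in Hy. simpl in Hy.
    unfold minus, plus, opp in Hy; simpl in Hy.
    pose proof (Rmin_l (zm - a) (b - zm)). pose proof (Rmin_r (zm - a) (b - zm)).
    specialize (Hk y ltac:(lra)). lra.
  - apply filter_forall. intros y.
    apply derive_minus; [apply H1|].
    apply is_derive_scal, HV.
  - apply derive_minus; [apply H2|].
    apply is_derive_scal, HV1.
  - assert (Hdel : phi (zm - c * h) <= k * V (zm - c * h)).
    { destruct (Rle_lt_dec a (zm - c * h)); [apply Hk; lra|].
      apply Rle_trans with (V (zm - c * h)); [apply Hleft; lra|].
      specialize (HVpos (zm - c * h)). nra. }
    assert (Hgd : g (phi (zm - c * h)) <= (p + e) * phi (zm - c * h)).
    { specialize (Hd 0 (phi (zm - c * h)) (Rlt_le _ _ (wv_pos W _)) (Hsm (zm - c * h) ltac:(lra))).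
      rewrite (ms_0 Hg) in Hd. lra. }
    specialize (Hsup zm). pose proof (ms_p Hg).
    assert ((p + e) * phi (zm - c * h) <= (p + e) * (k * V (zm - c * h))) by (apply Rmult_le_compat_l; lra).
    assert (k * (V2 zm - c * V1 zm - V zm + (p + e) * V (zm - c * h)) < 0) by nra.
    assert (c * phi1 zm = c * (k * V1 zm)) by (f_equal; lra).
    lra.
Qed.

(** If phi is not bounded below by a multiple of e^(l z), it is arbitrarily small relative to e^(l
    a) at points a far to the left. The tail bound from such a point gives phi <= M e^(l' z) + e'
    e^(l z) with M independent of e', and e' tends to 0. *)
Lemma wave_dichotomy {g kappa p L c h phi phi1} l l' :
  monostable g kappa p L -> wave g kappa c h phi phi1 -> 0 <= c * h ->
  0 < l -> 0 < l' -> symbol p c h l < 0 -> symbol p c h l' < 0 ->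
  (exists M, 0 < M /\ forall z, phi z <= M * exp (l' * z)) \/
  (exists d, 0 < d /\ forall z, z <= 0 -> d * exp (l * z) <= phi z).
Proof.
  intros Hg W Hch Hl0 Hl0' Hl Hl'.
  destruct (classic (exists d, 0 < d /\ forall z, z <= 0 -> d * exp (l * z) <= phi z)) as [|Hn]; [right; assumption|left].
  destruct (symbol_margin p c h l Hl) as [e1 [He1 Hs1]].
  destruct (symbol_margin p c h l' Hl') as [e2 [He2 Hs2]].
  pose (e := Rmin e1 e2).
  assert (He : 0 < e) by (apply Rmin_pos; auto).
  assert (Hs1' : symbol (p + e) c h l < 0).
  { eapply Rle_lt_trans; [apply symbol_mono_p|exact Hs1]. pose proof (Rmin_l e1 e2). unfold e; lra. }
  assert (Hs2' : symbol (p + e) c h l' < 0).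
  { eapply Rle_lt_trans; [apply symbol_mono_p|exact Hs2]. pose proof (Rmin_r e1 e2). unfold e; lra. }
  destruct (ms_near0 Hg e He) as [d [Hd Hnear]].
  destruct (wv_left W d Hd) as [Z [HZ Hsm]].
  pose proof (ms_kappa Hg) as Hk.
  (* With this M the bound is trivial to the right of -Z, as phi < kappa. *)
  pose (M := kappa * exp (l' * Z)).
  assert (HM : 0 < M) by (apply Rmult_lt_0_compat; [lra|apply exp_pos]).
  assert (HMr : forall z, - Z <= z -> phi z <= M * exp (l' * z)).
  { intros z Hz. apply Rle_trans with kappa; [left; apply W|].
    unfold M. rewrite Rmult_assoc, <- exp_plus. rewrite <- (Rmult_1_r kappa) at 1.
    apply Rmult_le_compat_l; [lra|]. apply exp_ge1. nra. }
  exists M. split; [exact HM|]. intros z.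
  destruct (Rle_lt_dec (- Z) z) as [h1|h1]; [apply HMr, h1|].
  apply le_epsilon. intros e' He'.
  destruct (nu_facts c) as (_ & _ & Hn1 & _).
  (* The loss in passing, by the Harnack inequality, from smallness at one point a to smallness on
     the delay strip to its left. *)
  pose (C := exp (nu1 c * (c * h)) * exp (- l * (c * h))).
  assert (HC : 0 < C) by (apply Rmult_lt_0_compat; apply exp_pos).
  destruct (continuous_pos_min phi z 0 ltac:(lra) (wave_continuous W)
    (fun y _ => wv_pos W y)) as [m [Hm Hmin]].
  (* Being at most the minimum [m] of phi on [z, 0], [d'] forces the point a to lie to the left of
     z. *)
  pose (d' := Rmin m (e' * C)).
  assert (Hd' : 0 < d') by (apply Rmin_pos; [exact Hm|apply Rmult_lt_0_compat; lra]).
  assert (Hex : exists a, a <= 0 /\ phi a < d' * exp (l * a)).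
  { apply NNPP; intros Hne. apply Hn. exists d'. split; [exact Hd'|].
    intros y Hy. apply Rnot_lt_le; intros Hlt. apply Hne. exists y; auto. }
  destruct Hex as [a [Ha0 Ha]].
  assert (Haz : a < z).
  { apply Rnot_le_lt; intros Hza. specialize (Hmin a ltac:(lra)).
    assert (exp (l * a) <= 1) by (apply exp_le1; nra).
    assert (d' <= m) by apply Rmin_l. nra. }
  apply Rle_trans with (M * exp (l' * z) + e' * exp (l * z)).
  - apply (wave_tail_bound e d l l' M e' a (- Z) Hg W); auto; try lra.
    + intros y Hy. left; apply Hsm, Hy.
    + intros y Hy.
      assert (H := log_derivative_decay phi phi1 (nu1 c) y a (proj1 (wv_ode W))
        (fun x => proj1 (wave_harnack Hg W x)) ltac:(lra)).
      assert (exp (nu1 c * (c * h)) <= exp (nu1 c * (a - y))) by (apply exp_mono; nra).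
      assert (phi y * exp (nu1 c * (c * h)) <= d' * exp (l * a)).
      { pose proof (wv_pos W y). nra. }
      assert (d' <= e' * C) by apply Rmin_r.
      assert (exp (l * a) <= exp (l * (c * h)) * exp (l * y)).
      { rewrite <- exp_plus. apply exp_mono. nra. }
      assert (phi y * exp (nu1 c * (c * h)) <= e' * exp (l * y) * exp (nu1 c * (c * h))).
      { apply Rle_trans with (1 := H1).
        apply Rle_trans with (e' * C * (exp (l * (c * h)) * exp (l * y))).
        - apply Rmult_le_compat; auto; left; auto. apply exp_pos.
        - right. unfold C.
          replace (e' * (exp (nu1 c * (c * h)) * exp (- l * (c * h))) * (exp (l * (c * h)) * exp (l * y)))
            with (e' * exp (l * y) * exp (nu1 c * (c * h)) * (exp (- l * (c * h)) * exp (l * (c * h)))) by ring.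
          rewrite <- Ropp_mult_distr_l, exp_opp_mul; ring. }
      apply Rmult_le_reg_r in H4; [|apply exp_pos].
      pose proof (exp_pos (l' * y)). nra.
    + specialize (HMr (- Z) ltac:(lra)). pose proof (exp_pos (l * - Z)). nra.
  - assert (exp (l * z) <= 1) by (apply exp_le1; nra). nra.
Qed.

(** * Wavefronts from supersolutions *)

(** Along an ultrafilter every bounded sequence converges, at all points at once; this replaces the
    extraction of a diagonal subsequence. *)
Lemma free_ultrafilter :
  exists U : (nat -> Prop) -> Prop,
    (forall N, U (fun n => (N <= n)%nat)) /\
    (forall A B : nat -> Prop, U A -> U B -> U (fun n => A n /\ B n)) /\
    (forall A B : nat -> Prop, (forall n, A n -> B n) -> U A -> U B) /\
    (forall A : nat -> Prop, U A \/ U (fun n => ~ A n)) /\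
    (forall A, U A -> exists n, A n).
Proof.
  pose (F := fun A : nat -> Prop => exists N, forall n, (N <= n)%nat -> A n).
  assert (HF : filter.ProperFilter F).
  { constructor.
    - intros [N HN]. exact (HN N (le_n N)).
    - constructor.
      + exists O. intros; exact Logic.I.
      + intros A B [N HN] [M HM]. exists (Nat.max N M). intros n Hn. split.
        * apply HN. eapply Nat.le_trans; [apply Nat.le_max_l|exact Hn].
        * apply HM. eapply Nat.le_trans; [apply Nat.le_max_r|exact Hn].
      + intros A B HAB [N HN]. exists N. intros n Hn. apply HAB, HN, Hn. }
  destruct (@filter.ultraFilterLemma nat F HF) as (U & HU & HFU).
  exists U.
  pose proof (@filter.ultra_proper _ _ HU) as HP.
  pose proof (@filter.filter_filter _ _ HP) as HP'.
  split; [|split; [|split; [|split]]].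
  - intros N. apply HFU. exists N. auto.
  - intros A B HA HB. exact (@filter.filterI _ _ HP' _ _ HA HB).
  - intros A B HAB HA. exact (@filter.filterS _ _ HP' _ _ HAB HA).
  - intros A. destruct (@filter.in_ultra_setVsetC _ U A HU) as [h|h]; [left|right]; exact h.
  - intros A HA. exact (@filter.filter_ex _ _ HP _ HA).
Qed.

(** * The profile map: invariance, monotonicity and limits *)

Definition profile (kappa : R) (f : R -> R) : Prop :=
  (forall z, continuous f z) /\ forall z, 0 <= f z <= kappa.

(* The profile map: its fixed points are the stationary solutions with speed [s]. *)
Definition pmap (g : R -> R) (s h : R) (f : R -> R) : R -> R :=
  resolvent s (fun z => g (f (z - s * h))).

(** The Harnack bound for the derivative of a solution with values in [0, kappa]. *)
Definition pmap_lip (kappa s : R) : R := (nu2 s - nu1 s) * kappa.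

(** The common Lipschitz constant passes to infima and to limits; continuity of the least fixed
    point and of the final limit rests on it. *)
Definition lip_profile (kappa s : R) (f : R -> R) : Prop :=
  (forall x y, Rabs (f y - f x) <= pmap_lip kappa s * Rabs (y - x)) /\
  forall z, 0 <= f z <= kappa.

Lemma monostable_range {g kappa p L} u :
  monostable g kappa p L -> 0 <= u <= kappa -> 0 <= g u <= kappa.
Proof.
  intros Hg Hu. split.
  - rewrite <- (ms_0 Hg). apply (ms_mono Hg), Hu.
  - rewrite <- (ms_kappa_fixed Hg). apply (ms_mono Hg), Hu.
Qed.

Lemma delayed_continuous (g f : R -> R) (b z : R) :
  (forall x, continuous g x) -> (forall x, continuous f x) -> continuous (fun z => g (f (z - b))) z.
Proof.
  intros Hg Hf. apply (continuous_comp (fun z => f (z - b)) g); [|apply Hg].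
  apply (continuous_comp (fun z => z - b) f); [|apply Hf].
  smooth.
Qed.

Lemma pmap_ode {g kappa p L} s h f :
  monostable g kappa p L -> profile kappa f ->
  exists y1, ode s (fun z => g (f (z - s * h))) (pmap g s h f) y1 /\ bounded_fun (pmap g s h f).
Proof.
  intros Hg [Hf Hr]. apply resolvent_spec.
  - intros z. apply delayed_continuous; [apply (monostable_continuous Hg)|exact Hf].
  - exists kappa. intros z. destruct (monostable_range _ Hg (Hr (z - s * h))).
    rewrite Rabs_right; lra.
Qed.

Lemma ode_range (c B : R) (F y y1 : R -> R) :
  0 <= c -> ode c F y y1 -> bounded_fun y -> (forall z, 0 <= F z <= B) -> forall z, 0 <= y z <= B.
Proof.
  intros Hc Hy Hb HF z.
  assert (HBb : bounded_fun (fun _ => B)) by (exists (Rabs B); intros; lra).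
  assert (H0b : bounded_fun (fun _ => 0)) by (exists 0; intros; rewrite Rabs_R0; lra).
  split.
  - apply (ode_mono c (fun _ => 0) (fun _ => 0) (fun _ => 0) F y y1); auto; [apply ode_const|].
    intros; apply HF.
  - apply (ode_mono c F y y1 (fun _ => B) (fun _ => B) (fun _ => 0)); auto; [apply ode_const|].
    intros; apply HF.
Qed.

Lemma pmap_range {g kappa p L} s h f :
  0 <= s -> monostable g kappa p L -> profile kappa f -> forall z, 0 <= pmap g s h f z <= kappa.
Proof.
  intros Hs Hg Hf. destruct (pmap_ode s h f Hg Hf) as [y1 [Ho Hb]].
  apply (ode_range s kappa _ _ y1 Hs Ho Hb).
  intros z. apply (monostable_range _ Hg), Hf.
Qed.

Lemma derivative_lipschitz (f f1 : R -> R) (K : R) :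
  (forall z, is_derive f z (f1 z)) -> (forall z, Rabs (f1 z) <= K) ->
  forall x y, Rabs (f y - f x) <= K * Rabs (y - x).
Proof.
  intros Hf HK x y. destruct (Rle_lt_dec x y) as [h|h].
  - rewrite (Rabs_right (y - x)) by lra. apply (derive_bound_lip f f1 K x y); auto.
  - rewrite (Rabs_minus_sym (f y)), (Rabs_left (y - x)) by lra.
    replace (- (y - x)) with (x - y) by ring. apply (derive_bound_lip f f1 K y x); auto; lra.
Qed.

Lemma pmap_lip_profile {g kappa p L} s h f :
  0 <= s -> monostable g kappa p L -> profile kappa f -> lip_profile kappa s (pmap g s h f).
Proof.
  intros Hs Hg Hf. destruct (pmap_ode s h f Hg Hf) as [y1 [Ho Hb]].
  assert (Hr := pmap_range s h f Hs Hg Hf).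
  split; [|exact Hr].
  apply (derivative_lipschitz _ y1); [apply Ho|].
  intros z. assert (Hh := ode_harnack s _ _ y1 Ho).
  destruct (nu_facts s) as (_ & _ & Hn1 & Hn2). specialize (Hr z) as Hrz.
  destruct (Hh ltac:(intros; apply (monostable_range _ Hg), Hf) ltac:(intros; apply Hr) z) as [h1 h2].
  unfold pmap_lip. apply Rabs_le. split; nra.
Qed.

Lemma lip_profile_profile kappa s f : lip_profile kappa s f -> profile kappa f.
Proof.
  intros [h1 h2]. split; [|exact h2].
  apply (lipschitz_continuous f (pmap_lip kappa s)), h1.
Qed.

Lemma pmap_mono {g kappa p L} s h f1 f2 :
  0 <= s -> monostable g kappa p L -> profile kappa f1 -> profile kappa f2 ->
  (forall z, f1 z <= f2 z) -> forall z, pmap g s h f1 z <= pmap g s h f2 z.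
Proof.
  intros Hs Hg H1 H2 H12.
  destruct (pmap_ode s h f1 Hg H1) as [y1 [Ho1 Hb1]].
  destruct (pmap_ode s h f2 Hg H2) as [y2 [Ho2 Hb2]].
  apply (ode_mono s _ _ y1 _ _ y2 Hs Ho1 Ho2 Hb1 Hb2).
  intros x. apply (ms_mono Hg), H12.
Qed.

Lemma pmap_shift {g kappa p L} s h f a :
  0 <= s -> monostable g kappa p L -> profile kappa f ->
  profile kappa (fun z => f (z + a)) /\
  forall z, pmap g s h (fun z => f (z + a)) z = pmap g s h f (z + a).
Proof.
  intros Hs Hg Hf.
  assert (Hfa : profile kappa (fun z => f (z + a))).
  { split; [|intros; apply Hf]. intros z.
    apply (continuous_comp (fun z => z + a) f); [|apply Hf].
    smooth. }
  split; [exact Hfa|].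
  destruct (pmap_ode s h f Hg Hf) as [y1 [Ho1 [M HM]]].
  destruct (pmap_ode s h _ Hg Hfa) as [y2 [Ho2 Hb2]].
  apply (ode_unique s _ _ y2 _ (fun z => y1 (z + a)) Hs Ho2).
  - assert (H := ode_shift s a _ _ _ Ho1). destruct H as [h1 h2]. split; [exact h1|].
    intros z. specialize (h2 z). replace (z - s * h + a) with (z + a - s * h) by ring. exact h2.
  - exact Hb2.
  - exists M. intros; apply HM.
Qed.

Lemma ode_close (c B m R0 z0 : R) (F1 y y1 F2 z z1 : R -> R) :
  0 <= c -> ode c F1 y y1 -> ode c F2 z z1 -> bounded_fun y -> bounded_fun z -> 0 <= m ->
  (forall x, 0 <= F1 x <= B) -> (forall x, 0 <= F2 x <= B) ->
  (forall x, Rabs (x - z0) <= R0 -> Rabs (F1 x - F2 x) <= m) ->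
  Rabs (y z0 - z z0) <= m + 4 * B * exp (- loc_rate c * R0).
Proof.
  intros Hc H1 H2 [M1 B1] [M2 B2] Hm HF1 HF2 Hl.
  apply (ode_local c B m R0 z0 (fun x => F1 x - F2 x) (fun x => y x - z x) (fun x => y1 x - z1 x)); auto.
  - apply ode_minus; auto.
  - exists (M1 + M2). intros x. eapply Rle_trans; [apply Rabs_triang|]. rewrite Rabs_Ropp.
    apply Rplus_le_compat; auto.
  - specialize (HF1 z0). lra.
  - intros x. specialize (HF1 x). specialize (HF2 x). apply Rabs_le. lra.
Qed.

Lemma small_tail (r C e : R) : 0 < r -> 0 <= C -> 0 < e -> exists R0, 0 <= R0 /\ C * exp (- r * R0) < e.
Proof.
  intros Hr HC He. destruct (exp_small r (e / (C + 1)) Hr) as [N [HN0 HN]].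
  { apply Rdiv_lt_0_compat; lra. }
  exists N. split; [exact HN0|]. specialize (HN N (Rle_refl N)).
  apply Rle_lt_trans with ((C + 1) * exp (- r * N)).
  - pose proof (exp_pos (- r * N)). nra.
  - replace e with ((C + 1) * (e / (C + 1))) by (field; lra). apply Rmult_lt_compat_l; lra.
Qed.

Lemma loc_rate_pos c : 0 <= c -> 0 < loc_rate c.
Proof. intros. apply Rinv_0_lt_compat. lra. Qed.

(** On a long stretch where f is nearly constant the profile map acts like g; this identifies limits
    at infinity. *)
Lemma pmap_near_const {g kappa p L} s h f l e :
  0 <= s -> monostable g kappa p L -> profile kappa f -> 0 <= l <= kappa -> 0 < e ->
  exists R0, 0 <= R0 /\ forall z0,
    (forall z, Rabs (z - (z0 - s * h)) <= R0 -> Rabs (f z - l) <= e) ->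
    Rabs (pmap g s h f z0 - g l) <= (L + 1) * e.
Proof.
  intros Hs Hg Hf Hl He.
  pose proof (ms_L _ _ _ _ Hg) as HL.
  destruct (small_tail (loc_rate s) (4 * kappa) e) as [R0 [HR0 HR]]; [apply loc_rate_pos, Hs|lra|exact He|].
  exists R0. split; [exact HR0|]. intros z0 Hz.
  destruct (pmap_ode s h f Hg Hf) as [y1 [Ho Hb]].
  assert (Rabs (pmap g s h f z0 - g l) <= L * e + 4 * kappa * exp (- loc_rate s * R0)).
  { apply (ode_close s kappa (L * e) R0 z0 (fun z => g (f (z - s * h))) (pmap g s h f) y1 (fun _ => g l) (fun _ => g l) (fun _ => 0)); auto.
    - apply ode_const.
    - exists (Rabs (g l)). intros; lra.
    - nra.
    - intros x. apply (monostable_range _ Hg), Hf.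
    - intros x. apply (monostable_range _ Hg), Hl.
    - intros x Hx. eapply Rle_trans; [apply (monostable_lip Hg)|].
      apply Rmult_le_compat_l; [lra|]. apply Hz.
      replace (x - s * h - (z0 - s * h)) with (x - z0) by ring. exact Hx. }
  lra.
Qed.

(** Let l be the supremum of f. Far to the right the profile map is close to g(l), which exceeds l
    unless l = kappa, while f dominates its image. *)
Lemma super_reaches_kappa {g kappa p L} s h f :
  0 <= s -> monostable g kappa p L -> profile kappa f ->
  (forall x y, x <= y -> f x <= f y) -> (forall z, pmap g s h f z <= f z) ->
  (exists z, 0 < f z) -> forall e, 0 < e -> exists z, kappa - e < f z.
Proof.
  intros Hs Hg Hf Hmono Hsup [z1 Hz1] e He.
  destruct (completeness (fun x => exists z, x = f z)) as [l [Hub Hlub]].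
  { exists kappa. intros x [z ->]. apply Hf. }
  { exists (f z1), z1. reflexivity. }
  assert (Hfl : forall z, f z <= l) by (intros z; apply Hub; exists z; reflexivity).
  assert (Hlk : l <= kappa) by (apply Hlub; intros x [z ->]; apply Hf).
  assert (Hl0 : 0 < l) by (specialize (Hfl z1); lra).
  assert (Happ : forall e', 0 < e' -> exists z, l - e' < f z).
  { intros e' He'. destruct (is_lub_approx _ l e' (conj Hub Hlub) He') as (x & [z ->] & Hz). exists z; exact Hz. }
  destruct (Req_dec l kappa) as [->|Hne]; [apply Happ, He|exfalso].
  pose proof (ms_above Hg l ltac:(lra)) as Hgl.
  pose proof (ms_L _ _ _ _ Hg) as HL.
  pose (e' := (g l - l) / (2 * (L + 1))).
  assert (He' : 0 < e') by (apply Rdiv_lt_0_compat; lra).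
  destruct (pmap_near_const s h f l e' Hs Hg Hf ltac:(lra) He') as [R0 [HR0 HR]].
  destruct (Happ e' He') as [z2 Hz2].
  specialize (HR (z2 + R0 + s * h)).
  assert (Hc : Rabs (pmap g s h f (z2 + R0 + s * h) - g l) <= (L + 1) * e').
  { apply HR. intros z Hz. apply Rabs_le_between in Hz.
    specialize (Hmono z2 z ltac:(lra)). specialize (Hfl z). apply Rabs_le. lra. }
  replace ((L + 1) * e') with ((g l - l) / 2) in Hc by (unfold e'; field; lra).
  apply Rabs_le_between in Hc.
  specialize (Hsup (z2 + R0 + s * h)). specialize (Hfl (z2 + R0 + s * h)). lra.
Qed.

(** Let l be the infimum of f. Far to the left f equals its image, which is close to g(l); this
    contradicts g(l) > l unless l = 0. *)
Lemma fixed_point_left_limit {g kappa p L} s h f :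
  0 <= s -> monostable g kappa p L -> profile kappa f ->
  (forall x y, x <= y -> f x <= f y) -> (forall z, pmap g s h f z = f z) ->
  (exists z, f z < kappa) -> forall e, 0 < e -> exists z, f z < e.
Proof.
  intros Hs Hg Hf Hmono Hfix [z1 Hz1] e He.
  destruct (completeness (fun x => exists z, x = - f z)) as [m [Hub Hlub]].
  { exists 0. intros x [z ->]. destruct Hf as [_ Hf]. specialize (Hf z). lra. }
  { exists (- f z1), z1. reflexivity. }
  pose (l := - m).
  assert (Hfl : forall z, l <= f z).
  { intros z. assert (- f z <= m) by (apply Hub; exists z; reflexivity). unfold l; lra. }
  assert (Hlk : 0 <= l).
  { assert (m <= 0); [|unfold l; lra]. apply Hlub; intros x [z ->].
    destruct Hf as [_ Hf]. specialize (Hf z). lra. }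
  assert (Happ : forall e', 0 < e' -> exists z, f z < l + e').
  { intros e' He'. destruct (is_lub_approx _ m e' (conj Hub Hlub) He') as (x & [z ->] & Hz). exists z. unfold l; lra. }
  destruct (Req_dec l 0) as [Hz|Hne].
  { destruct (Happ e He) as [z Hz']. exists z. lra. }
  exfalso.
  assert (Hl1 : l < kappa) by (specialize (Hfl z1); lra).
  pose proof (ms_above Hg l ltac:(lra)) as Hgl.
  pose proof (ms_L _ _ _ _ Hg) as HL.
  pose (e' := (g l - l) / (2 * (L + 2))).
  assert (He' : 0 < e') by (apply Rdiv_lt_0_compat; lra).
  destruct (pmap_near_const s h f l e' Hs Hg Hf ltac:(lra) He') as [R0 [HR0 HR]].
  destruct (Happ e' He') as [z2 Hz2].
  pose (z0 := z2 - R0 - Rabs (s * h)).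
  assert (Hc : Rabs (pmap g s h f z0 - g l) <= (L + 1) * e').
  { apply HR. intros z Hz. apply Rabs_le_between in Hz. unfold z0 in Hz.
    pose proof (Rle_abs (- (s * h))). rewrite Rabs_Ropp in H.
    specialize (Hmono z z2 ltac:(lra)). specialize (Hfl z). apply Rabs_le. lra. }
  rewrite Hfix in Hc. apply Rabs_le_between in Hc.
  specialize (Hmono z0 z2).
  assert (z0 <= z2) by (unfold z0; pose proof (Rabs_pos (s * h)); lra).
  assert ((L + 2) * e' = (g l - l) / 2) by (unfold e'; field; lra).
  specialize (Hmono H). nra.
Qed.

Lemma fixed_point_wave {g kappa p L} s h f :
  0 <= s -> monostable g kappa p L -> profile kappa f ->
  (forall x y, x <= y -> f x <= f y) -> (forall z, pmap g s h f z = f z) ->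
  (exists z, 0 < f z) -> (exists z, f z < kappa) -> is_wavefront g kappa h s f.
Proof.
  intros Hs Hg Hf Hmono Hfix Hpos Hlt.
  destruct (pmap_ode s h f Hg Hf) as [y1 [[Ho1 Ho2] Hb]].
  assert (Hd : forall z, is_derive f z (y1 z)).
  { intros z. apply (is_derive_ext (pmap g s h f)); auto. }
  assert (Hd2 : forall z, is_derive y1 z (s * y1 z + f z - g (f (z - s * h)))).
  { intros z. rewrite <- (Hfix z). auto. }
  assert (HD : forall z, Derive f z = y1 z) by (intros; apply is_derive_unique, Hd).
  assert (HD2 : forall z, is_derive (Derive f) z (s * y1 z + f z - g (f (z - s * h)))).
  { intros z. apply (is_derive_ext y1); auto. }
  assert (Hr := super_reaches_kappa s h f Hs Hg Hf Hmono ltac:(intros; rewrite Hfix; lra) Hpos).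
  assert (Hl := fixed_point_left_limit s h f Hs Hg Hf Hmono Hfix Hlt).
  destruct Hf as [Hc Hrange].
  split; [|split; [|split; [|split]]].
  - intros z. split; eexists; [apply Hd|apply HD2].
  - intros z. rewrite (is_derive_unique _ _ _ (HD2 z)), HD. ring.
  - intros z. destruct (Rle_lt_or_eq_dec 0 (f z) (proj1 (Hrange z))) as [h0|h0]; [exact h0|exfalso].
    destruct Hpos as [z1 Hz1].
    assert (f z1 = 0); [|lra].
    apply (ode_zero s (fun z => g (f (z - s * h))) f y1 z); auto.
    + split; [exact Hd|exact Hd2].
    + intros x. apply (monostable_range _ Hg), Hrange.
    + intros x; apply Hrange.
  - apply is_lim_spec. intros [e He]. simpl.
    destruct (Hl e He) as [z Hz]. exists z. intros x Hx.
    specialize (Hmono x z ltac:(lra)). specialize (Hrange x). apply Rabs_def1; lra.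
  - apply is_lim_spec. intros [e He]. simpl.
    destruct (Hr e He) as [z Hz]. exists z. intros x Hx.
    specialize (Hmono z x ltac:(lra)). specialize (Hrange x). apply Rabs_def1; lra.
Qed.

(** V touches Y from above only near z; the delayed term is nonlocal and is therefore evaluated at Y
    itself. *)
Definition stat_super (g : R -> R) (s h : R) (Y : R -> R) : Prop :=
  (forall z, continuous Y z) /\
  forall z, exists (V V1 : R -> R) (vzz : R),
    locally z (fun x => is_derive V x (V1 x)) /\ is_derive V1 z vzz /\
    V z = Y z /\ locally z (fun x => Y x <= V x) /\
    vzz - s * V1 z - V z + g (Y (z - s * h)) <= 0.

Lemma pmap_le_super {g kappa p L} s h f Y :
  0 <= s -> monostable g kappa p L -> profile kappa f -> stat_super g s h Y ->
  (forall z, 0 <= Y z) -> (forall z, f z <= Y z) -> forall z, pmap g s h f z <= Y z.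
Proof.
  intros Hs Hg Hf [HYc HY] HY0 HfY.
  destruct (pmap_ode s h f Hg Hf) as [y1 [Ho [M HM]]].
  apply (ode_below s _ _ y1 Y Hs Ho HYc).
  - exists M. intros z. specialize (HM z). specialize (HY0 z). apply Rabs_le_between in HM. lra.
  - intros z _. destruct (HY z) as (V & V1 & vzz & h1 & h2 & h3 & h4 & h5).
    exists V, V1, vzz. repeat (split; [assumption|]).
    pose proof (ms_mono Hg _ _ (HfY (z - s * h))). lra.
Qed.

Lemma Rmax_lip a b a' b' e : Rabs (a - a') <= e -> Rabs (b - b') <= e -> Rabs (Rmax a b - Rmax a' b') <= e.
Proof.
  intros H1 H2. apply Rabs_le_between in H1. apply Rabs_le_between in H2. apply Rabs_le.
  unfold Rmax. destruct (Rle_dec a b); destruct (Rle_dec a' b'); lra.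
Qed.

(* Knaster-Tarski for f |-> max (ramp, pmap f) on the complete lattice of Lipschitz profiles. *)
Lemma least_forced_profile {g kappa p L} s h (r Y : R -> R) :
  0 <= s -> monostable g kappa p L -> lip_profile kappa s r ->
  (forall x y, x <= y -> r x <= r y) ->
  stat_super g s h Y -> (forall z, 0 <= Y z) -> (forall z, r z <= Y z) ->
  exists a, lip_profile kappa s a /\ (forall x y, x <= y -> a x <= a y) /\
    (forall z, a z = Rmax (r z) (pmap g s h a z)) /\ forall z, a z <= Y z.
Proof.
  intros Hs Hg Hr Hrmono HY HY0 HrY.
  pose (K := pmap_lip kappa s).
  pose proof (ms_kappa Hg) as Hk.
  assert (HK : 0 <= K).
  { unfold K, pmap_lip. destruct (nu_facts s) as (_ & _ & h1 & h2). nra. }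
  pose (Phi := fun f z => Rmax (r z) (pmap g s h f z)).
  assert (HPhi : forall f, profile kappa f -> lip_profile kappa s (Phi f)).
  { intros f Hf. destruct (pmap_lip_profile s h f Hs Hg Hf) as [h1 h2].
    destruct Hr as [h3 h4]. split.
    - intros x y. apply Rmax_lip; auto.
    - intros z. unfold Phi. specialize (h2 z); specialize (h4 z). split.
      + eapply Rle_trans; [apply h4|apply Rmax_l].
      + apply Rmax_lub; lra. }
  assert (HPmono : forall f1 f2, profile kappa f1 -> profile kappa f2 ->
     (forall z, f1 z <= f2 z) -> forall z, Phi f1 z <= Phi f2 z).
  { intros f1 f2 H1 H2 H12 z. unfold Phi. apply Rle_max_compat_l.
    apply (pmap_mono _ _ _ _ Hs Hg); auto. }
  pose (Pre := fun f => lip_profile kappa s f /\ forall z, Phi f z <= f z).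
  assert (Htop : Pre (fun _ => kappa)).
  { assert (Hc : lip_profile kappa s (fun _ => kappa)).
    { split; intros; [|lra]. rewrite Rminus_diag, Rabs_R0. apply Rmult_le_pos; [exact HK|apply Rabs_pos]. }
    split; [exact Hc|]. intros z. apply (HPhi _ (lip_profile_profile _ _ _ Hc)). }
  assert (Hbd : forall z, bound (fun x => exists f, Pre f /\ x = - f z)).
  { intros z. exists 0. intros x (f & [[_ Hf] _] & ->). specialize (Hf z). lra. }
  assert (Hne : forall z, exists x, exists f, Pre f /\ x = - f z).
  { intros z. eexists. exists (fun _ => kappa). split; [exact Htop|reflexivity]. }
  pose (a := fun z => - proj1_sig (completeness _ (Hbd z) (Hne z))).
  assert (Ha : forall z, is_lub (fun x => exists f, Pre f /\ x = - f z) (- a z)).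
  { intros z. unfold a. rewrite Ropp_involutive. exact (proj2_sig (completeness _ (Hbd z) (Hne z))). }
  clearbody a.
  assert (Hlow : forall f, Pre f -> forall z, a z <= f z).
  { intros f Hf z. destruct (Ha z) as [Hub _]. assert (- f z <= - a z); [|lra].
    apply Hub. exists f; auto. }
  assert (Hglb : forall z x, (forall f, Pre f -> x <= f z) -> x <= a z).
  { intros z x Hx. destruct (Ha z) as [_ Hl]. assert (- a z <= - x); [|lra].
    apply Hl. intros y (f & Hf & ->). specialize (Hx f Hf). lra. }
  assert (Hal : lip_profile kappa s a).
  { split.
    - intros x y.
      assert (Hone : forall x y, a x <= a y + K * Rabs (y - x)).
      { intros u v. assert (a u - K * Rabs (v - u) <= a v); [|lra].
        apply Hglb. intros f Hf. specialize (Hlow f Hf u).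
        destruct Hf as [[Hf _] _]. specialize (Hf u v). apply Rabs_le_between in Hf. fold K in Hf. lra. }
      apply Rabs_le. fold K. split.
      + specialize (Hone x y). lra.
      + specialize (Hone y x). rewrite (Rabs_minus_sym x y) in Hone. lra.
    - intros z. split.
      + apply Hglb. intros f [[_ Hf] _]. apply Hf.
      + apply (Hlow _ Htop). }
  assert (Hap := lip_profile_profile _ _ _ Hal).
  assert (HPa : forall z, Phi a z <= a z).
  { intros z. apply Hglb. intros f Hf. apply Rle_trans with (Phi f z); [|apply Hf].
    apply HPmono; auto. apply (lip_profile_profile _ s), Hf. }
  assert (HaP : forall z, a z <= Phi a z).
  { apply Hlow. split; [apply HPhi, Hap|]. intros z. apply HPmono; auto.
    apply (lip_profile_profile _ s), HPhi, Hap. }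
  exists a. split; [exact Hal|]. split; [|split].
  (* The ramp increases, so a left translate of [a] is again pre-fixed and lies above the least
     one. *)
  - intros x y Hxy.
    destruct (pmap_shift s h a (y - x) Hs Hg Hap) as [Hps Hsh].
    assert (H := Hlow (fun z => a (z + (y - x)))).
    specialize (fun Hp => H Hp x). simpl in H. replace (x + (y - x)) with y in H by ring.
    apply H. split.
    + split; [|intros; apply Hal]. intros u v. destruct Hal as [Hal _].
      specialize (Hal (u + (y - x)) (v + (y - x))).
      replace (v + (y - x) - (u + (y - x))) with (v - u) in Hal by ring. exact Hal.
    + intros z. unfold Phi. rewrite Hsh.
      apply Rle_trans with (Phi a (z + (y - x))); [|apply HPa].
      unfold Phi. apply Rle_max_compat_r. apply Hrmono. lra.
  - intros z. apply Rle_antisym; [apply HaP|apply HPa].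
  (* The truncation of Y at kappa is pre-fixed but may fail to be Lipschitz; one application of
     [Phi] repairs this. *)
  - pose (m := fun z => Rmin (Y z) kappa).
    assert (Hm : profile kappa m).
    { split.
      - intros z. apply continuous_Rmin; [apply HY|apply continuous_const].
      - intros z. split; [apply Rmin_glb; [apply HY0|lra]|apply Rmin_r]. }
    assert (HPm : forall z, Phi m z <= m z).
    { intros z. unfold Phi, m. apply Rmax_lub; apply Rmin_glb; auto.
      - apply Hr.
      - apply (pmap_le_super _ _ _ _ Hs Hg); auto. intros; apply Rmin_l.
      - apply (pmap_range _ _ _ Hs Hg); auto. }
    intros z. apply Rle_trans with (Phi m z).
    + apply Hlow. split; [apply HPhi, Hm|]. intros x. apply HPmono; auto.
      apply (lip_profile_profile _ s), HPhi, Hm.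
    + apply Rle_trans with (1 := HPm z). apply Rmin_l.
Qed.

(** Zero up to -1 and b from 0 on. Used as a lower obstacle, it keeps the least fixed profile away
    from 0. *)
Definition ramp (b z : R) : R := b * Rmax 0 (Rmin 1 (z + 1)).

Lemma ramp_facts (b : R) (r := ramp b) : 0 <= b ->
  (forall x y, Rabs (r y - r x) <= b * Rabs (y - x)) /\
  (forall x y, x <= y -> r x <= r y) /\ (forall z, 0 <= r z <= b) /\
  (forall z, z <= -1 -> r z = 0) /\ r 0 = b.
Proof.
  intros Hb.
  assert (H0 : forall z, 0 <= Rmax 0 (Rmin 1 (z + 1)) <= 1).
  { intros z. split; [apply Rmax_l|]. apply Rmax_lub; [lra|apply Rmin_l]. }
  repeat split.
  - intros x y. unfold r, ramp. rewrite <- Rmult_minus_distr_l, Rabs_mult, (Rabs_right b) by lra.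
    apply Rmult_le_compat_l; [exact Hb|].
    apply Rmax_lip; [rewrite Rminus_diag, Rabs_R0; apply Rabs_pos|].
    unfold Rmin, Rabs.
    destruct (Rle_dec 1 (y + 1)); destruct (Rle_dec 1 (x + 1)); repeat destruct (Rcase_abs _); lra.
  - intros x y Hxy. unfold r, ramp. apply Rmult_le_compat_l; [exact Hb|].
    apply Rle_max_compat_l. apply Rle_min_compat_l. lra.
  - unfold r, ramp. specialize (H0 z). apply Rmult_le_pos; lra.
  - unfold r, ramp. specialize (H0 z). nra.
  - intros z Hz. unfold r, ramp. rewrite Rmax_left; [ring|].
    eapply Rle_trans; [apply Rmin_r|]. lra.
  - unfold r, ramp. rewrite Rmin_left, Rmax_right by lra. ring.
Qed.

(** The least forced profile lies under Y, hence below kappa/2 somewhere, and tends to kappa at the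
    right; translating it to the value kappa/2 at 0 keeps the later limit from being 0 or kappa. It
    misses being fixed by at most the ramp height b. *)
Lemma almost_fixed_profile {g kappa p L} s h Y b0 b :
  0 <= s -> monostable g kappa p L -> stat_super g s h Y -> (forall z, 0 <= Y z) ->
  (exists z, Y z < kappa / 2) -> (forall z, -1 <= z -> b0 <= Y z) ->
  0 < b -> b <= b0 -> b <= kappa -> b <= pmap_lip kappa s ->
  exists f, lip_profile kappa s f /\ (forall x y, x <= y -> f x <= f y) /\ f 0 = kappa / 2 /\
    forall z, Rabs (f z - pmap g s h f z) <= b.
Proof.
  intros Hs Hg HY HY0 [zl Hzl] Hb0 Hb Hbb Hbk HbK.
  destruct (ramp_facts b ltac:(lra)) as (h1 & h2 & h3 & h4 & h5).
  set (r := ramp b) in *.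
  destruct (least_forced_profile s h r Y Hs Hg) as (a & Ha & Hmono & Hfix & HaY); auto.
  { split.
    - intros x y. eapply Rle_trans; [apply h1|]. apply Rmult_le_compat_r; [apply Rabs_pos|exact HbK].
    - intros z. specialize (h3 z). lra. }
  { intros z. destruct (Rle_lt_dec z (-1)) as [hz|hz].
    - rewrite h4 by exact hz. apply HY0.
    - specialize (h3 z). specialize (Hb0 z ltac:(lra)). lra. }
  assert (Hap := lip_profile_profile _ _ _ Ha).
  destruct (super_reaches_kappa s h a Hs Hg Hap Hmono) with (e := kappa / 2) as [zr Hzr].
  { intros z. pose proof (Hfix z) as Hz. rewrite Hz. apply Rmax_r. }
  { exists 0. rewrite Hfix. apply Rlt_le_trans with (r 0); [lra|apply Rmax_l]. }
  { lra. }
  assert (Hl : a zl < kappa / 2) by (eapply Rle_lt_trans; [apply HaY|exact Hzl]).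
  assert (Hlr : zl < zr).
  { apply Rnot_le_lt; intros Hn. specialize (Hmono zr zl Hn). lra. }
  destruct (IVT (fun z => a z - kappa / 2) zl zr) as [z0 [_ Hz0]].
  - intros z. apply continuity_pt_minus; [|apply continuity_pt_const; intros ? ?; reflexivity].
    apply continuity_pt_filterlim, Hap.
  - exact Hlr.
  - lra.
  - lra.
  - destruct (pmap_shift s h a z0 Hs Hg Hap) as [_ Hsh].
    exists (fun z => a (z + z0)). repeat split; try apply Ha.
    + intros x y. destruct Ha as [Ha _]. specialize (Ha (x + z0) (y + z0)).
      replace (y + z0 - (x + z0)) with (y - x) in Ha by ring. exact Ha.
    + intros x y Hxy. apply Hmono. lra.
    + rewrite Rplus_0_l. lra.
    + intros z. rewrite Hsh, Hfix. specialize (h3 (z + z0)).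
      assert (Hp := pmap_range s h a Hs Hg Hap (z + z0)).
      unfold Rmax. destruct (Rle_dec _ _); apply Rabs_le; lra.
Qed.

(** * Compactness through limits along an ultrafilter *)

Definition is_ulim (U : (nat -> Prop) -> Prop) (x : nat -> R) (l : R) : Prop :=
  forall e, 0 < e -> U (fun n => Rabs (x n - l) < e).

Section Ultralimits.

Variable U : (nat -> Prop) -> Prop.
Hypothesis U_tail : forall N, U (fun n => (N <= n)%nat).
Hypothesis U_and : forall A B : nat -> Prop, U A -> U B -> U (fun n => A n /\ B n).
Hypothesis U_imp : forall A B : nat -> Prop, (forall n, A n -> B n) -> U A -> U B.
Hypothesis U_dec : forall A : nat -> Prop, U A \/ U (fun n => ~ A n).
Hypothesis U_ex : forall A : nat -> Prop, U A -> exists n, A n.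

(** The limit is the supremum of all r that lie below almost all terms in the sense of [U]. *)
Lemma ulim_exists (x : nat -> R) (a b : R) : (forall n, a <= x n <= b) -> exists l, is_ulim U x l.
Proof.
  intros Hx.
  assert (UT : U (fun _ => True)) by (apply (U_imp (fun n => (0 <= n)%nat)); auto).
  destruct (completeness (fun r => U (fun n => r <= x n))) as [l [Hub Hlub]].
  { exists b. intros r Hr. destruct (U_ex _ Hr) as [n Hn]. specialize (Hx n). lra. }
  { exists a. apply (U_imp (fun _ => True)); [|exact UT]. intros n _. apply Hx. }
  exists l. intros e He.
  assert (H1 : U (fun n => l - e < x n)).
  { apply NNPP; intros Hn.
    assert (l <= l - e); [|lra]. apply Hlub. intros r Hr.
    apply Rnot_lt_le; intros Hlt. apply Hn. apply (U_imp (fun n => r <= x n)); [|exact Hr].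
    intros; lra. }
  assert (H2 : U (fun n => x n < l + e)).
  { destruct (U_dec (fun n => l + e <= x n)) as [h|h].
    - specialize (Hub _ h). lra.
    - apply (U_imp _ _ (fun n Hn => Rnot_le_lt _ _ Hn) h). }
  apply (U_imp _ _ (fun n (Hn : l - e < x n /\ x n < l + e) => Rabs_def1 (x n - l) e ltac:(lra) ltac:(lra))).
  apply U_and; auto.
Qed.

(** Convergence on a finite grid of mesh e / (4 K), filled in by the common Lipschitz constant. *)
Lemma ulim_uniform (f : nat -> R -> R) (F : R -> R) (K a b e : R) :
  0 < K -> 0 < e ->
  (forall n x y, Rabs (f n y - f n x) <= K * Rabs (y - x)) ->
  (forall x y, Rabs (F y - F x) <= K * Rabs (y - x)) ->
  (forall z, is_ulim U (fun n => f n z) (F z)) ->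
  U (fun n => forall z, a <= z <= b -> Rabs (f n z - F z) <= e).
Proof.
  intros HK He Hf HF Hlim.
  pose (d := e / (4 * K)).
  assert (Hd : 0 < d) by (apply Rdiv_lt_0_compat; lra).
  assert (Hgrid : forall m, U (fun n => forall j, (j <= m)%nat -> Rabs (f n (a + INR j * d) - F (a + INR j * d)) < e / 4)).
  { induction m as [|m IH].
    - apply (U_imp (fun n => Rabs (f n (a + INR 0 * d) - F (a + INR 0 * d)) < e / 4)).
      + intros n Hn j Hj. replace j with O by lia. exact Hn.
      + apply Hlim. lra.
    - apply (U_imp (fun n => (forall j, (j <= m)%nat -> Rabs (f n (a + INR j * d) - F (a + INR j * d)) < e / 4)
         /\ Rabs (f n (a + INR (S m) * d) - F (a + INR (S m) * d)) < e / 4)).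
      + intros n [H1 H2] j Hj. destruct (Nat.eq_dec j (S m)) as [->|Hne]; [exact H2|].
        apply H1. lia.
      + apply U_and; [exact IH|]. apply Hlim. lra. }
  destruct (nfloor_ex (Rmax 0 ((b - a) / d))) as [m Hm]; [apply Rmax_l|].
  apply (U_imp _ _) with (2 := Hgrid (S m)).
  intros n Hn z Hz.
  destruct (nfloor_ex ((z - a) / d)) as [j Hj].
  { apply Rdiv_le_0_compat; lra. }
  assert (Hzb : (z - a) / d <= (b - a) / d).
  { unfold Rdiv. apply Rmult_le_compat_r; [left; apply Rinv_0_lt_compat, Hd|lra]. }
  assert (Hjm : (j <= S m)%nat).
  { apply INR_le. rewrite S_INR. pose proof (Rmax_r 0 ((b - a) / d)). lra. }
  specialize (Hn j Hjm). set (x := a + INR j * d) in *.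
  assert (Hxz : Rabs (z - x) <= d).
  { assert (Hzz : z - a = (z - a) / d * d) by (field; lra).
    unfold x. apply Rabs_le. nra. }
  specialize (Hf n x z). specialize (HF x z).
  assert (K * Rabs (z - x) <= e / 4).
  { apply Rle_trans with (K * d); [apply Rmult_le_compat_l; lra|]. unfold d. right. field. lra. }
  apply Rabs_le_between in Hf. apply Rabs_le_between in HF. apply Rabs_def2 in Hn.
  apply Rabs_le. lra.
Qed.

End Ultralimits.

(** The almost fixed profiles for ramp heights B / (n + 1) have a limit [F] with F(0) = kappa/2.
    Convergence on bounded intervals suffices for [F] to be fixed, since the profile map depends on
    far values only by an exponentially small amount. *)
Lemma wave_from_super {g kappa p L} s h Y b0 :
  0 <= s -> monostable g kappa p L -> stat_super g s h Y -> (forall z, 0 <= Y z) ->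
  (exists z, Y z < kappa / 2) -> 0 < b0 -> (forall z, -1 <= z -> b0 <= Y z) ->
  exists f, is_wavefront g kappa h s f.
Proof.
  intros Hs Hg HY HY0 Hl Hb0 Hb0Y.
  pose proof (ms_kappa Hg) as Hk. pose proof (ms_L _ _ _ _ Hg) as HL.
  pose (K := pmap_lip kappa s).
  assert (HK : 0 < K).
  { unfold K, pmap_lip. destruct (nu_facts s) as (_ & _ & h1 & h2). nra. }
  pose (B := Rmin b0 (Rmin kappa K)).
  assert (HB : 0 < B) by (repeat apply Rmin_pos; lra).
  assert (HB1 : B <= b0) by apply Rmin_l.
  assert (HB2 : B <= kappa) by (eapply Rle_trans; [apply Rmin_r|apply Rmin_l]).
  assert (HB3 : B <= K) by (eapply Rle_trans; [apply Rmin_r|apply Rmin_r]).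
  assert (Hex : forall n : nat, exists f, lip_profile kappa s f /\ (forall x y, x <= y -> f x <= f y) /\
    f 0 = kappa / 2 /\ forall z, Rabs (f z - pmap g s h f z) <= B / (INR n + 1)).
  { intros n. pose proof (pos_INR n).
    assert (0 < B / (INR n + 1)) by (apply Rdiv_lt_0_compat; lra).
    assert (B / (INR n + 1) <= B).
    { apply Rmult_le_reg_r with (INR n + 1); [lra|].
      replace (B / (INR n + 1) * (INR n + 1)) with B by (field; lra). nra. }
    apply (almost_fixed_profile s h Y b0 _ Hs Hg); auto; fold K; lra. }
  pose (f := fun n => proj1_sig (constructive_indefinite_description _ (Hex n))).
  assert (Hf : forall n, lip_profile kappa s (f n) /\ (forall x y, x <= y -> f n x <= f n y) /\
    f n 0 = kappa / 2 /\ forall z, Rabs (f n z - pmap g s h (f n) z) <= B / (INR n + 1)).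
  { intros n. exact (proj2_sig (constructive_indefinite_description _ (Hex n))). }
  clearbody f.
  destruct free_ultrafilter as (U & Utail & Uand & Uimp & Udec & Uex).
  assert (HF : forall z, exists l, is_ulim U (fun n => f n z) l).
  { intros z. apply (ulim_exists U Utail Uand Uimp Udec Uex _ 0 kappa). intros n. apply (Hf n). }
  pose (F := fun z => proj1_sig (constructive_indefinite_description _ (HF z))).
  assert (HFl : forall z, is_ulim U (fun n => f n z) (F z)).
  { intros z. exact (proj2_sig (constructive_indefinite_description _ (HF z))). }
  clearbody F.
  assert (Happ : forall x y e, 0 < e -> exists n, Rabs (f n x - F x) < e /\ Rabs (f n y - F y) < e).
  { intros x y e He. apply Uex. apply Uand; apply HFl, He. }
  assert (Hle2 : forall x y A, (forall n, f n x - f n y <= A) -> F x - F y <= A).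
  { intros x y A HA. apply le_epsilon. intros e He.
    destruct (Happ x y (e / 2) ltac:(lra)) as [n [h1 h2]]. specialize (HA n).
    apply Rabs_def2 in h1. apply Rabs_def2 in h2. lra. }
  assert (Hmono : forall x y, x <= y -> F x <= F y).
  { intros x y Hxy. assert (F x - F y <= 0); [|lra]. apply Hle2. intros n.
    destruct (Hf n) as (_ & Hm & _). specialize (Hm x y Hxy). lra. }
  assert (Hlip : forall x y, Rabs (F y - F x) <= K * Rabs (y - x)).
  { intros x y. apply Rabs_le. split.
    - assert (F x - F y <= K * Rabs (y - x)); [|lra]. apply Hle2. intros n.
      destruct (Hf n) as ([Hm _] & _). specialize (Hm x y). apply Rabs_le_between in Hm. fold K in Hm; lra.
    - apply Hle2. intros n.
      destruct (Hf n) as ([Hm _] & _). specialize (Hm x y). apply Rabs_le_between in Hm. fold K in Hm; lra. }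
  assert (HF0 : F 0 = kappa / 2).
  { apply Rminus_diag_uniq. apply Rabs_eq_0. apply Rle_antisym; [|apply Rabs_pos].
    apply le_epsilon. intros e He. destruct (Happ 0 0 e He) as [n [h1 _]].
    destruct (Hf n) as (_ & _ & h2 & _). rewrite h2 in h1. rewrite Rabs_minus_sym. lra. }
  assert (Hrange : forall z, 0 <= F z <= kappa).
  { intros z. split; apply le_epsilon; intros e He; destruct (Happ z z e He) as [n [h1 _]];
      destruct (Hf n) as ((_ & Hr) & _); specialize (Hr z); apply Rabs_def2 in h1; lra. }
  assert (HFp : profile kappa F).
  { apply (lip_profile_profile kappa s). split; [exact Hlip|exact Hrange]. }
  exists F. apply (fixed_point_wave _ _ _ Hs Hg); auto.
  - intros z0.
    apply Rminus_diag_uniq. apply Rabs_eq_0. apply Rle_antisym; [|apply Rabs_pos].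
    apply le_epsilon. intros e He. rewrite Rplus_0_l.
    pose (e1 := e / (4 * (L + 1))).
    assert (He1 : 0 < e1) by (apply Rdiv_lt_0_compat; lra).
    assert (HLe : L * e1 + e1 = e / 4) by (unfold e1; field; lra).
    destruct (small_tail (loc_rate s) (4 * kappa) (e / 4)) as [R0 [HR0 HR]];
      [apply loc_rate_pos, Hs|lra|lra|].
    pose (b := Rabs (s * h)).
    assert (Hb : 0 <= b) by apply Rabs_pos.
    pose proof (Rle_abs (s * h)) as Hb1. pose proof (Rle_abs (- (s * h))) as Hb2.
    rewrite Rabs_Ropp in Hb2. fold b in Hb1, Hb2.
    assert (HU := ulim_uniform U Uand Uimp f F K (z0 - R0 - b) (z0 + R0 + b) e1 HK He1
      (fun n => proj1 (proj1 (Hf n))) Hlip HFl).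
    destruct (nfloor_ex (4 * B / e)) as [N HN]; [apply Rdiv_le_0_compat; lra|].
    destruct (Uex _ (Uand _ _ HU (Utail (S N)))) as [n [Hn Hn2]].
    destruct (Hf n) as (Hlp & _ & _ & Hfn). specialize (Hfn z0).
    assert (HBn : B / (INR n + 1) <= e / 4).
    { apply le_INR in Hn2. rewrite S_INR in Hn2. pose proof (pos_INR n).
      apply Rmult_le_reg_r with (INR n + 1); [lra|].
      replace (B / (INR n + 1) * (INR n + 1)) with B by (field; lra).
      assert (4 * B / e * (e / 4) = B) by (field; lra). nra. }
    assert (Hfnp := lip_profile_profile _ _ _ Hlp).
    destruct (pmap_ode s h F Hg HFp) as [y1 [Ho1 Hb1']].
    destruct (pmap_ode s h (f n) Hg Hfnp) as [y2 [Ho2 Hb2']].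
    assert (Hc : Rabs (pmap g s h F z0 - pmap g s h (f n) z0) <= L * e1 + 4 * kappa * exp (- loc_rate s * R0)).
    { apply (ode_close s kappa (L * e1) R0 z0 _ _ y1 _ _ y2 Hs Ho1 Ho2); auto.
      - nra.
      - intros x. apply (monostable_range _ Hg), Hrange.
      - intros x. apply (monostable_range _ Hg), Hfnp.
      - intros x Hx. eapply Rle_trans; [apply (monostable_lip Hg)|].
        apply Rmult_le_compat_l; [lra|]. rewrite Rabs_minus_sym. apply Hn.
        apply Rabs_le_between in Hx. lra. }
    specialize (Hn z0 ltac:(lra)).
    apply Rabs_le_between in Hn. apply Rabs_le_between in Hc. apply Rabs_le_between in Hfn.
    apply Rabs_le. lra.
  - exists 0. lra.
  - exists 0. lra.
Qed.

(** * The weight *)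

Lemma eta_le1 l z : eta l z <= 1.
Proof. apply Rmin_r. Qed.

Lemma eta_le_exp l z : eta l z <= exp (l * z).
Proof. apply Rmin_l. Qed.

Lemma eta_mono l x y : 0 < l -> x <= y -> eta l x <= eta l y.
Proof. intros Hl Hxy. apply Rle_min_compat_r. apply exp_mono. nra. Qed.

Lemma eta_neg l z : 0 < l -> z <= 0 -> eta l z = exp (l * z).
Proof. intros Hl Hz. apply Rmin_left, exp_le1. nra. Qed.

Lemma eta_nonneg l z : 0 < l -> 0 <= z -> eta l z = 1.
Proof. intros Hl Hz. apply Rmin_right, exp_ge1. nra. Qed.

Lemma eta_continuous l z : continuous (eta l) z.
Proof.
  apply (continuous_Rmin (fun z => exp (l * z)) (fun _ => 1)); [|apply continuous_const].
  smooth.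
Qed.

Lemma eta_shift l z s : 0 < l -> 0 <= s -> exp (- l * s) * eta l z <= eta l (z - s).
Proof.
  intros Hl Hs. pose proof (exp_pos (- l * s)).
  assert (exp (- l * s) <= 1) by (apply exp_le1; nra).
  unfold eta at 2. apply Rmin_glb.
  - replace (l * (z - s)) with (- l * s + l * z) by ring. rewrite exp_plus.
    apply Rmult_le_compat_l; [lra|]. apply eta_le_exp.
  - pose proof (eta_le1 l z). nra.
Qed.

Lemma eta_increment l x y : 0 < l -> x <= y -> eta l y - eta l x <= l * (y - x) * eta l y.
Proof.
  intros Hl Hxy.
  assert (H := eta_shift l y (y - x) Hl ltac:(lra)). replace (y - (y - x)) with x in H by ring.
  pose proof (exp_ineq1_le (- l * (y - x))). pose proof (eta_pos l y). nra.
Qed.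

(** * Pushed fronts decay fast *)

(* If phi decays slowly, then min(phi, M e^(l' z)) is a strict supersolution with faster decay; one application of the profile map opens a gap that survives a small decrease of the speed. *)
Lemma slow_front_not_minimal {g kappa p L c h phi phi1} l l' d0 :
  monostable g kappa p L -> wave g kappa c h phi phi1 -> 0 < c -> 0 <= h ->
  0 < l -> l < l' -> symbol p c h l' < 0 ->
  0 < d0 -> (forall z, z <= 0 -> d0 * exp (l * z) <= phi z) ->
  exists s f, s < c /\ is_wavefront g kappa h s f.
Proof.
  intros Hg W Hc Hh Hl Hll Hsym Hd0 Hslow.
  pose proof (ms_kappa Hg) as Hk. pose proof (ms_L _ _ _ _ Hg) as HL.
  pose proof (ms_p Hg) as Hp.
  assert (Hch : 0 <= c * h) by nra.
  destruct (symbol_margin p c h l' Hsym) as [e [He Hs]].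
  unfold symbol in Hs.
  pose (A := l' ^ 2 - c * l' - 1). pose (G := (p + e) * exp (- l' * c * h)).
  fold A in Hs. fold G in Hs.
  assert (HG : 0 < G) by (apply Rmult_lt_0_compat; [lra|apply exp_pos]).
  (* With the slope p + e at 0, the profile map multiplies e^(l' z) by q, and q < 1 says that the
     symbol is negative at l'. *)
  pose (q := G / - A).
  assert (Hq : 0 < q) by (apply Rdiv_lt_0_compat; lra).
  assert (HqA : q * A + G = 0) by (unfold q; field; lra).
  assert (Hq1 : q < 1) by nra.
  destruct (ms_near0 Hg e He) as [d [Hd Hnear]].
  destruct (wv_left W d Hd) as [Z [HZ Hsm]].
  (* The division by q makes even q M e^(l' z) exceed kappa to the right of -Z; there [psi] is phi,
     and the linear bound is needed only on the left. *)
  pose (M := kappa * exp (l' * Z) / q).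
  assert (HM : 0 < M).
  { apply Rdiv_lt_0_compat; [|exact Hq]. apply Rmult_lt_0_compat; [lra|apply exp_pos]. }
  assert (HMZ : forall z, - Z <= z -> kappa <= q * M * exp (l' * z)).
  { intros z Hz. replace (q * M) with (kappa * exp (l' * Z)) by (unfold M; field; lra).
    rewrite Rmult_assoc, <- exp_plus. rewrite <- (Rmult_1_r kappa) at 1.
    apply Rmult_le_compat_l; [lra|]. apply exp_ge1. nra. }
  pose (psi := fun z => Rmin (phi z) (M * exp (l' * z))).
  assert (Hexpc : forall k z, continuous (fun z => k * exp (l' * z)) z).
  { intros k z. smooth. }
  assert (Hpsi : profile kappa psi).
  { split.
    - intros z. apply (continuous_Rmin phi (fun z => M * exp (l' * z))); [|apply Hexpc].
      apply (wave_continuous W).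
    - intros z. pose proof (wv_lt W z). pose proof (wv_pos W z). split.
      + apply Rmin_glb; [lra|]. apply Rmult_le_pos; [lra|left; apply exp_pos].
      + eapply Rle_trans; [apply Rmin_l|lra]. }
  assert (Hpsiphi : forall z, psi z <= phi z) by (intros; apply Rmin_l).
  assert (Hpsir : forall z, - Z <= z -> psi z = phi z).
  { intros z Hz. apply Rmin_left. pose proof (wv_lt W z). specialize (HMZ z Hz).
    nra. }
  destruct (pmap_ode c h psi Hg Hpsi) as [y1 [Ho Hb]].
  assert (Hyr := pmap_range c h psi ltac:(lra) Hg Hpsi).
  set (y := pmap g c h psi) in *.
  assert (Hphib : bounded_fun phi).
  { exists kappa. intros z. pose proof (wv_lt W z). pose proof (wv_pos W z).
    apply Rabs_le. lra. }
  assert (Hyphi : forall z, y z <= phi z).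
  { apply (ode_mono c _ _ y1 _ _ phi1 ltac:(lra) Ho (wv_ode W) Hb Hphib).
    intros x. apply (ms_mono Hg), Hpsiphi. }
  assert (HyM : forall z, y z <= q * M * exp (l' * z)).
  { apply (ode_below c _ y y1 _ ltac:(lra) Ho).
    - intros z. apply Hexpc.
    - exists kappa. intros z. specialize (Hyr z).
      assert (0 < q * M * exp (l' * z)) by (apply Rmult_lt_0_compat; [nra|apply exp_pos]). lra.
    - intros z Hz. destruct (Rle_lt_dec (- Z) z) as [hz|hz].
      { specialize (HMZ z hz). specialize (Hyr z). lra. }
      exists (fun z => q * M * exp (l' * z)), (fun z => q * M * l' * exp (l' * z)), (q * M * l' ^ 2 * exp (l' * z)).
      split; [apply filter_forall; intros x; auto_derive; [trivial|ring]|].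
      split; [auto_derive; [trivial|ring]|]. split; [reflexivity|].
      split; [apply filter_forall; intros; lra|].
      assert (Hgp : g (psi (z - c * h)) <= M * G * exp (l' * z)).
      { specialize (Hnear 0 (psi (z - c * h)) (proj1 (proj2 Hpsi _))).
        rewrite (ms_0 Hg) in Hnear.
        assert (psi (z - c * h) <= d).
        { eapply Rle_trans; [apply Hpsiphi|]. left; apply Hsm. lra. }
        specialize (Hnear H).
        assert (psi (z - c * h) <= M * exp (l' * (z - c * h))) by apply Rmin_r.
        apply Rle_trans with ((p + e) * (M * exp (l' * (z - c * h)))); [nra|].
        right. replace (l' * (z - c * h)) with (l' * z + - l' * c * h) by ring.
        rewrite exp_plus. unfold G. ring. }
      replace (q * M * l' ^ 2 * exp (l' * z) - c * (q * M * l' * exp (l' * z)) - q * M * exp (l' * z))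
        with (M * exp (l' * z) * (q * A)) by (unfold A; ring).
      replace (q * A) with (- G) by lra. nra. }
  (* To the left of -Z3 the slow decay puts phi above M e^(l' z), so the truncation is effective. *)
  pose (Z3 := Rmax Z (ln (M / d0) / (l' - l))).
  assert (HZ3 : Z <= Z3) by apply Rmax_l.
  assert (Hfar : forall z, z <= - Z3 -> M * exp (l' * z) <= phi z).
  { intros z Hz. eapply Rle_trans; [|apply Hslow; lra].
    assert (ln (M / d0) / (l' - l) <= - z) by (pose proof (Rmax_r Z (ln (M / d0) / (l' - l))); unfold Z3 in Hz; lra).
    apply (Rmult_le_compat_l (l' - l)) in H; [|lra].
    replace ((l' - l) * (ln (M / d0) / (l' - l))) with (ln (M / d0)) in H by (field; lra).
    assert (HMd : M = d0 * exp (ln (M / d0))).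
    { rewrite exp_ln; [field; lra|apply Rdiv_lt_0_compat; lra]. }
    rewrite HMd, Rmult_assoc. apply Rmult_le_compat_l; [lra|].
    rewrite <- exp_plus. apply exp_mono. nra. }
  (* A contact of y and phi would spread to the whole line, but at -Z3 one has y <= q M e^(l' z) <
     phi. *)
  assert (Hgap : forall z, 0 < phi z - y z).
  { assert (Hnn : forall z, 0 <= phi z - y z) by (intros z; specialize (Hyphi z); lra).
    intros z. destruct (Hnn z) as [h0|h0]; [exact h0|exfalso].
    assert (Hz0 := ode_zero c _ _ _ z (ode_minus c _ _ _ _ _ _ (wv_ode W) Ho)).
    assert (phi (- Z3) - y (- Z3) = 0).
    { apply Hz0; auto. intros x. pose proof (ms_mono Hg _ _ (Hpsiphi (x - c * h))). lra. }
    specialize (Hfar (- Z3) ltac:(lra)). specialize (HyM (- Z3)).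
    assert (0 < M * exp (l' * - Z3)) by (apply Rmult_lt_0_compat; [lra|apply exp_pos]). nra. }
  destruct (ms_near_kappa Hg) as (gam & dk & Hgam & Hdk & Hnk).
  assert (HL1 : exists L1, 0 <= L1 /\ forall z, L1 <= z -> kappa - dk <= y z).
  { pose (ek := dk / (L + 1)).
    assert (Hek : 0 < ek) by (apply Rdiv_lt_0_compat; lra).
    destruct (pmap_near_const c h psi kappa ek ltac:(lra) Hg Hpsi ltac:(lra) Hek) as [R0 [HR0 HR]].
    destruct (wv_right W ek Hek) as [Zr [HZr Hr]].
    exists (Zr + R0 + c * h). split; [lra|]. intros z Hz.
    specialize (HR z). rewrite (ms_kappa_fixed Hg) in HR. fold y in HR.
    assert (Hc1 : Rabs (y z - kappa) <= (L + 1) * ek).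
    { apply HR. intros x Hx. apply Rabs_le_between in Hx. rewrite Hpsir by lra.
      specialize (Hr x ltac:(lra)). pose proof (wv_lt W x). apply Rabs_le. lra. }
    replace ((L + 1) * ek) with dk in Hc1 by (unfold ek; field; lra).
    apply Rabs_le_between in Hc1. lra. }
  destruct HL1 as [L1 [HL1 Hyk]].
  destruct (continuous_pos_min (fun z => phi z - y z) (- Z3) L1) as [m [Hm Hmin]].
  { lra. }
  { intros z. apply cont_minus.
    - apply (wave_continuous W).
    - exact (is_derive_cont _ _ _ (proj1 Ho z)). }
  { intros; apply Hgap. }
  pose (ep := Rmin m ((1 - q) * M)).
  assert (Hep : 0 < ep) by (apply Rmin_pos; nra).
  assert (Hep1 : ep <= m) by apply Rmin_l.
  assert (Hep2 : ep <= (1 - q) * M) by apply Rmin_r.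
  assert (Hl' : 0 < l') by lra.
  assert (Hroom : forall z, z <= L1 -> y z + ep * eta l' z <= psi z).
  { intros z Hz. pose proof (eta_pos l' z). pose proof (eta_le1 l' z). pose proof (eta_le_exp l' z).
    assert (Hexp : y z + ep * eta l' z <= M * exp (l' * z)).
    { specialize (HyM z). assert (ep * eta l' z <= (1 - q) * M * exp (l' * z)).
      { apply Rmult_le_compat; lra. }
      lra. }
    apply Rmin_glb; [|exact Hexp].
    destruct (Rle_lt_dec z (- Z3)) as [hz|hz].
    - specialize (Hfar z hz). lra.
    - specialize (Hmin z ltac:(lra)). nra. }
  pose (C2 := Rmax kappa (q * M)).
  assert (HC2 : forall z, y z <= C2 * eta l' z).
  { intros z. destruct (Rle_lt_dec z 0) as [hz|hz].
    - rewrite eta_neg by lra. eapply Rle_trans; [apply HyM|].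
      apply Rmult_le_compat_r; [left; apply exp_pos|apply Rmax_r].
    - rewrite eta_nonneg by lra. rewrite Rmult_1_r. eapply Rle_trans; [apply Hyr|apply Rmax_l]. }
  assert (HC2p : 0 < C2) by (apply Rlt_le_trans with kappa; [lra|apply Rmax_l]).
  destruct (nu_facts c) as (_ & _ & Hn1 & Hn2).
  pose (C3 := (nu2 c - nu1 c) * C2).
  assert (Hy1 : forall z, Rabs (y1 z) <= C3 * eta l' z).
  { intros z. destruct (ode_harnack c _ y y1 Ho) with (z := z) as [h1 h2].
    - intros x. apply (monostable_range _ Hg), Hpsi.
    - intros x; apply Hyr.
    - specialize (Hyr z). specialize (HC2 z). unfold C3. apply Rabs_le. split; nra. }
  assert (HC3 : 0 < C3) by (unfold C3; nra).
  pose (C4 := C3 + ep * l').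
  assert (HC4 : 0 < C4) by (assert (0 < ep * l') by pos; unfold C4; lra).
  pose (Y := fun z => y z + ep * eta l' z).
  assert (HYlip : forall a b, a <= b -> Y b - Y a <= C4 * eta l' b * (b - a)).
  { intros a b Hab. unfold Y, C4.
    assert (Rabs (y b - y a) <= C3 * eta l' b * (b - a)).
    { apply (derive_bound_lip y y1); [intros; apply Ho| |exact Hab].
      intros z Hz. eapply Rle_trans; [apply Hy1|]. apply Rmult_le_compat_l; [lra|].
      apply eta_mono; lra. }
    pose proof (eta_increment l' a b Hl' Hab). pose proof (Rle_abs (y b - y a)).
    assert (ep * (eta l' b - eta l' a) <= ep * (l' * (b - a) * eta l' b)) by (apply Rmult_le_compat_l; lra).
    lra. }
  (* What the term ep eta gains: - A where eta is exponential, and 1 - gam, after the delayed cost,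
     where eta = 1. *)
  pose (a1 := Rmin (- A) (1 - gam)).
  assert (Ha1 : 0 < a1) by (apply Rmin_pos; lra).
  assert (Ha1A : a1 <= - A) by apply Rmin_l.
  assert (Ha1g : a1 <= 1 - gam) by apply Rmin_r.
  (* Lowering the speed by tau costs C4 tau eta in the drift and L C4 h tau eta through the
     displaced delay; [tau] is chosen so that ep a1 covers both. *)
  pose (C5 := C4 + L * C4 * h).
  assert (HC5 : 0 < C5).
  { unfold C5. assert (0 <= L * C4 * h) by pos. lra. }
  pose (tau := Rmin c (ep * a1 / C5)).
  assert (Htau : 0 < tau).
  { apply Rmin_pos; [exact Hc|]. apply Rdiv_lt_0_compat; [pos|exact HC5]. }
  assert (Htauc : tau <= c) by apply Rmin_l.
  assert (HtauC : tau * C5 <= ep * a1).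
  { apply Rle_trans with (ep * a1 / C5 * C5).
    - apply Rmult_le_compat_r; [lra|apply Rmin_r].
    - right; field; lra. }
  pose (s := c - tau).
  assert (HYc : forall z, continuous Y z).
  { intros z. apply cont_plus; [exact (is_derive_cont _ _ _ (proj1 Ho z))|].
    apply (cont_mult (fun _ => ep)); [apply continuous_const|apply eta_continuous]. }
  assert (HYpos : forall z, 0 <= Y z).
  { intros z. unfold Y. specialize (Hyr z). assert (0 < ep * eta l' z) by pos. lra. }
  (* the delayed term costs at most gam * ep * eta, and only where eta = 1 *)
  assert (Hdelay : forall z, z - c * h <= L1 /\ g (Y (z - s * h)) - g (psi (z - c * h)) <= L * C4 * h * tau * eta l' z
     \/ 0 < z /\ g (Y (z - s * h)) - g (psi (z - c * h)) <= L * C4 * h * tau * eta l' z + gam * ep).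
  { intros z.
    assert (Hth : 0 <= h * tau) by pos. assert (Hsh0 : 0 <= (c - tau) * h) by pos.
    assert (Hsh : z - c * h <= z - s * h) by (unfold s; lra).
    assert (Hshz : z - s * h <= z) by (unfold s; lra).
    assert (H1 : g (Y (z - s * h)) - g (Y (z - c * h)) <= L * C4 * h * tau * eta l' z).
    { specialize (HYlip _ _ Hsh).
      assert (HYd : Y (z - s * h) - Y (z - c * h) <= C4 * eta l' z * (h * tau)).
      { eapply Rle_trans; [exact HYlip|].
        replace (z - s * h - (z - c * h)) with (h * tau) by (unfold s; ring).
        apply Rmult_le_compat_r; [exact Hth|]. apply Rmult_le_compat_l; [lra|]. apply eta_mono; lra. }
      pose proof (eta_pos l' z).
      destruct (Rle_lt_dec (Y (z - c * h)) (Y (z - s * h))) as [h0|h0].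
      - pose proof (ms_lip Hg _ _ h0). apply (Rmult_le_compat_l L) in HYd; lra.
      - pose proof (ms_mono Hg _ _ (Rlt_le _ _ h0)).
        assert (0 <= L * C4 * h * tau * eta l' z).
        { repeat apply Rmult_le_pos; lra. }
        lra. }
    destruct (Rle_lt_dec (z - c * h) L1) as [hz|hz]; [left|right].
    - split; [exact hz|]. pose proof (ms_mono Hg _ _ (Hroom _ hz)). fold (Y (z - c * h)) in H. lra.
    - split; [lra|].
      specialize (Hyk (z - c * h) ltac:(lra)).
      specialize (Hnk (y (z - c * h)) (Y (z - c * h)) Hyk).
      pose proof (eta_le1 l' (z - c * h)).
      assert (H2 : g (Y (z - c * h)) - g (y (z - c * h)) <= gam * ep).
      { assert (0 < ep * eta l' (z - c * h)) by pos. eapply Rle_trans; [apply Hnk; unfold Y; lra|]. unfold Y.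
        replace (y (z - c * h) + ep * eta l' (z - c * h) - y (z - c * h)) with (ep * eta l' (z - c * h)) by ring.
        apply Rmult_le_compat_l; [lra|]. rewrite <- (Rmult_1_r ep) at 2. apply Rmult_le_compat_l; lra. }
      assert (g (y (z - c * h)) <= g (psi (z - c * h))).
      { apply (ms_mono Hg). rewrite Hpsir by lra. apply Hyphi. }
      lra. }
  assert (Hsuper : stat_super g s h Y).
  { split; [exact HYc|]. intros z.
    pose proof (eta_pos l' z) as Heta. specialize (Hy1 z) as Hy1z.
    apply Rabs_le_between in Hy1z.
    destruct Ho as [Ho1 Ho2].
    destruct (Rle_lt_dec z 0) as [hz|hz].
    - exists (fun z => y z + ep * exp (l' * z)), (fun z => y1 z + ep * (l' * exp (l' * z))),
        (c * y1 z + y z - g (psi (z - c * h)) + ep * (l' ^ 2 * exp (l' * z))).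
      split; [|split; [|split; [|split]]].
      + apply filter_forall. intros x.
        apply derive_plus; [apply Ho1|].
        auto_derive; [trivial|ring].
      + apply derive_plus; [apply Ho2|].
        auto_derive; [trivial|ring].
      + unfold Y. rewrite eta_neg by lra. reflexivity.
      + apply filter_forall. intros x. unfold Y. apply Rplus_le_compat_l.
        apply Rmult_le_compat_l; [lra|apply eta_le_exp].
      + rewrite eta_neg in * by lra. set (E := exp (l' * z)) in *.
        assert (HD : g (Y (z - s * h)) - g (psi (z - c * h)) <= L * C4 * h * tau * E).
        { destruct (Hdelay z) as [[_ HD]|[h0 HD]].
          - rewrite eta_neg in HD by lra. exact HD.
          - lra. }
        assert (HA : ep * (l' ^ 2 * E) - c * (ep * (l' * E)) - ep * E <= - (ep * a1 * E)).
        { replace (ep * (l' ^ 2 * E) - c * (ep * (l' * E)) - ep * E) with (ep * E * A) by (unfold A; ring).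
          assert (0 < ep * E) by (unfold E; pos). assert (ep * E * A <= ep * E * - a1) by (apply Rmult_le_compat_l; lra). lra. }
        assert (HV1 : tau * (y1 z + ep * (l' * E)) <= tau * (C4 * E)).
        { apply Rmult_le_compat_l; [lra|]. unfold C4. lra. }
        assert (HC : tau * (C4 * E) + L * C4 * h * tau * E <= ep * a1 * E).
        { replace (tau * (C4 * E) + L * C4 * h * tau * E) with (tau * C5 * E) by (unfold C5; ring).
          apply Rmult_le_compat_r; lra. }
        assert (s * (y1 z + ep * (l' * E)) = c * (y1 z + ep * (l' * E)) - tau * (y1 z + ep * (l' * E)))
          by (unfold s; ring).
        lra.
    - exists (fun z => y z + ep), y1, (c * y1 z + y z - g (psi (z - c * h))).
      split; [|split; [|split; [|split]]].
      + apply filter_forall. intros x. rewrite <- (Rplus_0_r (y1 x)).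
        apply derive_plus; [apply Ho1|].
        apply derive_const.
      + apply Ho2.
      + unfold Y. rewrite eta_nonneg by lra. ring.
      + apply filter_forall. intros x. unfold Y. apply Rplus_le_compat_l.
        rewrite <- (Rmult_1_r ep) at 2. apply Rmult_le_compat_l; [lra|apply eta_le1].
      + rewrite eta_nonneg in * by lra.
        assert (HD : g (Y (z - s * h)) - g (psi (z - c * h)) <= L * C4 * h * tau + gam * ep).
        { assert (0 <= gam * ep) by (apply Rmult_le_pos; lra).
          destruct (Hdelay z) as [[_ HD]|[h0 HD]]; rewrite eta_nonneg in HD by lra; lra. }
        assert (HV1 : tau * y1 z <= tau * C4).
        { apply Rmult_le_compat_l; [lra|]. unfold C4. assert (0 < ep * l') by pos. lra. }
        assert (HC : tau * C4 + L * C4 * h * tau <= ep * a1).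
        { replace (tau * C4 + L * C4 * h * tau) with (tau * C5) by (unfold C5; ring). exact HtauC. }
        assert (ep * a1 <= ep * (1 - gam)) by (apply Rmult_le_compat_l; lra).
        assert (s * y1 z = c * y1 z - tau * y1 z) by (unfold s; ring).
        lra. }
  assert (HYle : forall z, Y z <= (C2 + ep) * exp (l' * z)).
  { intros z. unfold Y. specialize (HC2 z).
    apply Rle_trans with ((C2 + ep) * eta l' z); [lra|].
    apply Rmult_le_compat_l; [lra|apply eta_le_exp]. }
  destruct (wave_from_super s h Y (ep * eta l' (-1)) ltac:(unfold s; lra) Hg) as [f Hf]; auto.
  - destruct (small_tail l' (C2 + ep) (kappa / 2)) as [R0 [_ HR0]]; [lra|lra|lra|].
    exists (- R0). eapply Rle_lt_trans; [apply HYle|].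
    replace (l' * - R0) with (- l' * R0) by ring. exact HR0.
  - apply Rmult_lt_0_compat; [lra|apply eta_pos].
  - intros z Hz. unfold Y. specialize (Hyr z). pose proof (eta_mono l' (-1) z Hl' Hz).
    assert (ep * eta l' (-1) <= ep * eta l' z) by (apply Rmult_le_compat_l; lra). lra.
  - exists s, f. split; [unfold s; lra|exact Hf].
Qed.

(** * Translated and perturbed fronts as test functions *)

Lemma jet_plus c U V t z P Q :
  jet c U t z P -> jet c V t z Q -> jet c (fun t z => U t z + V t z) t z (P + Q).
Proof.
  intros (U1 & ut & uzz & h1 & h2 & h3 & h4) (V1 & vt & vzz & k1 & k2 & k3 & k4).
  exists (fun z => U1 z + V1 z), (ut + vt), (uzz + vzz). split; [|split; [|split]].
  - apply derive_plus; auto.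
  - generalize (filter_and _ _ h2 k2). apply filter_imp. intros y [a b].
    apply derive_plus; auto.
  - apply derive_plus; auto.
  - rewrite h4, k4. ring.
Qed.

Lemma jet_opp c U t z P : jet c U t z P -> jet c (fun t z => - U t z) t z (- P).
Proof.
  intros (U1 & ut & uzz & h1 & h2 & h3 & h4).
  exists (fun z => - U1 z), (- ut), (- uzz). split; [|split; [|split]].
  - apply derive_opp; auto.
  - revert h2. apply filter_imp. intros y a.
    apply derive_opp; auto.
  - apply derive_opp; auto.
  - rewrite h4. ring.
Qed.

Lemma jet_exp c k (q r : R -> R) q' r' t z :
  is_derive q t q' -> is_derive r t r' ->
  jet c (fun t z => q t * exp (k * (z + r t))) t z
    (exp (k * (z + r t)) * (q' + q t * (k * r' - k ^ 2 + c * k + 1))).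
Proof.
  intros Hq Hr.
  exists (fun y => q t * k * exp (k * (y + r t))),
    (q' * exp (k * (z + r t)) + q t * (k * r' * exp (k * (z + r t)))),
    (q t * k ^ 2 * exp (k * (z + r t))).
  split; [|split; [|split]].
  - apply (derive_mult q (fun s => exp (k * (z + r s)))); [exact Hq| ].
    evar_last.
    + apply (is_derive_comp (fun x => exp (k * (z + x))) r); [auto_derive; [trivial|reflexivity]|exact Hr].
    + unfold scal; simpl; unfold mult; simpl. ring.
  - apply filter_forall. intros y. auto_derive; [trivial|ring].
  - auto_derive; [trivial|ring].
  - ring.
Qed.

Lemma jet_wave {g kappa c h phi phi1} (r : R -> R) r' t z :
  wave g kappa c h phi phi1 -> is_derive r t r' ->
  jet c (fun t z => phi (z + r t)) t z (r' * phi1 (z + r t) + g (phi (z + r t - c * h))).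
Proof.
  intros W Hr. destruct (wv_ode W) as [H1 H2].
  exists (fun y => phi1 (y + r t)), (r' * phi1 (z + r t)),
    (c * phi1 (z + r t) + phi (z + r t) - g (phi (z + r t - c * h))).
  split; [|split; [|split]].
  - evar_last.
    + apply (is_derive_comp phi (fun s => z + r s)); [apply H1|].
      apply (derive_plus (fun _ => z));
        [apply derive_const|exact Hr].
    + unfold scal, plus, zero; simpl; unfold mult; simpl. ring.
  - apply filter_forall. intros y. apply (proj1 (ode_shift c (r t) _ _ _ (wv_ode W))).
  - apply (proj2 (ode_shift c (r t) _ _ _ (wv_ode W))).
  - ring.
Qed.

Lemma jet_wave_static {g kappa c h phi phi1} t z :
  wave g kappa c h phi phi1 -> jet c (fun _ z => phi z) t z (g (phi (z - c * h))).
Proof.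
  intros W. destruct (wv_ode W) as [H1 H2].
  exists phi1, 0, (c * phi1 z + phi z - g (phi (z - c * h))).
  split; [|split; [|split]].
  - apply derive_const.
  - apply filter_forall, H1.
  - apply H2.
  - ring.
Qed.

(** k is the exponent of the branch of eta active at x; as eta is a minimum, this branch touches it
    from above. *)
Lemma eta_branch l x : 0 < l ->
  exists k, (k = l /\ x <= 0 \/ k = 0 /\ 0 < x) /\ eta l x = exp (k * x) /\ forall y, eta l y <= exp (k * y).
Proof.
  intros Hl. destruct (Rle_lt_dec x 0) as [h|h].
  - exists l. split; [left; auto|]. split; [apply eta_neg; lra|]. intros; apply eta_le_exp.
  - exists 0. split; [right; auto|]. split.
    + rewrite Rmult_0_l, exp_0. apply eta_nonneg; lra.
    + intros y. rewrite Rmult_0_l, exp_0. apply eta_le1.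
Qed.

(** Front and weight carry separate shifts r and r2: in the stability proof from above they move
    together, in the one from below the weight stays fixed. *)
Lemma perturbed_super_test {g kappa c h phi phi1} l k (r r2 q : R -> R) r' r2' q' t z :
  wave g kappa c h phi phi1 -> is_derive r t r' -> is_derive r2 t r2' -> is_derive q t q' ->
  (forall s, 0 <= q s) -> eta l (z + r2 t) = exp (k * (z + r2 t)) ->
  (forall y, eta l y <= exp (k * y)) ->
  super_test c (fun t z => phi (z + r t) + q t * eta l (z + r2 t)) t z
    (r' * phi1 (z + r t) + g (phi (z + r t - c * h))
     + eta l (z + r2 t) * (q' + q t * (k * r2' - k ^ 2 + c * k + 1))).
Proof.
  intros W Hr Hr2 Hq Hq0 He Hle.
  exists (fun t z => phi (z + r t) + q t * exp (k * (z + r2 t))).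
  split; [|split; [|split]].
  - rewrite He. apply jet_plus; [apply (jet_wave _ _ _ _ W); auto|apply jet_exp; auto].
  - rewrite He. reflexivity.
  - exists 1. split; [lra|]. intros s _. apply Rplus_le_compat_l. apply Rmult_le_compat_l; auto.
  - apply filter_forall. intros y. apply Rplus_le_compat_l. apply Rmult_le_compat_l; auto.
Qed.

Lemma perturbed_sub_test {g kappa c h phi phi1} l k (r r2 q : R -> R) r' r2' q' t z :
  wave g kappa c h phi phi1 -> is_derive r t r' -> is_derive r2 t r2' -> is_derive q t q' ->
  (forall s, 0 <= q s) -> eta l (z + r2 t) = exp (k * (z + r2 t)) ->
  (forall y, eta l y <= exp (k * y)) ->
  sub_test c (fun t z => phi (z + r t) - q t * eta l (z + r2 t)) t z
    (r' * phi1 (z + r t) + g (phi (z + r t - c * h))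
     - eta l (z + r2 t) * (q' + q t * (k * r2' - k ^ 2 + c * k + 1))).
Proof.
  intros W Hr Hr2 Hq Hq0 He Hle.
  exists (fun t z => phi (z + r t) + - (q t * exp (k * (z + r2 t)))).
  split; [|split; [|split]].
  - rewrite He. apply jet_plus; [apply (jet_wave _ _ _ _ W); auto|apply jet_opp, jet_exp; auto].
  - rewrite He. reflexivity.
  - exists 1. split; [lra|]. intros s _. apply Rplus_le_compat_l. apply Ropp_le_contravar.
    apply Rmult_le_compat_l; auto.
  - apply filter_forall. intros y. apply Rplus_le_compat_l. apply Ropp_le_contravar.
    apply Rmult_le_compat_l; auto.
Qed.

Lemma continuous_perturbed (phi q r r2 : R -> R) l (p : R * R) :
  (forall x, continuous phi x) -> (forall x, continuous q x) ->
  (forall x, continuous r x) -> (forall x, continuous r2 x) ->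
  continuous (fun p : R * R => phi (snd p + r (fst p)) + q (fst p) * eta l (snd p + r2 (fst p))) p.
Proof.
  intros H1 H2 H3 H4.
  assert (Hetac := eta_continuous l). cont.
Qed.

(** * Monotonicity of fast fronts by sliding *)

Lemma small_rate (a b h : R) : 0 <= a -> 0 <= h -> a < b ->
  exists b0, 0 < b0 /\ forall be, 0 < be <= b0 -> a * exp (be * h) + be <= b.
Proof.
  intros Ha Hh Hab.
  assert (Hc : continuous (fun be => a * exp (be * h) + be) 0).
  { smooth. }
  assert (Hlt : 0 < b - a) by lra.
  destruct (proj1 (filterlim_locally _ _) Hc (mkposreal _ Hlt)) as [d Hd].
  pose proof (cond_pos d).
  exists (d / 2). split; [lra|]. intros be Hbe.
  specialize (Hd be). assert (Hb : ball 0 d be).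
  { apply Rabs_def1; simpl; unfold minus, plus, opp; simpl; lra. }
  specialize (Hd Hb). apply Rabs_def2 in Hd. simpl in Hd. unfold minus, plus, opp in Hd. simpl in Hd.
  rewrite Rmult_0_l, exp_0 in Hd. lra.
Qed.

(* A weight decay rate that works both near 0 (in the exponential weight) and near kappa. *)
Lemma decay_rate {g kappa p L} c h l :
  monostable g kappa p L -> 0 <= h -> symbol p c h l < 0 ->
  exists be d, 0 < be /\ 0 < d < kappa /\ 0 <= 1 - l ^ 2 + c * l - 2 * be /\ 0 <= 1 - 2 * be /\
    (forall u v, u <= v -> v <= d -> forall x, 0 <= x ->
       v - u <= exp (be * h) * exp (- l * c * h) * x ->
       g v - g u <= (1 - l ^ 2 + c * l - 2 * be) * x) /\
    (forall u v, kappa - d <= u -> u <= v -> forall x, 0 <= x ->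
       v - u <= exp (be * h) * x -> g v - g u <= (1 - 2 * be) * x).
Proof.
  intros Hg Hh Hs.
  pose proof (ms_p Hg) as Hp.
  destruct (symbol_margin p c h l Hs) as [e [He Hm]]. unfold symbol in Hm.
  destruct (ms_near0 Hg e He) as [d1 [Hd1 Hn1]].
  destruct (ms_near_kappa Hg) as (gam & d2 & Hgam & Hd2 & Hn2).
  set (G := (p + e) * exp (- l * c * h)) in *.
  assert (HG : 0 < G) by (apply Rmult_lt_0_compat; [lra|apply exp_pos]).
  destruct (small_rate G (1 - l ^ 2 + c * l) h) as [b1 [Hb1 H1]]; [lra|exact Hh|lra|].
  destruct (small_rate gam 1 h) as [b2 [Hb2 H2]]; [lra|exact Hh|lra|].
  (* Half of the admissible rate is used, so that a margin of 2 be is left instead of be. *)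
  pose (b := Rmin b1 b2). pose (be := b / 2).
  assert (Hb : 0 < b) by (apply Rmin_pos; auto).
  assert (b <= b1) by apply Rmin_l. assert (b <= b2) by apply Rmin_r.
  assert (Hbe : exp (be * h) <= exp (b * h)) by (apply exp_mono; unfold be; nra).
  specialize (H1 b ltac:(lra)). specialize (H2 b ltac:(lra)).
  pose (d := Rmin d1 d2).
  assert (Hd : 0 < d) by (apply Rmin_pos; lra).
  assert (d <= d1) by apply Rmin_l. assert (d <= d2) by apply Rmin_r.
  assert (0 < G * exp (b * h)) by pos.
  assert (0 <= gam * exp (b * h)) by pos.
  exists be, d. split; [unfold be; lra|]. split; [lra|].
  split; [unfold be; lra|]. split; [unfold be; lra|]. split.
  - intros u v Huv Hv x Hx Hd'. specialize (Hn1 u v Huv ltac:(lra)).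
    assert ((p + e) * (v - u) <= (p + e) * (exp (be * h) * exp (- l * c * h) * x)) by (apply Rmult_le_compat_l; lra).
    assert (G * exp (be * h) * x <= (1 - l ^ 2 + c * l - 2 * be) * x); [|unfold G in *; lra].
    apply Rmult_le_compat_r; [exact Hx|].
    assert (G * exp (be * h) <= G * exp (b * h)) by (apply Rmult_le_compat_l; lra). unfold be in *; lra.
  - intros u v Hu Huv x Hx Hd'. specialize (Hn2 u v ltac:(lra) Huv).
    assert (gam * (v - u) <= gam * (exp (be * h) * x)) by (apply Rmult_le_compat_l; lra).
    assert (gam * exp (be * h) * x <= (1 - 2 * be) * x); [|lra].
    apply Rmult_le_compat_r; [exact Hx|].
    assert (gam * exp (be * h) <= gam * exp (b * h)) by (apply Rmult_le_compat_l; lra). unfold be in *; lra.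
Qed.

Lemma exp_decay_to_zero (a C be : R) : 0 < be -> (forall T, 0 <= T -> a <= C * exp (- be * T)) -> a <= 0.
Proof.
  intros Hbe H. apply Rnot_lt_le; intros Ha.
  assert (HC : 0 <= Rabs C) by apply Rabs_pos.
  destruct (small_tail be (Rabs C) a Hbe HC Ha) as [T [HT Hlt]].
  specialize (H T HT). pose proof (exp_pos (- be * T)). pose proof (Rle_abs C). nra.
Qed.

(** Order on a bounded interval extends to the tails: phi(z + s) + Q e^(-be t) eta satisfies the
    supersolution inequality where the order is unknown and dominates phi initially, so t -> oo
    gives the claim. That Z is independent of s is what sliding requires. *)
Lemma slide_tail {g kappa p L c h phi phi1} l Q :
  monostable g kappa p L -> wave g kappa c h phi phi1 -> 0 < c -> 0 <= h ->
  0 < l -> symbol p c h l < 0 -> 0 < Q -> (forall z, phi z <= Q * eta l z) ->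
  exists Z, 0 < Z /\ forall s, 0 < s ->
    (forall z, - Z <= z <= Z -> phi z <= phi (z + s)) -> forall z, phi z <= phi (z + s).
Proof.
  intros Hg W Hc Hh Hl Hs HQ HQe.
  destruct (decay_rate c h l Hg Hh Hs) as (be & d & Hbe & Hd & Hrate & Hrate1 & Hz & Hk).
  destruct (wv_left W d ltac:(lra)) as [Z1 [HZ1 HL1]].
  destruct (wv_right W d ltac:(lra)) as [Z2 [HZ2 HR2]].
  pose proof (ms_L _ _ _ _ Hg) as HL.
  assert (Hch : 0 <= c * h) by pos.
  pose (Z := Z1 + Z2 + c * h).
  exists Z. split; [unfold Z; lra|]. intros s Hs0 Hmid z.
  assert (phi z - phi (z + s) <= 0); [|lra].
  apply (exp_decay_to_zero _ Q be Hbe). intros T HT.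
  assert (Hcmp : phi z <= phi (z + s) + Q * exp (- be * T) * eta l (z + 0)).
  2:{ pose proof (eta_le1 l (z + 0)).
      assert (Q * exp (- be * T) * eta l (z + 0) <= Q * exp (- be * T) * 1).
      { apply Rmult_le_compat_l; [pos|exact H]. }
      lra. }
  pose (q := fun t => Q * exp (- be * t)).
  assert (Hq0 : forall t, 0 <= q t).
  { intros t. unfold q. pos. }
  apply (comparison c (c * h) h L T (fun _ z => phi z)
    (fun t z => phi (z + (fun _ => s) t) + q t * eta l (z + (fun _ => 0) t))); try lra.
  - intros pt. assert (Hcont := wave_continuous W). assert (Hetac := eta_continuous l).
    unfold q. cont.
  - exists kappa. intros t y Ht. pose proof (wv_lt W y).
    pose proof (wv_pos W (y + s)). specialize (Hq0 t).
    assert (0 <= q t * eta l (y + 0)) by pos. lra.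
  - intros t y Ht. specialize (HQe y). rewrite Rplus_0_r.
    assert (1 <= exp (- be * t)) by (apply exp_decay_ge1; lra).
    pose proof (wv_pos W (y + s)). pose proof (eta_pos l y).
    assert (Q * eta l y <= q t * eta l y).
    { apply Rmult_le_compat_r; [lra|]. unfold q. rewrite <- (Rmult_1_r Q) at 1. apply Rmult_le_compat_l; lra. }
    lra.
  - intros t y Ht.
    assert (Hpert : 0 <= q t * eta l (y + 0)).
    { apply Rmult_le_pos; [apply Hq0|left; apply eta_pos]. }
    destruct (Rle_lt_dec (phi y) (phi (y + s))) as [h0|h0]; [left; lra|right].
    destruct (eta_branch l (y + 0) Hl) as (k & Hkc & Hke & Hkle).
    exists (g (phi (y - c * h))).
    eexists. split; [|split].
    + apply jet_sub_test, (jet_wave_static _ _ W).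
    + apply (perturbed_super_test l k (fun _ => s) (fun _ => 0) q 0 0 (- be * q t) _ _ W); auto.
      * apply derive_const.
      * apply derive_const.
      * unfold q. auto_derive; [trivial|ring].
    + intros x Hx Hdel. rewrite !Rplus_0_r in *.
      assert (Hout : y < - Z \/ Z < y).
      { destruct (Rle_lt_dec (- Z) y); [|left; lra]. destruct (Rle_lt_dec y Z); [|right; lra].
        specialize (Hmid y ltac:(lra)). lra. }
      assert (Hqh : q (t - h) = exp (be * h) * q t).
      { unfold q. replace (- be * (t - h)) with (be * h + - be * t) by ring. rewrite exp_plus. ring. }
      set (a := phi (y - c * h)) in *. replace (y + s - c * h) with (y - c * h + s) by ring.
      set (b := phi (y - c * h + s)) in *.
      rewrite Hqh in Hdel.
      set (X := q t * eta l y).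
      assert (HX : 0 <= X) by exact Hpert.
      replace (eta l y * (- be * q t + q t * (k * 0 - k ^ 2 + c * k + 1)))
        with ((1 - k ^ 2 + c * k - be) * X) by (unfold X; ring).
      assert (HkX : 0 <= (1 - k ^ 2 + c * k - be) * X).
      { apply Rmult_le_pos; [|exact HX]. destruct Hkc as [[-> _]|[-> _]]; lra. }
      assert (HLx : 0 <= L * x) by pos.
      destruct (Rle_lt_dec a (b + x)) as [hab|hab].
      { destruct (Rle_lt_dec a b) as [h1|h1].
        - pose proof (ms_mono Hg _ _ h1). lra.
        - pose proof (ms_lip Hg b a ltac:(lra)).
          assert (L * (a - b) <= L * x) by (apply Rmult_le_compat_l; lra). lra. }
      (* The slack x granted by the comparison principle costs L x; the remaining difference is
         absorbed by the weight. *)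
      assert (Hg1 : g a - g (a - x) <= L * x).
      { pose proof (ms_lip Hg (a - x) a ltac:(lra)) as Hlip.
        replace (a - (a - x)) with x in Hlip by ring. exact Hlip. }
      assert (Hfin : g (a - x) - g b <= (1 - k ^ 2 + c * k - 2 * be) * X).
      { destruct Hout as [Hy|Hy].
        - assert (Hyn : y <= 0) by (unfold Z in Hy; lra).
          destruct Hkc as [[-> _]|[_ Hpos]]; [|lra].
          apply Hz; [lra| |exact HX|].
          + assert (a < d) by (apply HL1; unfold Z in Hy; lra). lra.
          + unfold X. rewrite !eta_neg in * by lra.
            replace (l * (y - c * h)) with (- l * c * h + l * y) in Hdel by ring. rewrite exp_plus in Hdel.
            lra.
        - assert (Hyp : 0 < y) by (unfold Z in Hy; lra).
          destruct Hkc as [[_ Hn]|[-> _]]; [lra|].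
          replace (1 - 0 ^ 2 + c * 0 - 2 * be) with (1 - 2 * be) by ring.
          (* If the delayed point lay in the interval [-Z, Z], the order assumed there would
             contradict [hab]. *)
          assert (Hyz : Z < y - c * h).
          { apply Rnot_le_lt; intros Hle.
            assert (phi (y - c * h) <= phi (y - c * h + s)) by (apply Hmid; unfold Z in *; lra).
            fold a b in H. lra. }
          apply Hk; [| lra |exact HX|].
          + left. apply HR2. unfold Z in Hyz; lra.
          + unfold X. rewrite (eta_nonneg l y) by lra. rewrite eta_nonneg in Hdel by (unfold Z in Hyz; lra). lra. }
      assert (HbX : 0 <= be * X) by pos.
      lra.
Qed.

Lemma wave_lipschitz {g kappa p L c h phi phi1} :
  monostable g kappa p L -> wave g kappa c h phi phi1 ->
  exists K, 0 < K /\ forall x y, Rabs (phi y - phi x) <= K * Rabs (y - x).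
Proof.
  intros Hg W. destruct (nu_facts c) as (_ & _ & Hn1 & Hn2).
  pose proof (ms_kappa Hg) as Hk.
  exists ((nu2 c - nu1 c) * kappa). split; [nra|].
  apply (derivative_lipschitz phi phi1); [apply W|].
  intros z. destruct (wave_harnack Hg W z).
  pose proof (wv_lt W z).
  apply Rabs_le. split; nra.
Qed.

Lemma wave_not_periodic {g kappa c h phi phi1} s :
  wave g kappa c h phi phi1 -> 0 < s -> (forall z, phi (z + s) = phi z) -> False.
Proof.
  intros W Hs Hper.
  assert (Hn : forall n, phi (0 + INR n * s) = phi 0).
  { induction n as [|n IH].
    - simpl. rewrite Rmult_0_l, Rplus_0_r. reflexivity.
    - rewrite S_INR. replace (0 + (INR n + 1) * s) with (0 + INR n * s + s) by ring.
      rewrite Hper. exact IH. }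
  pose proof (wv_lt W 0) as H0.
  destruct (wv_right W (kappa - phi 0) ltac:(lra)) as [Z [HZ HR]].
  destruct (nfloor_ex (Z / s)) as [n Hn2]; [apply Rdiv_le_0_compat; lra|].
  specialize (HR (0 + INR (S n) * s)). rewrite Hn in HR.
  assert (Z <= 0 + INR (S n) * s); [|lra].
  rewrite S_INR. destruct Hn2 as [_ Hn2].
  apply (Rmult_lt_compat_r s) in Hn2; [|exact Hs].
  replace (Z / s * s) with Z in Hn2 by (field; lra). lra.
Qed.

(** Let [sb] be the supremum of the shifts for which the order fails. At [sb] it holds by
    continuity, and strictly by the strong maximum principle, as phi is not periodic; the margin on
    [-Z, Z] survives a small decrease of the shift, and the tails follow. *)
Lemma fast_front_monotone {g kappa p L c h phi phi1} l Q :
  monostable g kappa p L -> wave g kappa c h phi phi1 -> 0 < c -> 0 <= h ->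
  0 < l -> symbol p c h l < 0 -> 0 < Q -> (forall z, phi z <= Q * eta l z) ->
  forall s, 0 < s -> forall z, phi z <= phi (z + s).
Proof.
  intros Hg W Hc Hh Hl Hs HQ HQe.
  destruct (slide_tail l Q Hg W Hc Hh Hl Hs HQ HQe) as [Z [HZ Hslide]].
  assert (Hcont := wave_continuous W).
  pose (P := fun s => forall z, phi z <= phi (z + s)).
  destruct (continuous_pos_min (fun z => kappa - phi z) (- Z) Z) as [m0 [Hm0 Hmin0]].
  { lra. }
  { intros z. apply cont_minus; [apply continuous_const|apply Hcont]. }
  { intros z _. pose proof (wv_lt W z). lra. }
  destruct (wv_right W m0 Hm0) as [Z2 [HZ2 HR2]].
  assert (Hbig : forall s, Z + Z2 <= s -> P s).
  { intros s Hs1. unfold P. apply Hslide; [lra|]. intros z Hz.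
    specialize (Hmin0 z Hz). specialize (HR2 (z + s) ltac:(lra)). lra. }
  destruct (wave_lipschitz Hg W) as [K [HK Hlip]].
  assert (Hall : forall s, 0 < s -> P s); [|exact Hall].
  intros s1 Hs1. apply NNPP; intros Hn.
  pose (E := fun s => 0 < s /\ ~ P s).
  destruct (completeness E) as [sb [Hub Hlub]].
  { exists (Z + Z2). intros s [_ Hs2]. apply Rnot_lt_le; intros Hlt. apply Hs2, Hbig. lra. }
  { exists s1. split; assumption. }
  assert (Hsb : s1 <= sb) by (apply Hub; split; assumption).
  assert (Habove : forall s, sb < s -> P s).
  { intros s Hs2. apply NNPP; intros Hns. assert (s <= sb) by (apply Hub; split; [lra|exact Hns]). lra. }
  assert (HPsb : P sb).
  { intros z. apply le_epsilon. intros e He.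
    pose (r := e / K). assert (Hr : 0 < r) by (apply Rdiv_lt_0_compat; lra).
    specialize (Habove (sb + r) ltac:(lra) z).
    specialize (Hlip (z + sb) (z + (sb + r))).
    replace (z + (sb + r) - (z + sb)) with r in Hlip by ring.
    rewrite (Rabs_right r) in Hlip by lra.
    replace (K * r) with e in Hlip by (unfold r; field; lra).
    apply Rabs_le_between in Hlip. lra. }
  assert (Hpos : forall z, 0 < phi (z + sb) - phi z).
  { assert (Hnn : forall z, 0 <= phi (z + sb) - phi z) by (intros z; specialize (HPsb z); lra).
    intros z. destruct (Hnn z) as [h0|h0]; [exact h0|exfalso].
    apply (wave_not_periodic sb W); [lra|].
    intros x. apply Rminus_diag_uniq.
    apply (ode_zero c _ (fun x => phi (x + sb) - phi x) _ z
      (ode_minus c _ _ _ _ _ _ (ode_shift c sb _ _ _ (wv_ode W)) (wv_ode W))); auto.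
    intros y. replace (y + sb - c * h) with (y - c * h + sb) by ring.
    pose proof (ms_mono Hg _ _ (HPsb (y - c * h))). lra. }
  destruct (continuous_pos_min (fun z => phi (z + sb) - phi z) (- Z) Z) as [m [Hm Hmin]].
  { lra. }
  { intros z. apply (cont_minus (fun z => phi (z + sb))); [|apply Hcont].
    apply (continuous_comp (fun z => z + sb) phi); [|apply Hcont].
    smooth. }
  { intros z _. apply Hpos. }
  pose (r := Rmin (m / K) (sb / 2)).
  assert (Hr : 0 < r) by (apply Rmin_pos; [apply Rdiv_lt_0_compat; lra|lra]).
  assert (Hr1 : r <= m / K) by apply Rmin_l.
  assert (Hr2 : r <= sb / 2) by apply Rmin_r.
  assert (Hnear : forall s, sb - r <= s <= sb -> P s).
  { intros s Hs2. unfold P. apply Hslide; [lra|]. intros z Hz. specialize (Hmin z Hz).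
    specialize (Hlip (z + s) (z + sb)).
    replace (z + sb - (z + s)) with (sb - s) in Hlip by ring.
    rewrite (Rabs_right (sb - s)) in Hlip by lra.
    assert (K * (sb - s) <= m).
    { apply Rle_trans with (K * (m / K)); [apply Rmult_le_compat_l; lra|]. right; field; lra. }
    apply Rabs_le_between in Hlip. lra. }
  assert (sb <= sb - r); [|lra].
  apply Hlub. intros s [Hs2 Hs3]. apply Rnot_lt_le; intros Hlt. apply Hs3.
  destruct (Rle_lt_dec s sb); [apply Hnear; lra|apply Habove; lra].
Qed.

(** That phi' is o(eta) at both ends means that in the tails a small translation costs far less than
    a comparable multiple of the weight. *)
Record front (g : R -> R) (kappa c h l : R) (phi phi1 : R -> R) : Prop := {
  fr_wave : wave g kappa c h phi phi1;
  fr_deriv_pos : forall z, 0 < phi1 z;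
  fr_deriv_bound : exists C, 0 < C /\ forall z, phi1 z <= C * eta l z;
  fr_deriv_tail : forall e, 0 < e -> exists Z, 0 < Z /\ forall z, Z <= Rabs z -> phi1 z <= e * eta l z;
  fr_left : forall e, 0 < e -> exists Z, 0 < Z /\ forall z, z <= - Z -> phi z <= e * eta l z }.

Arguments fr_wave {g kappa c h l phi phi1}.
Arguments fr_deriv_pos {g kappa c h l phi phi1}.
Arguments fr_deriv_bound {g kappa c h l phi phi1}.
Arguments fr_deriv_tail {g kappa c h l phi phi1}.
Arguments fr_left {g kappa c h l phi phi1}.

(** The surplus of l' over l turns the bound on phi into o(eta) on the left, and the Harnack
    inequalities for phi and kappa - phi pass smallness on to phi'. *)
Lemma fast_wave_front {g kappa p L c h phi phi1} l l' M :
  monostable g kappa p L -> wave g kappa c h phi phi1 -> 0 < c -> 0 <= h ->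
  0 < l -> l < l' -> symbol p c h l < 0 -> 0 < M -> (forall z, phi z <= M * exp (l' * z)) ->
  front g kappa c h l phi phi1.
Proof.
  intros Hg W Hc Hh Hl Hll Hs HM HMz.
  pose proof (ms_kappa Hg) as Hk.
  destruct (nu_facts c) as (_ & _ & Hn1 & Hn2).
  assert (Hharn := wave_harnack Hg W).
  pose (Q := Rmax kappa M).
  assert (HQ : 0 < Q) by (apply Rlt_le_trans with kappa; [lra|apply Rmax_l]).
  assert (HQe : forall z, phi z <= Q * eta l z).
  { intros z. destruct (Rle_lt_dec z 0) as [hz|hz].
    - rewrite eta_neg by lra. apply Rle_trans with (M * exp (l' * z)); [apply HMz|].
      apply Rmult_le_compat; [lra|left; apply exp_pos|apply Rmax_r|apply exp_mono; nra].
    - rewrite eta_nonneg by lra. rewrite Rmult_1_r. left.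
      apply Rlt_le_trans with kappa; [apply W|apply Rmax_l]. }
  assert (Hmono := fast_front_monotone l Q Hg W Hc Hh Hl Hs HQ HQe).
  destruct (wv_ode W) as [Ho1 Ho2].
  assert (Hge : forall z, 0 <= phi1 z).
  { intros z. apply (derive_ge0_of_left_max phi z (phi1 z) 1); [lra|apply Ho1|].
    intros s Hs'. specialize (Hmono (z - s) ltac:(lra) s). replace (s + (z - s)) with z in Hmono by ring. exact Hmono. }
  (* Harnack inequality for the nonnegative difference of two translates; infinitesimally it reads
     phi'' <= nu2 phi'. *)
  assert (Hslope : forall z s, 0 < s -> phi1 (z + s) - nu2 c * phi (z + s) <= phi1 z - nu2 c * phi z).
  { intros z s Hs'.
    destruct (ode_harnack c _ _ _ (ode_minus c _ _ _ _ _ _ (ode_shift c s _ _ _ (wv_ode W)) (wv_ode W))) with (z := z) as [_ H].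
    - intros x. replace (x + s - c * h) with (x - c * h + s) by ring.
      pose proof (ms_mono Hg _ _ (Hmono s Hs' (x - c * h))). lra.
    - intros x. specialize (Hmono s Hs' x). lra.
    - lra. }
  assert (Hphi2 : forall z, c * phi1 z + phi z - g (phi (z - c * h)) <= nu2 c * phi1 z).
  { intros z.
    assert (c * phi1 z + phi z - g (phi (z - c * h)) - nu2 c * phi1 z <= 0); [|lra].
    apply (derive_le0_of_right_max (fun x => phi1 x - nu2 c * phi x) z _ 1); [lra| |].
    - apply derive_minus; [apply Ho2|].
      apply is_derive_scal, Ho1.
    - intros s Hs'. specialize (Hslope z (s - z) ltac:(lra)). replace (z + (s - z)) with s in Hslope by ring. exact Hslope. }
  assert (Htail : forall e, 0 < e -> exists Z, 0 < Z /\ forall z, z <= - Z -> phi z <= e * eta l z).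
  { intros e He. destruct (small_tail (l' - l) M e) as [R0 [HR0 HR]]; [lra|lra|exact He|].
    exists (R0 + 1). split; [lra|]. intros z Hz. rewrite eta_neg by lra.
    eapply Rle_trans; [apply HMz|].
    replace (l' * z) with ((l' - l) * z + l * z) by ring. rewrite exp_plus, <- Rmult_assoc.
    apply Rmult_le_compat_r; [left; apply exp_pos|].
    assert (exp ((l' - l) * z) <= exp (- (l' - l) * R0)) by (apply exp_mono; nra). nra. }
  constructor; auto.
  (* By phi'' <= nu2 phi' a zero of phi' persists to the right, and phi could not rise to kappa. *)
  - intros z. destruct (Hge z) as [h0|h0]; [exact h0|exfalso].
    assert (Hz : forall x, z <= x -> phi1 x = 0).
    { intros x Hx. apply Rle_antisym; [|apply Hge].
      pose proof (log_derivative_growth phi1 _ (nu2 c) z x Ho2 Hphi2 Hx). rewrite <- h0 in H. lra. }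
    pose proof (wv_lt W z) as Hlt.
    destruct (wv_right W (kappa - phi z) ltac:(lra)) as [Z [HZ HR]].
    pose (x := Rmax z Z).
    assert (z <= x) by apply Rmax_l. assert (Z <= x) by apply Rmax_r.
    assert (phi x <= phi z).
    { apply (derive_le0_antitone phi phi1); [intros; apply Ho1| |exact H].
      intros y Hy. rewrite Hz; lra. }
    specialize (HR x H0). lra.
  - exists (nu2 c * Q). split; [apply Rmult_lt_0_compat; auto|]. intros z.
    specialize (Hharn z). specialize (HQe z). nra.
  - intros e He.
    destruct (Htail (e / nu2 c)) as [Z1 [HZ1 H1]]; [apply Rdiv_lt_0_compat; lra|].
    destruct (wv_right W (e / - nu1 c)) as [Z2 [HZ2 H2]]; [apply Rdiv_lt_0_compat; lra|].
    exists (Z1 + Z2). split; [lra|]. intros z Hz.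
    destruct (Rle_lt_dec 0 z) as [hz|hz].
    + rewrite Rabs_right in Hz by lra. rewrite eta_nonneg by lra.
      specialize (H2 z ltac:(lra)).
      pose proof (wave_harnack_right Hg W z).
      assert (- nu1 c * (kappa - phi z) <= - nu1 c * (e / - nu1 c)) by (apply Rmult_le_compat_l; lra).
      replace (- nu1 c * (e / - nu1 c)) with e in H0 by (field; lra). lra.
    + rewrite Rabs_left in Hz by lra. specialize (H1 z ltac:(lra)). specialize (Hharn z).
      assert (nu2 c * phi z <= nu2 c * (e / nu2 c * eta l z)) by (apply Rmult_le_compat_l; lra).
      replace (nu2 c * (e / nu2 c * eta l z)) with (e * eta l z) in H by (field; lra). lra.
Qed.

(** * Increments of a front measured by the weight *)

Lemma front_monotone {g kappa c h l phi phi1 x y} :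
  front g kappa c h l phi phi1 -> x <= y -> phi x <= phi y.
Proof.
  intros F Hxy. destruct (wv_ode (fr_wave F)) as [Ho _].
  apply (derive_ge0_monotone phi phi1); auto. intros. left; apply F.
Qed.

Lemma front_strict {g kappa c h l phi phi1 x y} :
  front g kappa c h l phi phi1 -> x < y -> phi x < phi y.
Proof.
  intros F Hxy. destruct (wv_ode (fr_wave F)) as [Ho _].
  destruct (mean_value phi phi1 x y (fun z _ => Ho z) (Rlt_le _ _ Hxy)) as [w [_ Hm]].
  pose proof (fr_deriv_pos F w). nra.
Qed.

Lemma front_increment {g kappa c h l phi phi1} : 0 < l ->
  front g kappa c h l phi phi1 ->
  exists C, 0 < C /\ forall x y, x <= y -> phi y - phi x <= C * (y - x) * eta l y.
Proof.
  intros Hl F. destruct (wv_ode (fr_wave F)) as [Ho _].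
  destruct (fr_deriv_bound F) as [C [HC Hb]].
  exists C. split; [exact HC|]. intros x y Hxy.
  assert (Rabs (phi y - phi x) <= C * eta l y * (y - x)).
  { apply (derive_bound_lip phi phi1); auto. intros z Hz.
    pose proof (fr_deriv_pos F z). rewrite Rabs_right by lra.
    eapply Rle_trans; [apply Hb|]. apply Rmult_le_compat_l; [lra|]. apply eta_mono; lra. }
  pose proof (Rle_abs (phi y - phi x)). lra.
Qed.

Lemma front_increment_tail {g kappa c h l phi phi1} e : 0 < l ->
  front g kappa c h l phi phi1 -> 0 < e ->
  exists Z, 0 < Z /\ forall z nu, Z <= Rabs z -> 0 <= nu <= 1 ->
    phi (z + nu) - phi z <= e * nu * eta l z /\ phi z - phi (z - nu) <= e * nu * eta l z.
Proof.
  intros Hl F He. destruct (wv_ode (fr_wave F)) as [Ho _].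
  pose (e1 := e * exp (- l)).
  assert (He1 : 0 < e1) by (apply Rmult_lt_0_compat; [lra|apply exp_pos]).
  destruct (fr_deriv_tail F e1 He1) as [Z [HZ Hb]].
  exists (Z + 1). split; [lra|].
  assert (Hgen : forall a b z, a <= b -> (forall x, a <= x <= b -> z - 1 <= x <= z + 1) ->
     Z + 1 <= Rabs z -> phi b - phi a <= e * (b - a) * eta l z).
  { intros a b z Hab Hx Hz.
    assert (Rabs (phi b - phi a) <= e * eta l z * (b - a)).
    { apply (derive_bound_lip phi phi1); auto. intros x Hxab.
      pose proof (fr_deriv_pos F x). rewrite Rabs_right by lra.
      specialize (Hx x Hxab).
      apply Rle_trans with (e1 * eta l x).
      - apply Hb. destruct (Rle_lt_dec 0 z).
        + rewrite Rabs_right in Hz by lra. rewrite Rabs_right; lra.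
        + rewrite Rabs_left in Hz by lra. rewrite Rabs_left; lra.
      - unfold e1. rewrite Rmult_assoc. apply Rmult_le_compat_l; [lra|].
        apply Rle_trans with (exp (- l * 1) * eta l (z + 1)).
        + rewrite Rmult_1_r. apply Rmult_le_compat_l; [left; apply exp_pos|]. apply eta_mono; lra.
        + pose proof (eta_shift l (z + 1) 1 Hl ltac:(lra)).
          replace (z + 1 - 1) with z in H0 by ring. exact H0. }
    pose proof (Rle_abs (phi b - phi a)). lra. }
  intros z nu Hz Hnu. split.
  - replace (e * nu) with (e * (z + nu - z)) by ring. apply Hgen; auto; [lra|]. intros; lra.
  - replace (e * nu) with (e * (z - (z - nu))) by ring. apply Hgen; auto; [lra|]. intros; lra.
Qed.

(** * Stability of the family of translates *)

(** An excess y at the delayed point changes the reaction by at most L y, as g is monotone and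
    Lipschitz. *)
Lemma comparison_delay {g kappa p L} (c h T : R) (u v : R -> R -> R) :
  monostable g kappa p L -> 0 <= c -> 0 <= h ->
  (forall p : R * R, continuous (fun p => u (fst p) (snd p) - v (fst p) (snd p)) p) ->
  (exists M, forall t z, 0 <= t <= T -> u t z - v t z <= M) ->
  (forall t z, - h <= t <= 0 -> u t z <= v t z) ->
  (forall t z, 0 < t <= T -> u t z <= v t z \/
     exists pu pv, sub_test c u t z pu /\ super_test c v t z pv /\
       pu <= g (u (t - h) (z - c * h)) /\ g (v (t - h) (z - c * h)) <= pv) ->
  forall t z, - h <= t <= T -> u t z <= v t z.
Proof.
  intros Hg Hc Hh H1 H2 H3 H4. pose proof (ms_L _ _ _ _ Hg) as HL.
  apply (comparison c (c * h) h L T u v); auto; [lra|].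
  intros t z Ht. destruct (H4 t z Ht) as [h0|(pu & pv & k1 & k2 & k3 & k4)]; [left; exact h0|right].
  exists pu, pv. split; [exact k1|]. split; [exact k2|]. intros y Hy Hd.
  destruct (Rle_lt_dec (v (t - h) (z - c * h)) (u (t - h) (z - c * h))) as [h0|h0].
  - pose proof (ms_lip Hg _ _ h0). nra.
  - pose proof (ms_mono Hg _ _ (Rlt_le _ _ h0)). nra.
Qed.

Record evolution (g : R -> R) (kappa c h : R) (w : R -> R -> R) : Prop := {
  ev_cont : forall p : R * R, continuous (fun p => w (fst p) (snd p)) p;
  ev_range : forall t z, 0 <= w t z <= kappa;
  ev_jet : forall t z, 0 < t -> jet c w t z (g (w (t - h) (z - c * h))) }.

Arguments ev_cont {g kappa c h w}.
Arguments ev_range {g kappa c h w}.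
Arguments ev_jet {g kappa c h w}.

Lemma evolution_shift {g kappa c h w} t0 :
  0 <= t0 -> evolution g kappa c h w -> evolution g kappa c h (fun t z => w (t0 + t) z).
Proof.
  intros Ht0 E. constructor.
  - intros p. apply (continuous_comp (fun p : R * R => (t0 + fst p, snd p)) (fun p : R * R => w (fst p) (snd p))).
    + intros P [d Hd]. exists d. intros q [h1 h2]. apply Hd. split; [|exact h2].
      simpl. unfold ball in *; simpl in *. unfold AbsRing_ball, abs, minus, plus, opp in *; simpl in *.
      replace (t0 + fst q + - (t0 + fst p)) with (fst q + - fst p) by ring. exact h1.
    + apply E.
  - intros; apply E.
  - intros t z Ht.
    destruct (ev_jet E (t0 + t) z ltac:(lra)) as (U1 & ut & uzz & h1 & h2 & h3 & h4).
    exists U1, ut, uzz. split; [|split; [exact h2|split; [exact h3|]]].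
    + evar_last.
      * apply (is_derive_comp (fun s => w s z) (fun s => t0 + s)); [exact h1|auto_derive; [trivial|reflexivity]].
      * unfold scal; simpl; unfold mult; simpl. ring.
    + rewrite <- h4. replace (t0 + (t - h)) with (t0 + t - h) by ring. reflexivity.
Qed.

Lemma is_derive_qexp (q be t : R) : is_derive (fun s => q * exp (- be * s)) t (- be * (q * exp (- be * t))).
Proof. auto_derive; [trivial|ring]. Qed.

Lemma derivable_continuous_all (f f1 : R -> R) : (forall x, is_derive f x (f1 x)) -> forall x, continuous f x.
Proof. intros H x. eapply is_derive_cont, H. Qed.

Lemma eta_shift_le l z s : 0 < l -> 0 <= s <= 1 -> eta l z <= exp l * eta l (z - s).
Proof.
  intros Hl Hs. pose proof (eta_shift l z s Hl ltac:(lra)) as H.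
  apply (Rmult_le_compat_l (exp l)) in H; [|left; apply exp_pos].
  eapply Rle_trans; [|exact H]. rewrite <- Rmult_assoc, <- exp_plus.
  rewrite <- (Rmult_1_l (eta l z)) at 1. apply Rmult_le_compat_r; [left; apply eta_pos|].
  apply exp_ge1. nra.
Qed.

(* Moving a translate at speed K q pays for a perturbation of size q: in the tails the weight eta absorbs the delayed reaction, and in between phi' is bounded below. *)
Lemma moving_front_absorbs {g kappa p L c h l phi phi1} Q :
  monostable g kappa p L -> front g kappa c h l phi phi1 -> 0 < c -> 0 <= h -> 0 < l ->
  symbol p c h l < 0 -> 0 < Q ->
  exists K be d, 0 < K /\ 0 < be /\ 0 < d /\ forall x y q k u v,
    Rabs (x - y) <= 1 -> 0 < q <= Q -> (k = l /\ y <= 0 \/ k = 0 /\ 0 < y) ->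
    u <= phi (x - c * h) <= v -> v - u <= exp (be * h) * q * eta l (y - c * h) ->
    u = phi (x - c * h) \/ exp (be * h) * q <= d ->
    g v - g u <= K * q * phi1 x + (1 - k ^ 2 + c * k - be) * (q * eta l y).
Proof.
  intros Hg F Hc Hh Hl Hs HQ.
  assert (W := fr_wave F). destruct (wv_ode W) as [_ Ho2].
  destruct (decay_rate c h l Hg Hh Hs) as (be & d & Hbe & Hd & _ & _ & Hz & Hk).
  pose proof (ms_L _ _ _ _ Hg) as HL.
  assert (Hch : 0 <= c * h) by pos.
  destruct (wv_left W (d / 2) ltac:(lra)) as [Z1 [HZ1 HL1]].
  destruct (wv_right W (d / 2) ltac:(lra)) as [Z2 [HZ2 HR2]].
  set (eh := exp (be * h)) in *. assert (Heh : 0 < eh) by apply exp_pos.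
  (* Even a perturbation of the full size Q is below d / 2 far enough to the left, because it
     carries the weight. *)
  destruct (small_tail l (Q * eh) (d / 2) Hl) as [Z3 [HZ3 HL3]]; [pos|lra|].
  pose (Z := Z1 + Z2 + Z3 + c * h + 1).
  (* The interval is widened by 1 because the front is evaluated at x and the weight at y. *)
  destruct (continuous_pos_min phi1 (- (Z + 1)) (Z + 1)) as [m [Hm Hmin]].
  { unfold Z; lra. }
  { intros z. exact (is_derive_cont _ _ _ (Ho2 z)). }
  { intros; apply F. }
  assert (Hl2 : 0 <= l ^ 2) by apply pow2_ge_0.
  assert (HLe : 0 < L * eh) by pos.
  (* In the middle K q phi' has to pay for the delayed reaction, for the term k^2 of the weight and
     for the decay rate. *)
  exists ((L * eh + l ^ 2 + be) / m), be, (d / 2).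
  split; [apply Rdiv_lt_0_compat; lra|]. split; [exact Hbe|]. split; [lra|].
  intros x y q k u v Hxy Hq Hkc Huv Hdiff Hsmall. apply Rabs_le_between in Hxy. fold eh in Hdiff, Hsmall.
  pose proof (eta_le1 l y) as Hey1.
  pose proof (eta_le1 l (y - c * h)) as Hed1.
  set (X := q * eta l y).
  assert (HX : 0 < X) by (unfold X; pos).
  assert (HXq : X <= q * 1) by (apply Rmult_le_compat_l; lra).
  assert (Hehq : 0 < eh * q) by pos.
  assert (Hvu : v - u <= eh * q).
  { eapply Rle_trans; [exact Hdiff|]. apply Rle_trans with (eh * q * 1); [apply Rmult_le_compat_l|]; lra. }
  assert (HbX : 0 < be * X) by pos.
  set (K := (L * eh + l ^ 2 + be) / m).
  assert (HK : 0 < K) by (apply Rdiv_lt_0_compat; lra).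
  assert (Hp1 : 0 < K * q * phi1 x) by (pose proof (fr_deriv_pos F x); pos).
  destruct (Rle_lt_dec (- Z) y) as [hz1|hz1]; [destruct (Rle_lt_dec y Z) as [hz2|hz2]|].
  - specialize (Hmin x ltac:(lra)).
    pose proof (ms_lip Hg u v ltac:(lra)) as Hlip.
    assert (L * (v - u) <= L * (eh * q)) by (apply Rmult_le_compat_l; lra).
    assert ((L * eh + l ^ 2 + be) * q <= K * q * phi1 x).
    { replace ((L * eh + l ^ 2 + be) * q) with (K * q * m) by (unfold K; field; lra).
      apply Rmult_le_compat_l; [pos|exact Hmin]. }
    assert (Hkl : 0 <= k /\ k ^ 2 <= l ^ 2) by (destruct Hkc as [[-> _]|[-> _]]; lra).
    assert (0 <= (1 + c * k) * X).
    { assert (0 <= c * k) by (apply Rmult_le_pos; lra). pos. }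
    assert (k ^ 2 * X <= l ^ 2 * q) by (apply Rmult_le_compat; [apply pow2_ge_0|lra|lra|lra]).
    assert (be * X <= be * q) by (apply Rmult_le_compat_l; lra).
    lra.
  - destruct Hkc as [[_ Hn]|[-> _]]; [unfold Z in hz2; lra|].
    assert (g v - g u <= (1 - 2 * be) * X); [|lra].
    assert (HXe : X = q) by (unfold X; rewrite eta_nonneg by (unfold Z in hz2; lra); ring).
    (* The slope bound needs its smaller argument above kappa - d: it is the front itself, or the
       perturbation is small. *)
    apply Hk; [|lra|lra|rewrite HXe; exact Hvu].
    specialize (HR2 (x - c * h) ltac:(unfold Z in hz2; lra)). destruct Hsmall; lra.
  - destruct Hkc as [[-> _]|[_ Hn]]; [|unfold Z in hz1; lra].
    assert (Hdist : eta l (y - c * h) = exp (l * (y - c * h))) by (apply eta_neg; unfold Z in hz1; lra).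
    assert (g v - g u <= (1 - l ^ 2 + c * l - 2 * be) * X); [|lra].
    apply Hz; [lra| |lra|].
    + specialize (HL1 (x - c * h) ltac:(unfold Z in hz1; lra)).
      assert (eh * q * eta l (y - c * h) <= Q * eh * exp (- l * Z3)).
      { rewrite Hdist. apply Rmult_le_compat; [lra|left; apply exp_pos| |].
        - rewrite (Rmult_comm Q). apply Rmult_le_compat_l; lra.
        - apply exp_mono. assert (0 <= l * (- (y - c * h) - Z3)) by (apply Rmult_le_pos; unfold Z in hz1; lra). lra. }
      lra.
    + eapply Rle_trans; [exact Hdiff|]. right. rewrite Hdist. unfold X. rewrite eta_neg by (unfold Z in hz1; lra).
      replace (l * (y - c * h)) with (- l * c * h + l * y) by ring. rewrite exp_plus. ring.
Qed.

(** Front and weight move to the left together; the drift of the weight then has the favourable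
    sign. Q may be any size, since only the bound below kappa restricts perturbations, and here the
    front is the smaller function. *)
Lemma stability_above {g kappa p L c h l phi phi1} Q :
  monostable g kappa p L -> front g kappa c h l phi phi1 -> 0 < c -> 0 <= h -> 0 < l ->
  symbol p c h l < 0 -> 0 < Q ->
  exists K be, 0 < K /\ 0 < be /\ forall w, evolution g kappa c h w -> forall a q, 0 < q <= Q ->
    (forall t z, - h <= t <= 0 -> w t z <= phi (z + a) + q * eta l (z + a)) ->
    forall t z, 0 <= t ->
      w t z <= phi (z + (a + K * q)) + q * exp (- be * t) * eta l (z + (a + K * q)).
Proof.
  intros Hg F Hc Hh Hl Hs HQ.
  assert (W := fr_wave F). destruct (wv_ode W) as [Ho1 _].
  destruct (moving_front_absorbs Q Hg F Hc Hh Hl Hs HQ)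
    as (K0 & be & d & HK0 & Hbe & _ & Habs).
  set (eh := exp (be * h)) in *. assert (Heh : 0 < eh) by apply exp_pos.
  pose (K1 := K0 / be). assert (HK1 : 0 < K1) by (apply Rdiv_lt_0_compat; lra).
  assert (HK1e : K1 * be = K0) by (unfold K1; field; lra).
  exists (K1 * eh), be. split; [pos|]. split; [exact Hbe|].
  intros w E a q Hq Hinit t0 z0 Ht0.
  pose (qt := fun t => q * exp (- be * t)).
  (* The derivative of [sg] is K0 times the current perturbation. The constant [eh] makes sg >= a on
     the whole initial strip, and the total shift stays below K1 eh q. *)
  pose (sg := fun t => a + K1 * q * (eh - exp (- be * t))).
  assert (Hqd : forall t, is_derive qt t (- be * qt t)) by (intros; apply is_derive_qexp).
  assert (Hsd : forall t, is_derive sg t (K0 * qt t)).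
  { intros t. rewrite <- HK1e. unfold sg, qt. auto_derive; [trivial|ring]. }
  assert (Hqt : forall t, 0 < qt t) by (intros; unfold qt; pos).
  assert (Hqh : forall t, qt (t - h) = eh * qt t).
  { intros t. unfold qt, eh. replace (- be * (t - h)) with (be * h + - be * t) by ring. rewrite exp_plus. ring. }
  assert (Hsmono : forall s t, s <= t -> sg s <= sg t).
  { intros s t Hst. apply (derive_ge0_monotone sg (fun t => K0 * qt t)); auto.
    intros x _. specialize (Hqt x). pos. }
  pose (v := fun t z => phi (z + sg t) + qt t * eta l (z + sg t)).
  assert (Hcmp : w t0 z0 <= v t0 z0).
  { apply (comparison_delay c h t0 w v Hg); auto; try lra.
    - intros pt. apply (cont_minus (fun p : R * R => w (fst p) (snd p))); [apply E|].
      apply continuous_perturbed.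
      + apply (wave_continuous W).
      + apply (derivable_continuous_all _ _ Hqd).
      + apply (derivable_continuous_all _ _ Hsd).
      + apply (derivable_continuous_all _ _ Hsd).
    - exists kappa. intros t z Ht. pose proof (ev_range E t z). unfold v.
      pose proof (wv_pos W (z + sg t)). pose proof (eta_pos l (z + sg t)).
      assert (0 < qt t * eta l (z + sg t)) by (apply Rmult_lt_0_compat; auto). lra.
    - intros t z Ht. eapply Rle_trans; [apply Hinit, Ht|]. unfold v.
      assert (Has : a <= sg t).
      { unfold sg. assert (exp (- be * t) <= eh) by (apply exp_mono; assert (0 <= be * (t + h)) by pos; lra).
        assert (0 <= K1 * q * (eh - exp (- be * t))) by pos. lra. }
      apply Rplus_le_compat; [apply (front_monotone F); lra|].
      apply Rmult_le_compat; [lra|left; apply eta_pos| |apply eta_mono; lra].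
      unfold qt. assert (1 <= exp (- be * t)) by (apply exp_decay_ge1; lra).
      rewrite <- (Rmult_1_r q) at 1. apply Rmult_le_compat_l; lra.
    - intros t z Ht. right.
      destruct (eta_branch l (z + sg t) Hl) as (k & Hkc & Hke & Hkle).
      eexists. eexists. split; [|split; [|split]].
      + apply jet_sub_test, (ev_jet E). lra.
      + apply (perturbed_super_test l k sg sg qt (K0 * qt t) (K0 * qt t) (- be * qt t) _ _ W); auto. intros; left; auto.
      + lra.
      + set (ze := z + sg t) in *. specialize (Hqt t) as Hqq.
        assert (Hqq1 : qt t <= q * 1).
        { apply Rmult_le_compat_l; [lra|]. apply exp_decay_le1; lra. }

        set (Xd := eh * qt t * eta l (ze - c * h)).
        assert (HXd : 0 < Xd) by (unfold Xd; pos).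
        assert (Hvd : v (t - h) (z - c * h) <= phi (ze - c * h) + Xd).
        { unfold v. assert (Hle : z - c * h + sg (t - h) <= ze - c * h).
          { specialize (Hsmono (t - h) t ltac:(lra)). unfold ze. lra. }
          apply Rplus_le_compat; [apply (front_monotone F), Hle|].
          rewrite Hqh. unfold Xd. apply Rmult_le_compat_l; [pos|]. apply eta_mono; auto. }
        pose proof (ms_mono Hg _ _ Hvd).
        specialize (Habs ze ze (qt t) k (phi (ze - c * h)) (phi (ze - c * h) + Xd)).
        rewrite Rminus_diag, Rabs_R0 in Habs.
        specialize (Habs ltac:(lra) ltac:(lra) Hkc ltac:(lra) ltac:(unfold Xd; lra) ltac:(auto)).
        assert (0 <= qt t * eta l ze * (k * (K0 * qt t))) by pos.
        lra. }
  eapply Rle_trans; [exact Hcmp|]. unfold v.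
  assert (Hle : z0 + sg t0 <= z0 + (a + K1 * eh * q)).
  { unfold sg. assert (0 < K1 * q * exp (- be * t0)) by pos. lra. }
  apply Rplus_le_compat; [apply (front_monotone F), Hle|].
  apply Rmult_le_compat_l; [left; apply Hqt|]. apply eta_mono; auto.
Qed.

(** The front moves to the right, but a weight moving with it would contribute with the wrong sign,
    so the weight stays at a. Recentring it at the end costs the factor e^l and requires the total
    shift to be at most 1. *)
Lemma stability_below {g kappa p L c h l phi phi1} :
  monostable g kappa p L -> front g kappa c h l phi phi1 -> 0 < c -> 0 <= h -> 0 < l ->
  symbol p c h l < 0 ->
  exists K be C qb, 0 < K /\ 0 < be /\ 0 < C /\ 0 < qb /\
    forall w, evolution g kappa c h w -> forall a q, 0 < q <= qb ->
    (forall t z, - h <= t <= 0 -> phi (z + a) - q * eta l (z + a) <= w t z) ->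
    forall t z, 0 <= t ->
      phi (z + (a - K * q)) - C * q * exp (- be * t) * eta l (z + (a - K * q)) <= w t z.
Proof.
  intros Hg F Hc Hh Hl Hs.
  assert (W := fr_wave F). destruct (wv_ode W) as [Ho1 _].
  destruct (moving_front_absorbs 1 Hg F Hc Hh Hl Hs Rlt_0_1)
    as (K0 & be & d & HK0 & Hbe & Hd & Habs).
  set (eh := exp (be * h)) in *. assert (Heh : 0 < eh) by apply exp_pos.
  pose (K1 := K0 / be). assert (HK1 : 0 < K1) by (apply Rdiv_lt_0_compat; lra).
  assert (HK1e : K1 * be = K0) by (unfold K1; field; lra).
  assert (HKe : 0 < K1 * eh) by pos.
  (* [q1] keeps the total shift below 1; [qb] in addition keeps the delayed perturbation within the
     range d near kappa. *)
  destruct (small_factor (K1 * eh) 1 1) as (q1 & Hq1 & HKq1); [lra|lra|lra|].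
  destruct (small_factor eh q1 d) as (qb & Hqb & Hehqb); [lra|lra|lra|].
  exists (K1 * eh), be, (exp l), qb.
  split; [exact HKe|]. split; [exact Hbe|]. split; [apply exp_pos|]. split; [lra|].
  intros w E a q Hq Hinit t0 z0 Ht0.
  assert (HKq : K1 * eh * q <= 1).
  { apply Rle_trans with (2 := HKq1). apply Rmult_le_compat_l; lra. }
  assert (Hehq : eh * q <= d).
  { apply Rle_trans with (2 := Hehqb). apply Rmult_le_compat_l; lra. }
  pose (qt := fun t => q * exp (- be * t)).
  pose (sg := fun t => a - K1 * q * (eh - exp (- be * t))).
  assert (Hqd : forall t, is_derive qt t (- be * qt t)) by (intros; apply is_derive_qexp).
  assert (Hsd : forall t, is_derive sg t (- (K0 * qt t))).
  { intros t. rewrite <- HK1e. unfold sg, qt. auto_derive; [trivial|ring]. }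
  assert (Hqt : forall t, 0 < qt t) by (intros; unfold qt; pos).
  assert (Hqh : forall t, qt (t - h) = eh * qt t).
  { intros t. unfold qt, eh. replace (- be * (t - h)) with (be * h + - be * t) by ring. rewrite exp_plus. ring. }
  assert (Hsmono : forall s t, s <= t -> sg t <= sg s).
  { intros s t Hst. apply (derive_le0_antitone sg (fun t => - (K0 * qt t))); auto.
    intros x _. specialize (Hqt x). assert (0 < K0 * qt x) by pos. lra. }
  assert (Hsge : forall t, - h <= t -> a - K1 * eh * q <= sg t <= a).
  { intros t Ht. unfold sg. assert (exp (- be * t) <= eh) by (apply exp_mono; assert (0 <= be * (t + h)) by pos; lra).
    assert (0 <= K1 * q * (eh - exp (- be * t))) by pos. assert (0 < K1 * q * exp (- be * t)) by pos. lra. }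
  pose (u := fun t z => phi (z + sg t) - qt t * eta l (z + (fun _ => a) t)).
  assert (Hcmp : u t0 z0 <= w t0 z0).
  { apply (comparison_delay c h t0 u w Hg); auto; try lra.
    - intros pt. apply (cont_minus (fun p : R * R => u (fst p) (snd p))); [|apply E].
      assert (Hphic := wave_continuous W). assert (Hetac := eta_continuous l).
      assert (Hsc := derivable_continuous_all _ _ Hsd). assert (Hqc := derivable_continuous_all _ _ Hqd).
      unfold u. cont.
    - exists kappa. intros t z Ht. pose proof (ev_range E t z). unfold u.
      pose proof (wv_lt W (z + sg t)). pose proof (eta_pos l (z + a)).
      assert (0 < qt t * eta l (z + a)) by (apply Rmult_lt_0_compat; auto). lra.
    - intros t z Ht. eapply Rle_trans; [|apply Hinit, Ht]. unfold u.
      assert (phi (z + sg t) <= phi (z + a)).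
      { apply (front_monotone F). specialize (Hsge t ltac:(lra)). lra. }
      assert (q * eta l (z + a) <= qt t * eta l (z + a)); [|lra].
      apply Rmult_le_compat_r; [left; apply eta_pos|].
      unfold qt. assert (1 <= exp (- be * t)) by (apply exp_decay_ge1; lra).
      rewrite <- (Rmult_1_r q) at 1. apply Rmult_le_compat_l; lra.
    - intros t z Ht. right.
      destruct (eta_branch l (z + a) Hl) as (k & Hkc & Hke & Hkle).
      eexists. eexists. split; [|split; [|split]].
      + apply (perturbed_sub_test l k sg (fun _ => a) qt (- (K0 * qt t)) 0 (- be * qt t) _ _ W); auto.
        * apply derive_const.
        * intros; left; auto.
      + apply jet_super_test, (ev_jet E). lra.
      + cbv beta. set (x := z + sg t) in *. set (y := z + a) in *. specialize (Hqt t) as Hqq.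
        assert (Hqq1 : qt t <= q * 1).
        { apply Rmult_le_compat_l; [lra|]. apply exp_decay_le1; lra. }
        assert (eh * qt t <= eh * (q * 1)) by (apply Rmult_le_compat_l; lra).
        set (Xd := eh * qt t * eta l (y - c * h)).
        assert (HXd : 0 < Xd) by (unfold Xd; pos).
        assert (Hud : phi (x - c * h) - Xd <= u (t - h) (z - c * h)).
        { unfold u. rewrite Hqh. replace (z - c * h + a) with (y - c * h) by (unfold y; ring). fold Xd.
          assert (phi (x - c * h) <= phi (z - c * h + sg (t - h))); [|lra].
          apply (front_monotone F). specialize (Hsmono (t - h) t ltac:(lra)). unfold x. lra. }
        pose proof (ms_mono Hg _ _ Hud).
        specialize (Hsge t ltac:(lra)).
        specialize (Habs x y (qt t) k (phi (x - c * h) - Xd) (phi (x - c * h))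
          ltac:(apply Rabs_le; unfold x, y; lra) ltac:(lra) Hkc ltac:(lra) ltac:(unfold Xd; lra) ltac:(right; lra)).
        lra.
      + lra. }
  eapply Rle_trans; [|exact Hcmp]. unfold u.
  assert (phi (z0 + (a - K1 * eh * q)) <= phi (z0 + sg t0)).
  { apply (front_monotone F). specialize (Hsge t0 ltac:(lra)). lra. }
  pose proof (eta_shift_le l (z0 + a) (K1 * eh * q) Hl) as Hes.
  replace (z0 + a - K1 * eh * q) with (z0 + (a - K1 * eh * q)) in Hes by ring.
  assert (qt t0 * eta l (z0 + a) <= qt t0 * (exp l * eta l (z0 + (a - K1 * eh * q)))).
  { apply Rmult_le_compat_l; [left; apply Hqt|]. apply Hes. split; [pos|exact HKq]. }
  unfold qt in *. lra.
Qed.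

(** * Interior gradient bound *)

Lemma locally_affine (x a b : R) (P : R -> Prop) :
  locally (a + b * x) P -> locally x (fun y => P (a + b * y)).
Proof.
  intros HP.
  assert (Hc : continuous (fun y => a + b * y) x).
  { smooth. }
  exact (Hc P HP).
Qed.

Lemma is_derive_affine (f : R -> R) (a b x l : R) :
  is_derive f (a + b * x) l -> is_derive (fun y => f (a + b * y)) x (b * l).
Proof.
  intros Hf. evar_last.
  - apply (is_derive_comp f (fun y => a + b * y)); [exact Hf|auto_derive; [trivial|reflexivity]].
  - unfold scal; simpl; unfold mult; simpl. ring.
Qed.

(* Doubling of variables: w(t, x + s) - w(t, x - s) solves the equation with w_xx(x+s) - w_xx(x-s) equal to the second derivative in s, so a concave function of s is a barrier. *)
Lemma gradient_bound_signed {g kappa p L c h w} sg x s :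
  monostable g kappa p L -> 0 <= c -> evolution g kappa c h w ->
  (sg = 1 \/ sg = -1) -> 0 <= s <= 1 ->
  w 1 (x + sg * s) - w 1 (x + - sg * s) <= 4 * kappa * s.
Proof.
  intros Hg Hc E Hsg Hs.
  pose proof (ms_kappa Hg) as Hk.
  assert (Hsg2 : sg * sg = 1) by (destruct Hsg as [-> | ->]; ring).
  apply le_epsilon. intros e0 He0.
  (* So that the confining term equals e0 at the point (1, x) in question. *)
  pose (e := e0 / (exp c * (1 + x ^ 2))).
  assert (Hden : 0 < exp c * (1 + x ^ 2)) by (pose proof (pow2_ge_0 x); pos).
  assert (He : 0 < e) by (apply Rdiv_lt_0_compat; lra).
  pose (N := fun t x : R => e * (exp (c * t) * (1 + x ^ 2))).
  assert (HN : forall t x, 0 < N t x).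
  { intros t y. unfold N. pose proof (pow2_ge_0 y). pos. }
  (* The term kappa (1 - t) covers t = 0, the concave term reaches 2 kappa at s = 1, and N confines
     x; each of these boundaries is thereby excluded as a contact, and s = 0 is excluded because the
     difference vanishes there. *)
  pose (D := fun t x s => w t (x + sg * s) - w t (x + - sg * s)
     - (kappa * (1 - t) + 2 * kappa * (2 * s - s ^ 2) + N t x)).
  pose (Rb := 1 + Rabs x + kappa / e).
  assert (Hke : 0 < kappa / e) by (apply Rdiv_lt_0_compat; lra).
  pose proof (Rabs_pos x) as Hax.
  assert (Hdiff : forall t y z, w t y - w t z <= kappa).
  { intros t y z. pose proof (ev_range E t y). pose proof (ev_range E t z). lra. }
  assert (Hbar : forall t s, 0 <= t <= 1 -> 0 <= s <= 1 -> 0 <= kappa * (1 - t) /\ 0 <= 2 * kappa * (2 * s - s ^ 2)).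
  { intros t s' Ht Hs'. split; [pos|]. replace (2 * s' - s' ^ 2) with (s' * (2 - s')) by ring. pos. }
  destruct (first_touch D 1 (- Rb) Rb 0 1) as [Hall|(t & y & r & Ht & Hy & Hr & HD0 & Hbef & Hat)].
  - unfold Rb; lra.
  - lra.
  - intros pt. unfold D.
    assert (Hw : forall b : R, continuous (fun p : R * (R * R) => w (fst p) (fst (snd p) + b * snd (snd p))) pt).
    { intros b. apply (continuous_comp_2 (fun p : R * (R * R) => fst p) (fun p : R * (R * R) => fst (snd p) + b * snd (snd p)) w).
      - cont.
      - cont.
      - apply (ev_cont E). }
    pose proof (Hw sg). pose proof (Hw (- sg)). unfold N. cont.
  - intros y r _ Hr. unfold D. specialize (Hdiff 0 (y + sg * r) (y + - sg * r)). specialize (HN 0 y).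
    destruct (Hbar 0 r ltac:(lra) Hr). lra.
  - assert (D 1 x s < 0).
    { apply Hall; [lra| |lra]. pose proof (Rle_abs x). pose proof (Rle_abs (- x)). rewrite Rabs_Ropp in H0.
      unfold Rb. lra. }
    unfold D in H.
    assert (HN1 : N 1 x = e0).
    { unfold N, e. rewrite Rmult_1_r. field. split; [|apply Rgt_not_eq, exp_pos]. pose proof (pow2_ge_0 x). lra. }
    rewrite HN1 in H. assert (2 * kappa * (2 * s - s ^ 2) <= 4 * kappa * s).
    { pose proof (pow2_ge_0 s). clear - Hk H0. nra. }
    lra.
  - exfalso. unfold D in HD0.
    set (ya := y + sg * r) in *. set (yb := y + - sg * r) in *.
    specialize (HN t y) as HNt.
    destruct (Hbar t r ltac:(lra) Hr) as [Hb1 Hb2].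
    assert (Hr0 : r <> 0).
    { intros Hr0. assert (ya = yb) by (unfold ya, yb; rewrite Hr0; ring). rewrite H in HD0. lra. }
    assert (Hr1 : r <> 1).
    { intros Hr1. specialize (Hdiff t ya yb). rewrite Hr1 in *. lra. }
    assert (HyR : - Rb < y < Rb).
    { assert (Hn : forall z, Rabs z = Rb -> y <> z).
      { intros z Hz Hyz. specialize (Hdiff t ya yb).
        assert (kappa < N t y); [|lra].
        unfold N. rewrite Hyz, <- (pow2_abs z), Hz.
        assert (1 <= exp (c * t)) by (apply exp_ge1; pos).
        assert (kappa / e < 1 + Rb ^ 2).
        { assert (kappa / e <= Rb) by (unfold Rb; lra). assert (1 <= Rb) by (unfold Rb; lra). clear - H0 H1. nra. }
        apply Rlt_le_trans with (e * (1 * (1 + Rb ^ 2))).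
        - apply (Rmult_lt_compat_l e) in H0; [|exact He]. replace (e * (kappa / e)) with kappa in H0 by (field; lra). lra.
        - apply Rmult_le_compat_l; [lra|]. apply Rmult_le_compat_r; [pose proof (pow2_ge_0 Rb); lra|lra]. }
      assert (y <> Rb) by (apply Hn; apply Rabs_right; unfold Rb; lra).
      assert (y <> - Rb) by (apply Hn; rewrite Rabs_Ropp; apply Rabs_right; unfold Rb; lra).
      lra. }
    destruct (ev_jet E t ya ltac:(lra)) as (A1 & at_ & azz & a1 & a2 & a3 & a4).
    destruct (ev_jet E t yb ltac:(lra)) as (B1 & bt & bzz & b1 & b2 & b3 & b4).
    assert (Htime : 0 <= at_ - bt - (- kappa + c * N t y)).
    { apply (derive_ge0_of_left_max (fun t => w t ya - w t yb - (kappa * (1 - t) + 2 * kappa * (2 * r - r ^ 2) + N t y)) t _ t); [lra| |].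
      - apply (derive_minus (fun t => w t ya - w t yb)).
        + apply derive_minus; assumption.
        + unfold N. auto_derive; [trivial|ring].
      - intros s' Hs'. specialize (Hbef s' y r ltac:(lra) Hy Hr). unfold D in Hbef. fold ya yb in Hbef. lra. }
    assert (Hx : A1 ya - B1 yb = 2 * e * exp (c * t) * y).
    { destruct (second_order_max (fun z => w t (sg * r + 1 * z) - w t (- sg * r + 1 * z) - (kappa * (1 - t) + 2 * kappa * (2 * r - r ^ 2) + N t z))
        (fun z => 1 * A1 (sg * r + 1 * z) - 1 * B1 (- sg * r + 1 * z) - 2 * e * exp (c * t) * z) y
        (1 * (1 * azz) - 1 * (1 * bzz) - 2 * e * exp (c * t))) as [Hx _].
      - assert (Hm : 0 < Rmin (y + Rb) (Rb - y)) by (apply Rmin_pos; lra).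
        exists (mkposreal _ Hm). intros z Hz. apply Rabs_def2 in Hz. simpl in Hz.
        unfold minus, plus, opp in Hz; simpl in Hz.
        pose proof (Rmin_l (y + Rb) (Rb - y)). pose proof (Rmin_r (y + Rb) (Rb - y)).
        specialize (Hat z r ltac:(lra) Hr). unfold D in Hat.
        replace (sg * r + 1 * z) with (z + sg * r) by ring. replace (- sg * r + 1 * z) with (z + - sg * r) by ring.
        replace (sg * r + 1 * y) with ya by (unfold ya; ring). replace (- sg * r + 1 * y) with yb by (unfold yb; ring).
        lra.
      - replace ya with (sg * r + 1 * y) in a2 by (unfold ya; ring).
        replace yb with (- sg * r + 1 * y) in b2 by (unfold yb; ring).
        apply locally_affine in a2. apply locally_affine in b2.
        generalize (filter_and _ _ a2 b2). apply filter_imp. intros z [k1 k2].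
        apply (derive_minus (fun z => w t (sg * r + 1 * z) - w t (- sg * r + 1 * z))).
        + apply derive_minus;
            apply (is_derive_affine (w t)); assumption.
        + unfold N. auto_derive; [trivial|ring].
      - replace ya with (sg * r + 1 * y) in a3 by (unfold ya; ring).
        replace yb with (- sg * r + 1 * y) in b3 by (unfold yb; ring).
        apply (derive_minus (fun z => 1 * A1 (sg * r + 1 * z) - 1 * B1 (- sg * r + 1 * z))).
        + apply derive_minus;
            apply is_derive_scal, is_derive_affine; assumption.
        + auto_derive; [trivial|ring].
      - replace (sg * r + 1 * y) with ya in Hx by (unfold ya; ring).
        replace (- sg * r + 1 * y) with yb in Hx by (unfold yb; ring). lra. }
    assert (Hss : azz - bzz <= - 4 * kappa).
    { destruct (second_order_max (fun z => w t (y + sg * z) - w t (y + - sg * z) - (kappa * (1 - t) + 2 * kappa * (2 * z - z ^ 2) + N t y))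
        (fun z => sg * A1 (y + sg * z) - - sg * B1 (y + - sg * z) - 2 * kappa * (2 - 2 * z)) r
        (sg * (sg * azz) - - sg * (- sg * bzz) - - (4 * kappa))) as [_ Hx2].
      - assert (Hm : 0 < Rmin r (1 - r)) by (apply Rmin_pos; lra).
        exists (mkposreal _ Hm). intros z Hz. apply Rabs_def2 in Hz. simpl in Hz.
        unfold minus, plus, opp in Hz; simpl in Hz.
        pose proof (Rmin_l r (1 - r)). pose proof (Rmin_r r (1 - r)).
        specialize (Hat y z Hy ltac:(lra)). unfold D in Hat. fold ya yb. lra.
      - apply locally_affine in a2. apply locally_affine in b2.
        generalize (filter_and _ _ a2 b2). apply filter_imp. intros z [k1 k2].
        apply (derive_minus (fun z => w t (y + sg * z) - w t (y + - sg * z))).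
        + apply derive_minus;
            apply (is_derive_affine (w t)); assumption.
        + auto_derive; [trivial|ring].
      - apply (derive_minus (fun z => sg * A1 (y + sg * z) - - sg * B1 (y + - sg * z))).
        + apply derive_minus;
            apply is_derive_scal, is_derive_affine; assumption.
        + auto_derive; [trivial|ring].
      - replace (sg * (sg * azz) - - sg * (- sg * bzz)) with (sg * sg * (azz - bzz)) in Hx2 by ring.
        rewrite Hsg2 in Hx2. lra. }
    (* The reaction terms differ by at most kappa, while the equation at the contact would require
       at least 3 kappa. *)
    assert (Hga := monostable_range _ Hg (ev_range E (t - h) (ya - c * h))).
    assert (Hgb := monostable_range _ Hg (ev_range E (t - h) (yb - c * h))).
    assert (Hsq : 0 <= c * N t y + c * (2 * e * exp (c * t) * y)).
    { unfold N. replace (c * (e * (exp (c * t) * (1 + y ^ 2))) + c * (2 * e * exp (c * t) * y))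
        with (c * (e * (exp (c * t) * (1 + y) ^ 2))) by ring. pos. }
    assert (c * A1 ya - c * B1 yb = c * (2 * e * exp (c * t) * y)) by (rewrite <- Hx; ring).
    lra.
Qed.

(** Restart at time t - 1; the two signs give the two one-sided bounds. *)
Lemma gradient_bound {g kappa p L c h w} t x y :
  monostable g kappa p L -> 0 <= c -> evolution g kappa c h w -> 1 <= t -> Rabs (y - x) <= 2 ->
  Rabs (w t y - w t x) <= 2 * kappa * Rabs (y - x).
Proof.
  intros Hg Hc E Ht Hxy.
  assert (E' := evolution_shift (t - 1) ltac:(lra) E).
  assert (Hone : forall x y, x <= y <= x + 2 -> Rabs (w t y - w t x) <= 2 * kappa * (y - x)).
  { intros a b Hab.
    assert (H1 := gradient_bound_signed 1 ((a + b) / 2) ((b - a) / 2) Hg Hc E' ltac:(auto) ltac:(lra)).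
    assert (H2 := gradient_bound_signed (-1) ((a + b) / 2) ((b - a) / 2) Hg Hc E' ltac:(auto) ltac:(lra)).
    simpl in H1, H2.
    replace (t - 1 + 1) with t in * by ring.
    replace ((a + b) / 2 + 1 * ((b - a) / 2)) with b in * by field.
    replace ((a + b) / 2 + - (1) * ((b - a) / 2)) with a in * by field.
    replace ((a + b) / 2 + -1 * ((b - a) / 2)) with a in * by field.
    replace ((a + b) / 2 + - -1 * ((b - a) / 2)) with b in * by field.
    replace (4 * kappa * ((b - a) / 2)) with (2 * kappa * (b - a)) in * by field.
    apply Rabs_le. lra. }
  destruct (Rle_lt_dec x y) as [h0|h0].
  - rewrite (Rabs_right (y - x)) in * by lra. apply Hone. lra.
  - rewrite (Rabs_minus_sym (w t y)), (Rabs_minus_sym y) in *. rewrite (Rabs_right (x - y)) in * by lra. apply Hone. lra.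
Qed.

(** * Quantitative strong maximum principle *)

(* Logarithm of the fundamental solution of U_t = U_zz - c U_z - U, started at time -tau. *)
Definition log_kernel (c tau t z : R) : R :=
  - t - ln (t + tau) / 2 - (z - c * t) ^ 2 / (4 * (t + tau)).

Lemma is_derive_exp_comp (f : R -> R) (x l : R) :
  is_derive f x l -> is_derive (fun y => exp (f y)) x (exp (f x) * l).
Proof.
  intros Hf. evar_last.
  - apply (is_derive_comp exp f); [|exact Hf]. auto_derive; [trivial|reflexivity].
  - unfold scal; simpl; unfold mult; simpl. ring.
Qed.

Lemma kernel_jet c tau t z : 0 < t + tau -> jet c (fun t z => exp (log_kernel c tau t z)) t z 0.
Proof.
  intros Ht.
  assert (Hz : forall y, is_derive (fun y => log_kernel c tau t y) y (- (y - c * t) / (2 * (t + tau)))).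
  { intros y. unfold log_kernel. auto_derive; [repeat split; lra|]. field. lra. }
  exists (fun y => exp (log_kernel c tau t y) * (- (y - c * t) / (2 * (t + tau)))),
    (exp (log_kernel c tau t z) * (-1 - 1 / (2 * (t + tau)) + c * (z - c * t) / (2 * (t + tau))
       + (z - c * t) ^ 2 / (4 * (t + tau) ^ 2))),
    (exp (log_kernel c tau t z) * ((z - c * t) ^ 2 / (4 * (t + tau) ^ 2) - 1 / (2 * (t + tau)))).
  split; [|split; [|split]].
  - apply (is_derive_exp_comp (fun s => log_kernel c tau s z)).
    unfold log_kernel. auto_derive; [repeat split; lra|]. field. lra.
  - apply filter_forall. intros y. apply (is_derive_exp_comp (fun y => log_kernel c tau t y)), Hz.
  - evar_last.
    + apply (derive_mult (fun y => exp (log_kernel c tau t y))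
        (fun y => - (y - c * t) / (2 * (t + tau)))).
      * apply (is_derive_exp_comp (fun y => log_kernel c tau t y)), Hz.
      * auto_derive; [repeat split; lra|reflexivity].
    + unfold plus, mult; simpl. field. lra.
  - field. lra.
Qed.

Lemma Rmax0_continuous x : continuous (fun t => Rmax t 0) x.
Proof.
  apply (lipschitz_continuous _ 1). intros a b. rewrite Rmult_1_l.
  apply Rmax_lip; [lra|]. rewrite Rminus_diag, Rabs_R0. apply Rabs_pos.
Qed.

(** The subsolution is e0 times the kernel minus a threshold, lowered by B. The threshold is the
    initial kernel value at distance rho; a short pre-time tau makes it smaller than the kernel on
    the target set. The gain k does not depend on v, B or M. *)
Lemma spread (c m rho Z h : R) :
  0 <= c -> 0 < m -> 0 < rho -> 0 < Z -> 0 <= h ->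
  exists k, 0 < k /\ forall (v : R -> R -> R) B M,
    (forall p : R * R, continuous (fun p => v (fst p) (snd p)) p) ->
    (forall t z, 0 <= t -> - M <= v t z) -> 0 <= B ->
    (forall t z, 0 < t -> exists P, jet c v t z P /\ - B <= P) ->
    (forall z, - B <= v 0 z) -> (forall z, Rabs z <= rho -> m <= v 0 z) ->
    forall t z, 1 <= t <= 1 + h -> Rabs z <= Z -> k - B <= v t z.
Proof.
  intros Hc Hm Hrho HZ Hh.
  (* A lower bound of the log kernel for 1 <= t <= 1 + h and |z| <= Z, valid for tau <= 1. *)
  pose (lg := - (1 + h) - ln (2 + h) / 2 - (Z + c * (1 + h)) ^ 2 / 4).
  pose (N := Rmax 0 (- lg + 1)).
  assert (HN0 : 0 <= N) by apply Rmax_l.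
  assert (HN : - lg + 1 <= N) by apply Rmax_r.
  (* y is the initial log height of the kernel, and tau = e^(-2 y); y is large enough to bring [lth]
     below [lg - 1]. *)
  pose (y := Rmax 1 (4 * (1 + N) / rho ^ 2)).
  assert (Hrho2 : 0 < rho ^ 2) by (apply pow_lt, Hrho).
  assert (Hy1 : 1 <= y) by apply Rmax_l.
  assert (Hy2 : 4 * (1 + N) <= rho ^ 2 * y).
  { apply Rle_trans with (rho ^ 2 * (4 * (1 + N) / rho ^ 2)).
    - right; field; lra.
    - apply Rmult_le_compat_l; [lra|apply Rmax_r]. }
  pose (tau := exp (- (2 * y))).
  assert (Htau : 0 < tau) by apply exp_pos.
  assert (Htau1 : tau <= 1) by (apply exp_le1; lra).
  assert (Hln : ln tau = - (2 * y)) by apply ln_exp.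
  (* The log kernel at time 0 and distance rho. *)
  pose (lth := y - rho ^ 2 / (4 * tau)).
  assert (Hlth : lth <= lg - 1).
  { unfold lth, tau. replace (rho ^ 2 / (4 * exp (- (2 * y)))) with (rho ^ 2 / 4 * (exp y * exp y)).
    - pose proof (exp_ineq1_le y).
      assert (y * y <= exp y * exp y) by (apply Rmult_le_compat; lra).
      assert (rho ^ 2 / 4 * (y * y) <= rho ^ 2 / 4 * (exp y * exp y)) by (apply Rmult_le_compat_l; lra).
      assert ((1 + N) * y <= rho ^ 2 / 4 * (y * y)).
      { replace (rho ^ 2 / 4 * (y * y)) with (rho ^ 2 * y / 4 * y) by field. apply Rmult_le_compat_r; lra. }
      assert (N * 1 <= N * y) by (apply Rmult_le_compat_l; lra). lra.
    - rewrite <- exp_plus, exp_Ropp. replace (2 * y) with (y + y) by ring. field. apply Rgt_not_eq, exp_pos. }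
  (* Scales the initial peak of the kernel to m. *)
  pose (e0 := m * exp (- y)).
  assert (He0 : 0 < e0) by (apply Rmult_lt_0_compat; [lra|apply exp_pos]).
  pose (k := e0 * (exp lg - exp lth)).
  exists k. split.
  { apply Rmult_lt_0_compat; [exact He0|]. assert (exp lth < exp lg) by (apply exp_increasing; lra). lra. }
  intros v B M Hv HM HB Hjet Hinit Hball t0 z0 Ht0 Hz0.
  (* The kernel is singular at -tau; freezing it for negative times gives the continuity on the
     whole plane that the comparison asks for. *)
  pose (G := fun t z => exp (log_kernel c tau (Rmax t 0) z)).
  assert (HG0 : forall z, G 0 z = exp (y - z ^ 2 / (4 * tau))).
  { intros z. unfold G, log_kernel. rewrite Rmax_left by lra. f_equal.
    rewrite Rplus_0_l, Hln, Rmult_0_r, Rminus_0_r. field. lra. }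
  assert (HGle : forall t z, 0 <= t -> G t z <= exp y).
  { intros t z Ht. unfold G. apply exp_mono. rewrite Rmax_left by lra. unfold log_kernel.
    assert (ln tau <= ln (t + tau)) by (apply ln_le; lra).
    assert (0 <= (z - c * t) ^ 2 / (4 * (t + tau))).
    { apply Rdiv_le_0_compat; [apply pow2_ge_0|lra]. }
    lra. }
  pose (u := fun t z => e0 * (G t z - exp lth) - B).
  assert (Hme : e0 * exp y = m).
  { unfold e0. rewrite Rmult_assoc, exp_opp_mul. ring. }
  assert (Hcmp : u t0 z0 <= v t0 z0).
  { apply (comparison c 0 0 0 t0 u v); try lra.
    - intros pt. apply (cont_minus (fun p : R * R => u (fst p) (snd p))); [|apply Hv].
      assert (Hfirst : forall f : R -> R, (forall x, 0 <= x -> continuous f x) ->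
         continuous (fun p : R * R => f (Rmax (fst p) 0)) pt).
      { intros f Hf. apply (continuous_comp (fun p : R * R => Rmax (fst p) 0) f); [|apply Hf, Rmax_r].
        apply (continuous_comp (fun p : R * R => fst p) (fun t => Rmax t 0)); [apply continuous_fst2|apply Rmax0_continuous]. }
      assert (Hc1 := Hfirst (fun t => - t - ln (t + tau) / 2) ltac:(intros; smooth)).
      assert (Hc2 := Hfirst (fun t => / (4 * (t + tau))) ltac:(intros; smooth)).
      assert (Hc3 := Hfirst (fun t => t) ltac:(intros; smooth)).
      unfold u, G, log_kernel, Rdiv. cont.
    - exists (m + M). intros t z Ht. specialize (HM t z ltac:(lra)). specialize (HGle t z ltac:(lra)). unfold u.
      assert (e0 * (G t z - exp lth) <= e0 * exp y).
      { apply Rmult_le_compat_l; [lra|]. pose proof (exp_pos lth). lra. }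
      lra.
    - intros t z Ht. replace t with 0 by lra. unfold u. rewrite HG0.
      destruct (Rle_lt_dec (Rabs z) rho) as [h0|h0].
      + specialize (Hball z h0).
        assert (e0 * (exp (y - z ^ 2 / (4 * tau)) - exp lth) <= e0 * exp y).
        { apply Rmult_le_compat_l; [lra|]. pose proof (exp_pos lth).
          assert (exp (y - z ^ 2 / (4 * tau)) <= exp y); [|lra]. apply exp_mono.
          assert (0 <= z ^ 2 / (4 * tau)) by (apply Rdiv_le_0_compat; [apply pow2_ge_0|lra]). lra. }
        lra.
      + specialize (Hinit z).
        assert (exp (y - z ^ 2 / (4 * tau)) <= exp lth).
        { apply exp_mono. unfold lth. apply Rplus_le_compat_l, Ropp_le_contravar.
          unfold Rdiv. apply Rmult_le_compat_r; [left; apply Rinv_0_lt_compat; lra|].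
          rewrite <- (pow2_abs z). apply pow_incr. lra. }
        assert (e0 * (exp (y - z ^ 2 / (4 * tau)) - exp lth) <= e0 * 0) by (apply Rmult_le_compat_l; lra).
        lra.
    - intros t z Ht. right. destruct (Hjet t z ltac:(lra)) as (P & HP & HPB).
      exists (- (e0 * exp lth) - B), P. split; [|split].
      + exists (fun t z => e0 * (exp (log_kernel c tau t z) - exp lth) - B).
        destruct (kernel_jet c tau t z ltac:(lra)) as (U1 & ut & uzz & h1 & h2 & h3 & h4).
        assert (Hext : forall s x, 0 < s -> e0 * (exp (log_kernel c tau s x) - exp lth) - B = u s x).
        { intros s x Hs. unfold u, G. rewrite Rmax_left by lra. reflexivity. }
        split; [|split; [|split]].
        * exists (fun y => e0 * U1 y), (e0 * ut), (e0 * uzz).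
          assert (Hgen : forall (f : R -> R) x l, is_derive f x l ->
             is_derive (fun y => e0 * (f y - exp lth) - B) x (e0 * l)).
          { intros f x l Hf. evar_last.
            - apply (derive_minus (fun y => e0 * (f y - exp lth)) (fun _ => B));
                [|apply derive_const].
              apply is_derive_scal.
              apply (derive_minus f (fun _ => exp lth));
                [exact Hf|apply derive_const].
            - unfold minus, plus, opp, zero; simpl. ring. }
          split; [|split; [|split]].
          -- apply (Hgen (fun s => exp (log_kernel c tau s z))), h1.
          -- revert h2. apply filter_imp. intros x Hx. apply (Hgen (fun x => exp (log_kernel c tau t x))), Hx.
          -- apply is_derive_scal, h3.
          -- replace (- (e0 * exp lth) - B) with (e0 * 0 - e0 * exp lth - B) by ring. rewrite h4. ring.
        * apply Hext. lra.
        * exists t. split; [lra|]. intros s Hs. right. apply Hext. lra.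
        * apply filter_forall. intros x. right. apply Hext. lra.
      + apply jet_super_test, HP.
      + intros x Hx _. assert (0 < e0 * exp lth) by (apply Rmult_lt_0_compat; [lra|apply exp_pos]). lra. }
  assert (HGlow : exp lg <= G t0 z0).
  { unfold G. rewrite Rmax_left by lra. apply exp_mono. unfold lg, log_kernel.
    assert (ln (t0 + tau) <= ln (2 + h)) by (apply ln_le; lra).
    assert ((z0 - c * t0) ^ 2 / (4 * (t0 + tau)) <= (Z + c * (1 + h)) ^ 2 / 4).
    { assert ((z0 - c * t0) ^ 2 <= (Z + c * (1 + h)) ^ 2).
      { rewrite <- (pow2_abs (z0 - c * t0)). apply pow_incr. split; [apply Rabs_pos|].
        eapply Rle_trans; [apply Rabs_triang|]. rewrite Rabs_Ropp.
        apply Rplus_le_compat; [exact Hz0|]. rewrite Rabs_right.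
        - apply Rmult_le_compat_l; lra.
        - apply Rle_ge, Rmult_le_pos; lra. }
      apply Rmult_le_compat; [apply pow2_ge_0|left; apply Rinv_0_lt_compat; lra|exact H0|].
      apply Rinv_le_contravar; lra. }
    lra. }
  unfold u in Hcmp. unfold k.
  assert (e0 * (exp lg - exp lth) <= e0 * (G t0 z0 - exp lth)) by (apply Rmult_le_compat_l; lra).
  lra.
Qed.

(** * The initial stage *)

(** The weight alone dominates w: its exponential branch after a large translation, since l < mu,
    and its constant branch because w <= kappa. *)
Lemma initial_above {g kappa c h l phi phi1} mu A {w} :
  front g kappa c h l phi phi1 -> 0 < kappa -> 0 < l -> l < mu -> 0 < A ->
  evolution g kappa c h w -> (forall t z, - h <= t <= 0 -> w t z <= A * exp (mu * z)) ->
  exists a, forall t z, - h <= t <= 0 -> w t z <= phi (z + a) + kappa * eta l (z + a).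
Proof.
  intros F Hk Hl Hmu HA E Hw.
  (* a >= 0 places the exponential branch at z <= 0, where e^(mu z) <= e^(l z). *)
  pose (a := Rmax 0 (ln (A / kappa) / l)).
  assert (Ha : 0 <= a) by apply Rmax_l.
  assert (HAa : A <= kappa * exp (l * a)).
  { apply Rle_trans with (kappa * exp (ln (A / kappa))).
    - rewrite exp_ln; [right; field; lra|apply Rdiv_lt_0_compat; lra].
    - apply Rmult_le_compat_l; [lra|]. apply exp_mono.
      assert (ln (A / kappa) / l <= a) by apply Rmax_r.
      apply (Rmult_le_compat_l l) in H; [|lra].
      replace (l * (ln (A / kappa) / l)) with (ln (A / kappa)) in H by (field; lra). exact H. }
  exists a. intros t z Ht.
  pose proof (wv_pos (fr_wave F) (z + a)).
  assert (w t z <= kappa * eta l (z + a)); [|lra].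
  destruct (Rle_lt_dec (z + a) 0) as [h0|h0].
  - rewrite eta_neg by lra. eapply Rle_trans; [apply Hw, Ht|].
    replace (l * (z + a)) with (l * a + l * z) by ring. rewrite exp_plus, <- Rmult_assoc.
    apply Rmult_le_compat; [lra|left; apply exp_pos|exact HAa|]. apply exp_mono. nra.
  - rewrite eta_nonneg by lra. rewrite Rmult_1_r. apply E.
Qed.

(** The subsolution is a level rising slowly from [be] to kappa - q, possible because g x - x has a
    positive minimum there, minus an exponential that retreats to the right with speed [V]. *)
Lemma invasion {g kappa p L c h w} b0 B q :
  monostable g kappa p L -> 0 < c -> 0 <= h -> evolution g kappa c h w ->
  0 < b0 -> (forall t z, - h <= t <= 0 -> B <= z -> b0 <= w t z) ->
  0 < q < kappa ->
  exists T Y, h <= T /\ forall t z, T - h <= t <= T -> Y <= z -> kappa - 3 * q <= w t z.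
Proof.
  intros Hg Hc Hh E Hb0 Hw Hq.
  pose proof (ms_L _ _ _ _ Hg) as HL.
  pose (be := Rmin b0 ((kappa - q) / 2)).
  assert (Hbe : 0 < be) by (apply Rmin_pos; lra).
  assert (Hbe1 : be <= b0) by apply Rmin_l.
  assert (Hbe2 : be <= (kappa - q) / 2) by apply Rmin_r.
  destruct (continuous_pos_min (fun x => g x - x) (be / 2) (kappa - q)) as [m [Hm Hmin]].
  { lra. }
  { intros x. apply cont_minus; [apply (monostable_continuous Hg)|apply continuous_id]. }
  { intros x Hx. pose proof (ms_above Hg x ltac:(lra)). lra. }
  (* The growth rate e and the lag e h of the delayed level must fit into m; the lagged level stays
     above be / 2; the rise takes at least time h; and over the last interval of length h the level
     drops by at most q. *)
  destruct (small_factor (1 + h) (Rmin m q) (Rmin (Rmin m q) (Rmin (be / 2) (kappa - q - be)))) as (e & [He _] & Hsmall);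
    [lra|repeat apply Rmin_pos; lra|repeat apply Rmin_pos; lra|].
  pose proof (Rmin_l (Rmin m q) (Rmin (be / 2) (kappa - q - be))). pose proof (Rmin_r (Rmin m q) (Rmin (be / 2) (kappa - q - be))).
  pose proof (Rmin_l m q). pose proof (Rmin_r m q).
  pose proof (Rmin_l (be / 2) (kappa - q - be)). pose proof (Rmin_r (be / 2) (kappa - q - be)).
  assert (He1 : (1 + h) * e <= m) by lra. assert (He2 : (1 + h) * e <= q) by lra.
  assert (He3 : (1 + h) * e <= be / 2) by lra.
  clear Hsmall H H0 H1 H2 H3 H4.
  assert (Heh : 0 <= e * h) by (apply Rmult_le_pos; lra).
  pose (T := (kappa - q - be) / e).
  assert (HTe : e * T = kappa - q - be) by (unfold T; field; lra).
  assert (HTh : h <= T).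
  { apply Rmult_le_reg_l with e; [exact He|]. lra. }
  (* This speed balances the drift of the exponential and its delayed effect on the reaction. *)
  pose (V := c + L * exp (c * h)).
  assert (HV : 0 < V) by (unfold V; pose proof (exp_pos (c * h)); assert (0 < L * exp (c * h)) by (apply Rmult_lt_0_compat; lra); lra).
  pose (ee := fun t z => kappa * exp (V * h) * exp (- (z - B) + V * t)).
  assert (Hkv : 0 < kappa * exp (V * h)) by (apply Rmult_lt_0_compat; [lra|apply exp_pos]).
  assert (Hee : forall t z, 0 < ee t z) by (intros; apply Rmult_lt_0_compat; [exact Hkv|apply exp_pos]).
  pose (u := fun t z => be + e * t - ee t z).
  assert (Hcmp : forall t z, - h <= t <= T -> u t z <= w t z).
  { apply (comparison_delay c h T u w Hg); auto; try lra.
    - intros pt. apply (cont_minus (fun p : R * R => u (fst p) (snd p))); [|apply E].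
      unfold u, ee. cont.
    - exists kappa. intros t z Ht. pose proof (ev_range E t z). unfold u. specialize (Hee t z).
      assert (e * t <= e * T) by (apply Rmult_le_compat_l; lra). lra.
    - intros t z Ht. unfold u. specialize (Hee t z) as Heez.
      assert (e * t <= 0) by (replace 0 with (e * 0) by ring; apply Rmult_le_compat_l; lra).
      destruct (Rle_lt_dec B z) as [h0|h0].
      + specialize (Hw t z Ht h0). lra.
      + pose proof (ev_range E t z).
        assert (kappa <= ee t z); [|lra].
        unfold ee. rewrite Rmult_assoc, <- exp_plus. rewrite <- (Rmult_1_r kappa) at 1.
        apply Rmult_le_compat_l; [lra|]. apply exp_ge1.
        assert (0 <= V * (h + t)) by (apply Rmult_le_pos; lra). lra.
    - intros t z Ht. right. exists (e + (be + e * t) + (c - V) * ee t z), (g (w (t - h) (z - c * h))).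
      split; [|split; [|split]].
      + apply jet_sub_test. exists (fun z => ee t z), (e - V * ee t z), (- ee t z).
        unfold u, ee. split; [|split; [|split]].
        * auto_derive; [trivial|ring].
        * apply filter_forall. intros y. auto_derive; [trivial|]. unfold Rminus. ring.
        * auto_derive; [trivial|]. unfold Rminus. ring.
        * ring.
      + apply jet_super_test, (ev_jet E). lra.
      + unfold u. set (b := be + e * (t - h)).
        assert (Hbr : be / 2 <= b <= kappa - q).
        { unfold b. assert (e * t <= e * T) by (apply Rmult_le_compat_l; lra).
          assert (0 <= e * t) by (apply Rmult_le_pos; lra). lra. }
        specialize (Hmin b Hbr).
        pose proof (Hee (t - h) (z - c * h)) as Hed.
        pose proof (ms_lip Hg (b - ee (t - h) (z - c * h)) b ltac:(lra)) as Hlip.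
        assert (Hedle : ee (t - h) (z - c * h) <= exp (c * h) * ee t z).
        { unfold ee. replace (exp (c * h) * (kappa * exp (V * h) * exp (- (z - B) + V * t)))
            with (kappa * exp (V * h) * (exp (c * h) * exp (- (z - B) + V * t))) by ring.
          apply Rmult_le_compat_l; [lra|]. rewrite <- exp_plus. apply exp_mono.
          assert (0 <= V * h) by (apply Rmult_le_pos; lra). lra. }
        assert (L * ee (t - h) (z - c * h) <= L * (exp (c * h) * ee t z)) by (apply Rmult_le_compat_l; lra).
        replace (b - (b - ee (t - h) (z - c * h))) with (ee (t - h) (z - c * h)) in Hlip by ring.
        replace ((c - V) * ee t z) with (- (L * (exp (c * h) * ee t z))) by (unfold V; ring).
        unfold b in *. lra.
      + lra. }
  destruct (small_tail 1 (kappa * exp (V * h) * exp (V * T)) q) as [R0 [_ HR0]]; [lra| |lra|].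
  { pose proof (exp_pos (V * T)). apply Rmult_le_pos; lra. }
  exists T, (B + R0). split; [exact HTh|]. intros t z Ht Hz.
  eapply Rle_trans; [|apply Hcmp; lra]. unfold u.
  assert (ee t z <= q).
  { left. eapply Rle_lt_trans; [|exact HR0]. unfold ee.
    rewrite (Rmult_assoc _ (exp (V * T))). apply Rmult_le_compat_l; [lra|]. rewrite <- exp_plus. apply exp_mono.
    assert (V * t <= V * T) by (apply Rmult_le_compat_l; lra). lra. }
  assert (e * (T - h) <= e * t) by (apply Rmult_le_compat_l; lra).
  lra.
Qed.

(** The front is translated so far to the right that it is below q eta wherever w is not yet close
    to kappa. Beyond, w >= kappa - q3 suffices: q3 <= kappa - phi(0) handles the arguments up to 0,
    and q3 <= q those where eta = 1. *)
Lemma initial_below {g kappa p L c h l phi phi1 w} b0 B q :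
  monostable g kappa p L -> front g kappa c h l phi phi1 -> 0 < c -> 0 <= h -> 0 < l ->
  evolution g kappa c h w ->
  0 < b0 -> (forall t z, - h <= t <= 0 -> B <= z -> b0 <= w t z) -> 0 < q ->
  exists T a, h <= T /\ forall t z, T - h <= t <= T -> phi (z + a) - q * eta l (z + a) <= w t z.
Proof.
  intros Hg F Hc Hh Hl E Hb0 Hw Hq.
  assert (W := fr_wave F).
  destruct (fr_left F q Hq) as [Z0 [HZ0 HZ]].
  pose proof (wv_lt W 0) as Hphi0. pose proof (wv_pos W 0) as Hphi0'.
  pose (q3 := Rmin q (kappa - phi 0)).
  assert (Hq3 : 0 < q3) by (apply Rmin_pos; lra).
  assert (Hq3a : q3 <= q) by apply Rmin_l. assert (Hq3b : q3 <= kappa - phi 0) by apply Rmin_r.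
  destruct (invasion b0 B (q3 / 3) Hg Hc Hh E Hb0 Hw ltac:(lra)) as (T & Y & HT & HY).
  replace (3 * (q3 / 3)) with q3 in HY by field.
  exists T, (- (Y + Z0)). split; [exact HT|]. intros t z Ht.
  set (ze := z + - (Y + Z0)).
  pose proof (ev_range E t z). pose proof (eta_pos l ze).
  destruct (Rle_lt_dec ze (- Z0)) as [h1|h1].
  - specialize (HZ ze h1). lra.
  - specialize (HY t z Ht ltac:(unfold ze in h1; lra)).
    destruct (Rle_lt_dec ze 0) as [h2|h2].
    + pose proof (front_monotone F h2).
      assert (0 < q * eta l ze) by (apply Rmult_lt_0_compat; lra). lra.
    + rewrite eta_nonneg by lra. pose proof (wv_lt W ze). lra.
Qed.

(** * Convergence to a translate *)

(* The value at times below [-h] is irrelevant; freezing it there makes the solution continuous on the whole plane. *)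
Lemma classical_evolution {g kappa p L} h c w0 w :
  monostable g kappa p L -> 0 <= h -> 0 <= c -> classical_solution g h c w0 w ->
  (forall t z, - h <= t <= 0 -> 0 <= w t z <= kappa) ->
  evolution g kappa c h (fun t z => w (Rmax t (- h)) z).
Proof.
  intros Hg Hh Hc (_ & Hcont & Hbd & Hder & _ & Hpde) Hinit.
  set (wt' := fun t z => w (Rmax t (- h)) z).
  assert (Hin : forall t z, - h <= t -> wt' t z = w t z).
  { intros t z Ht. unfold wt'. rewrite Rmax_left by lra. reflexivity. }
  assert (HC : forall pt : R * R, continuous (fun pt => wt' (fst pt) (snd pt)) pt).
  { intros [t z]. apply filterlim_locally. intros [e He]. simpl.
    destruct (Hcont (Rmax t (- h)) z (Rmax_r _ _) e He) as [d [Hd Hdw]].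
    exists (mkposreal d Hd). intros [s y] [h1 h2]. simpl in h1, h2.
    apply Hdw; [apply Rmax_r| |exact h2].
    eapply Rle_lt_trans; [|exact h1].
    apply Rmax_lip; [apply Rle_refl|]. rewrite Rminus_diag, Rabs_R0. apply Rabs_pos. }
  assert (HJ : forall t z, 0 < t -> jet c wt' t z (g (wt' (t - h) (z - c * h)))).
  { intros t z Ht. destruct (Hder t z Ht) as (D1 & _ & D3).
    exists (fun y => wz w t y), (wt w t z), (wzz w t z). split; [|split; [|split]].
    - apply (is_derive_ext_loc (fun s => w s z)).
      + exists (mkposreal t Ht). intros s Hs. apply Rabs_def2 in Hs. simpl in Hs.
        unfold minus, plus, opp in Hs; simpl in Hs. rewrite Hin; [reflexivity|lra].
      + apply Derive_correct, D1.
    - apply filter_forall. intros y. apply (is_derive_ext (fun y => w t y)).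
      + intros x. rewrite Hin; [reflexivity|lra].
      + apply Derive_correct. apply (Hder t y Ht).
    - apply Derive_correct, D3.
    - rewrite !Hin by lra. rewrite Hpde by exact Ht. ring. }
  assert (Hbd' : forall T, exists M, forall t z, 0 <= t <= T -> Rabs (wt' t z) <= M).
  { intros T. destruct (Hbd T) as [M HM]. exists M. intros t z Ht. rewrite Hin by lra. apply HM. lra. }
  assert (Hinit' : forall t z, - h <= t <= 0 -> 0 <= wt' t z <= kappa).
  { intros t z Ht. rewrite Hin by lra. apply Hinit, Ht. }
  assert (Hconst : forall (a t z : R), jet c (fun _ _ => a) t z a).
  { intros a t z. exists (fun _ => 0), 0, 0. split; [|split; [|split]].
    - apply derive_const.
    - apply filter_forall. intros. apply derive_const.
    - apply derive_const.
    - ring. }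
  assert (Hlow : forall t z, - h <= t -> 0 <= wt' t z).
  { intros t z Ht. destruct (Rle_lt_dec t 0) as [h0|h0]; [apply Hinit'; lra|].
    destruct (Hbd' t) as [M HM].
    apply (comparison_delay c h t (fun _ _ => 0) wt' Hg); auto; try lra.
    - intros pt. apply (cont_minus (fun _ => 0)); [apply continuous_const|apply HC].
    - exists M. intros s y Hs. specialize (HM s y Hs). apply Rabs_le_between in HM. lra.
    - intros s y Hs. apply Hinit', Hs.
    - intros s y Hs. right. exists 0, (g (wt' (s - h) (y - c * h))).
      split; [apply jet_sub_test, Hconst|]. split; [apply jet_super_test, HJ; lra|].
      split; [rewrite (ms_0 Hg); lra|lra]. }
  assert (Hup : forall t z, - h <= t -> wt' t z <= kappa).
  { intros t z Ht. destruct (Rle_lt_dec t 0) as [h0|h0]; [apply Hinit'; lra|].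
    destruct (Hbd' t) as [M HM].
    apply (comparison_delay c h t wt' (fun _ _ => kappa) Hg); auto; try lra.
    - intros pt. apply cont_minus; [apply HC|apply continuous_const].
    - exists (M - kappa). intros s y Hs. specialize (HM s y Hs). apply Rabs_le_between in HM. lra.
    - intros s y Hs. apply Hinit', Hs.
    - intros s y Hs. right. exists (g (wt' (s - h) (y - c * h))), kappa.
      split; [apply jet_sub_test, HJ; lra|]. split; [apply jet_super_test, Hconst|].
      split; [lra|rewrite (ms_kappa_fixed Hg); lra]. }
  constructor; auto.
  intros t z. destruct (Rle_lt_dec (- h) t) as [h0|h0]; [split; auto|].
  unfold wt'. rewrite Rmax_right by lra. rewrite <- (Hin (- h) z) by lra. split; [apply Hlow|apply Hup]; lra.
Qed.

(** * Asymptotic shifts and their improvement *)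

Definition eventually_above (phi : R -> R) (l : R) (w : R -> R -> R) (a : R) : Prop :=
  forall q, 0 < q -> exists T, 0 <= T /\ forall t z, T <= t -> phi (z + a) - q * eta l (z + a) <= w t z.

Definition eventually_below (phi : R -> R) (l : R) (w : R -> R -> R) (b : R) : Prop :=
  forall q, 0 < q -> exists T, 0 <= T /\ forall t z, T <= t -> w t z <= phi (z + b) + q * eta l (z + b).

Lemma exp_decay_time (be C q : R) : 0 < be -> 0 <= C -> 0 < q ->
  exists T, 0 <= T /\ forall t, T <= t -> C * exp (- be * t) <= q.
Proof.
  intros Hbe HC Hq. destruct (small_tail be C q Hbe HC Hq) as [T [HT Hlt]].
  exists T. split; [exact HT|]. intros t Ht. left. eapply Rle_lt_trans; [|exact Hlt].
  apply Rmult_le_compat_l; [exact HC|]. apply exp_mono. nra.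
Qed.

(** K depends neither on the solution nor on the starting time: a perturbation of size q costs a
    shift K q however late it is observed. *)
Lemma eventually_below_of_start {g kappa p L c h l phi phi1} Q :
  monostable g kappa p L -> front g kappa c h l phi phi1 -> 0 < c -> 0 <= h -> 0 < l ->
  symbol p c h l < 0 -> 0 < Q ->
  exists K, 0 < K /\ forall w T a q, evolution g kappa c h w -> 0 <= T -> 0 < q <= Q ->
    (forall t z, T - h <= t <= T -> w t z <= phi (z + a) + q * eta l (z + a)) ->
    eventually_below phi l w (a + K * q).
Proof.
  intros Hg F Hc Hh Hl Hs HQ.
  destruct (stability_above Q Hg F Hc Hh Hl Hs HQ) as (K & be & HK & Hbe & Hst).
  exists K. split; [exact HK|]. intros w T a q E HT Hq Hw e He.
  specialize (Hst _ (evolution_shift T HT E) a q Hq ltac:(intros; apply Hw; lra)).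
  destruct (exp_decay_time be q e Hbe ltac:(lra) He) as [T1 [HT1 Hd]].
  exists (T + T1). split; [lra|]. intros t z Ht.
  specialize (Hst (t - T) z ltac:(lra)). cbv beta in Hst. replace (T + (t - T)) with t in Hst by ring.
  eapply Rle_trans; [exact Hst|]. apply Rplus_le_compat_l.
  apply Rmult_le_compat_r; [left; apply eta_pos|]. apply Hd. lra.
Qed.

Lemma eventually_above_of_start {g kappa p L c h l phi phi1} :
  monostable g kappa p L -> front g kappa c h l phi phi1 -> 0 < c -> 0 <= h -> 0 < l ->
  symbol p c h l < 0 ->
  exists K qb, 0 < K /\ 0 < qb /\ forall w T a q, evolution g kappa c h w -> 0 <= T -> 0 < q <= qb ->
    (forall t z, T - h <= t <= T -> phi (z + a) - q * eta l (z + a) <= w t z) ->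
    eventually_above phi l w (a - K * q).
Proof.
  intros Hg F Hc Hh Hl Hs.
  destruct (stability_below Hg F Hc Hh Hl Hs) as (K & be & C & qb & HK & Hbe & HC & Hqb & Hst).
  exists K, qb. split; [exact HK|]. split; [exact Hqb|]. intros w T a q E HT Hq Hw e He.
  specialize (Hst _ (evolution_shift T HT E) a q Hq ltac:(intros; apply Hw; lra)).
  destruct (exp_decay_time be (C * q) e Hbe ltac:(apply Rmult_le_pos; lra) He) as [T1 [HT1 Hd]].
  exists (T + T1). split; [lra|]. intros t z Ht.
  specialize (Hst (t - T) z ltac:(lra)). cbv beta in Hst. replace (T + (t - T)) with t in Hst by ring.
  eapply Rle_trans; [|exact Hst]. apply Rplus_le_compat_l, Ropp_le_contravar.
  apply Rmult_le_compat_r; [left; apply eta_pos|]. apply Hd. lra.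
Qed.

Lemma wave_evolution {g kappa c h phi phi1} a :
  wave g kappa c h phi phi1 -> evolution g kappa c h (fun _ z => phi (z + a)).
Proof.
  intros W. constructor.
  - intros pt. assert (Hphic := wave_continuous W). cont.
  - intros _ z. split; left; apply W.
  - intros t z _.
    assert (H := jet_wave (fun _ => a) 0 t z W (derive_const a t)). cbv beta in H.
    replace (0 * phi1 (z + a) + g (phi (z + a - c * h))) with (g (phi (z - c * h + a))) in H; [exact H|].
    rewrite Rmult_0_l, Rplus_0_l. do 2 f_equal. ring.
Qed.

(** The gradient bound widens the gap from a point to an interval of radius rho, and [spread]
    carries it to |z| <= Z. Since the order holds only up to q, both the data and the reaction
    difference are bounded below only by -(L + 1) q. *)
Lemma gap_spreads {g kappa p L} c h m Z :
  monostable g kappa p L -> 0 <= c -> 0 <= h -> 0 < m -> 0 < Z ->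
  exists k, 0 < k /\ forall u1 u2 t0 q, evolution g kappa c h u1 -> evolution g kappa c h u2 ->
    1 <= t0 -> 0 <= q -> (L + 1) * q <= k -> (forall t z, t0 - h <= t -> u2 t z - q <= u1 t z) ->
    m <= u1 t0 0 - u2 t0 0 ->
    forall t z, t0 + 1 <= t <= t0 + 1 + h -> Rabs z <= Z -> k <= u1 t z - u2 t z.
Proof.
  intros Hg Hc Hh Hm HZ.
  pose proof (ms_kappa Hg) as Hk. pose proof (ms_L _ _ _ _ Hg) as HL.
  (* Each solution varies by at most 2 kappa rho, so half of the gap m survives. *)
  destruct (small_factor (4 * kappa) 1 (m / 2)) as (rho & Hrho & Hkrho); [lra|lra|lra|].
  destruct (spread c (m / 2) rho Z h Hc ltac:(lra) ltac:(lra) HZ Hh) as [k [Hkp Hspread]].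
  exists (k / 2). split; [lra|]. intros u1 u2 t0 q E1 E2 Ht0 Hq Hqk Hord Hgap t z Ht Hz.
  assert (HLq : 0 <= L * q) by pos.
  assert (F1 := evolution_shift t0 ltac:(lra) E1).
  assert (F2 := evolution_shift t0 ltac:(lra) E2).
  assert (Hv := Hspread (fun t z => u1 (t0 + t) z + - u2 (t0 + t) z) ((L + 1) * q) kappa).
  specialize (fun H1 H2 H3 H4 H5 H6 => Hv H1 H2 H3 H4 H5 H6 (t - t0) z ltac:(lra) Hz).
  cbv beta in Hv. replace (t0 + (t - t0)) with t in Hv by ring.
  assert (k - (L + 1) * q <= u1 t z + - u2 t z); [|lra].
  apply Hv; clear Hv.
  - intros pt. apply (cont_plus (fun p : R * R => u1 (t0 + fst p) (snd p))); [apply F1|].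
    apply cont_opp, F2.
  - intros s x _. pose proof (ev_range F1 s x). pose proof (ev_range F2 s x). cbv beta in *. lra.
  - lra.
  - intros s x Hs. eexists. split.
    + apply jet_plus; [apply (ev_jet F1), Hs|apply jet_opp, (ev_jet F2), Hs].
    + cbv beta. set (a1 := u1 _ _). set (a2 := u2 _ _).
      assert (a2 - q <= a1) by (apply Hord; lra).
      pose proof (ms_mono Hg (a2 - q) a1 ltac:(lra)). pose proof (ms_lip Hg (a2 - q) a2 ltac:(lra)) as Hli.
      replace (a2 - (a2 - q)) with q in Hli by ring. lra.
  - intros x. specialize (Hord (t0 + 0) x ltac:(lra)). lra.
  - intros x Hx. rewrite Rplus_0_r.
    assert (H1 := gradient_bound t0 0 x Hg Hc E1 Ht0).
    assert (H2 := gradient_bound t0 0 x Hg Hc E2 Ht0).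
    rewrite Rminus_0_r in H1, H2. specialize (H1 ltac:(lra)). specialize (H2 ltac:(lra)).
    assert (2 * kappa * Rabs x <= 2 * kappa * rho) by (apply Rmult_le_compat_l; lra).
    apply Rabs_le_between in H1. apply Rabs_le_between in H2. lra.
Qed.

(** On the bounded interval the gap pays for raising the shift by nu; outside, the raise and the
    remaining error cost at most nu e eta. Restarting with this perturbation loses K nu e, at most
    half of nu. *)
Lemma improve_above {g kappa p L c h l phi phi1 w} a m :
  monostable g kappa p L -> front g kappa c h l phi phi1 -> 0 < c -> 0 <= h -> 0 < l ->
  symbol p c h l < 0 -> evolution g kappa c h w ->
  0 < m -> eventually_above phi l w a ->
  (forall T, exists t0, T <= t0 /\ phi a + m <= w t0 0) ->
  exists nu, 0 < nu /\ eventually_above phi l w (a + nu).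
Proof.
  intros Hg F Hc Hh Hl Hs E Hm Ha Hinf.
  pose proof (ms_L _ _ _ _ Hg) as HL.
  destruct (eventually_above_of_start Hg F Hc Hh Hl Hs) as (K & qb & HK & Hqb & Hstart).
  destruct (front_increment Hl F) as [Cp [HCp Hinc]].
  (* The order of choices matters: e fixes the tail Z0, this fixes the gap k, then nu is small
     against k and q against nu. *)
  destruct (small_factor K qb (1 / 2)) as (e & He & HKe); [lra|lra|lra|].
  destruct (front_increment_tail (e / 2) Hl F ltac:(lra)) as [Z0 [HZ0 Htail]].
  pose proof (Rabs_pos a).
  destruct (gap_spreads c h m (Z0 + Rabs a) Hg ltac:(lra) Hh Hm ltac:(lra)) as (k & Hkp & Hspread).
  destruct (small_factor Cp 1 k) as (nu & Hnu & Hnu2); [lra|lra|lra|].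
  assert (Hnue : 0 < nu * e) by pos.
  destruct (small_factor (L + 1) (nu * e / 2) k) as (q & Hq & Hq2); [lra|lra|lra|].
  destruct (Ha q ltac:(lra)) as [T [HT HTw]].
  destruct (Hinf (T + h + 1)) as [t0 [Ht0 Hw0]].
  assert (Hv := Hspread w (fun _ z => phi (z + a)) t0 q E (wave_evolution a (fr_wave F))
    ltac:(lra) ltac:(lra) Hq2).
  exists (nu - K * (nu * e)). split.
  { replace (nu - K * (nu * e)) with (nu * (1 - K * e)) by ring. apply Rmult_lt_0_compat; lra. }
  replace (a + (nu - K * (nu * e))) with (a + nu - K * (nu * e)) by ring.
  apply (Hstart w (t0 + 1 + h)); [exact E|lra| |].
  { split; [exact Hnue|]. apply Rle_trans with (1 * e); [apply Rmult_le_compat_r|]; lra. }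
  intros t z Ht. replace (z + (a + nu)) with (z + a + nu) by ring.
  destruct (Rle_lt_dec (Rabs z) (Z0 + Rabs a)) as [h1|h1].
  - assert (k <= w t z - phi (z + a)).
    { apply Hv; [|rewrite Rplus_0_l; lra|lra|exact h1]. intros s x Hs'. specialize (HTw s x ltac:(lra)).
      assert (q * eta l (x + a) <= q * 1) by (apply Rmult_le_compat_l; [lra|apply eta_le1]). lra. }
    specialize (Hinc (z + a) (z + a + nu) ltac:(lra)). replace (z + a + nu - (z + a)) with nu in Hinc by ring.
    assert (Cp * nu * eta l (z + a + nu) <= Cp * nu * 1) by (apply Rmult_le_compat_l; [pos|apply eta_le1]).
    assert (0 <= nu * e * eta l (z + a + nu)) by pos. lra.
  - destruct (Htail (z + a) nu) as [Ht1 _]; [|lra|].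
    { pose proof (Rabs_triang_inv z (- a)) as Htri. rewrite Rabs_Ropp in Htri.
      replace (z - - a) with (z + a) in Htri by ring. lra. }
    specialize (HTw t z ltac:(lra)).
    assert (eta l (z + a) <= eta l (z + a + nu)) by (apply eta_mono; lra).
    assert (q * eta l (z + a) <= nu * e / 2 * eta l (z + a)) by (apply Rmult_le_compat_r; [left; apply eta_pos|lra]).
    assert (nu * e * eta l (z + a) <= nu * e * eta l (z + a + nu)) by (apply Rmult_le_compat_l; lra).
    lra.
Qed.

(** Mirror image; the factor e^(-l) appears because the shift is lowered, so the new weight is
    smaller than the old one, by at most this factor. *)
Lemma improve_below {g kappa p L c h l phi phi1 w} b m :
  monostable g kappa p L -> front g kappa c h l phi phi1 -> 0 < c -> 0 <= h -> 0 < l ->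
  symbol p c h l < 0 -> evolution g kappa c h w ->
  0 < m -> eventually_below phi l w b ->
  (forall T, exists t0, T <= t0 /\ w t0 0 <= phi b - m) ->
  exists nu, 0 < nu /\ eventually_below phi l w (b - nu).
Proof.
  intros Hg F Hc Hh Hl Hs E Hm Hb Hinf.
  pose proof (ms_L _ _ _ _ Hg) as HL.
  destruct (eventually_below_of_start 1 Hg F Hc Hh Hl Hs Rlt_0_1) as (K & HK & Hstart).
  destruct (front_increment Hl F) as [Cp [HCp Hinc]].
  destruct (small_factor K 1 (1 / 2)) as (e & He & HKe); [lra|lra|lra|].
  assert (He2 : 0 < e * exp (- l)) by pos.
  destruct (front_increment_tail (e * exp (- l) / 2) Hl F ltac:(lra)) as [Z0 [HZ0 Htail]].
  pose proof (Rabs_pos b).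
  destruct (gap_spreads c h m (Z0 + Rabs b) Hg ltac:(lra) Hh Hm ltac:(lra)) as (k & Hkp & Hspread).
  destruct (small_factor Cp 1 k) as (nu & Hnu & Hnu2); [lra|lra|lra|].
  assert (Hnue : 0 < nu * e) by pos. assert (Hnue2 : 0 < nu * (e * exp (- l))) by pos.
  destruct (small_factor (L + 1) (nu * (e * exp (- l)) / 2) k) as (q & Hq & Hq2); [lra|lra|lra|].
  destruct (Hb q ltac:(lra)) as [T [HT HTw]].
  destruct (Hinf (T + h + 1)) as [t0 [Ht0 Hw0]].
  assert (Hv := Hspread (fun _ z => phi (z + b)) w t0 q (wave_evolution b (fr_wave F)) E
    ltac:(lra) ltac:(lra) Hq2).
  exists (nu - K * (nu * e)). split.
  { replace (nu - K * (nu * e)) with (nu * (1 - K * e)) by ring. apply Rmult_lt_0_compat; lra. }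
  replace (b - (nu - K * (nu * e))) with (b - nu + K * (nu * e)) by ring.
  apply (Hstart w (t0 + 1 + h)); [exact E|lra| |].
  { split; [exact Hnue|]. apply Rle_trans with (1 * e); [apply Rmult_le_compat_r|]; lra. }
  intros t z Ht. replace (z + (b - nu)) with (z + b - nu) by ring.
  destruct (Rle_lt_dec (Rabs z) (Z0 + Rabs b)) as [h1|h1].
  - assert (k <= phi (z + b) - w t z).
    { apply Hv; [|rewrite Rplus_0_l; lra|lra|exact h1]. intros s x Hs'. specialize (HTw s x ltac:(lra)).
      assert (q * eta l (x + b) <= q * 1) by (apply Rmult_le_compat_l; [lra|apply eta_le1]). lra. }
    specialize (Hinc (z + b - nu) (z + b) ltac:(lra)). replace (z + b - (z + b - nu)) with nu in Hinc by ring.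
    assert (Cp * nu * eta l (z + b) <= Cp * nu * 1) by (apply Rmult_le_compat_l; [pos|apply eta_le1]).
    assert (0 <= nu * e * eta l (z + b - nu)) by pos. lra.
  - destruct (Htail (z + b) nu) as [_ Ht1]; [|lra|].
    { pose proof (Rabs_triang_inv z (- b)) as Htri. rewrite Rabs_Ropp in Htri.
      replace (z - - b) with (z + b) in Htri by ring. lra. }
    specialize (HTw t z ltac:(lra)).
    assert (exp (- l) * eta l (z + b) <= eta l (z + b - nu)).
    { eapply Rle_trans; [|apply (eta_shift l (z + b) nu Hl); lra].
      apply Rmult_le_compat_r; [left; apply eta_pos|]. apply exp_mono.
      assert (l * nu <= l * 1) by (apply Rmult_le_compat_l; lra). lra. }
    assert (q * eta l (z + b) <= nu * (e * exp (- l)) / 2 * eta l (z + b)) by (apply Rmult_le_compat_r; [left; apply eta_pos|lra]).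
    assert (nu * e * (exp (- l) * eta l (z + b)) <= nu * e * eta l (z + b - nu)) by (apply Rmult_le_compat_l; lra).
    lra.
Qed.

Lemma eventually_ordered {g kappa c h l phi phi1} w a b :
  front g kappa c h l phi phi1 -> eventually_above phi l w a -> eventually_below phi l w b -> a <= b.
Proof.
  intros F Ha Hb. apply Rnot_lt_le; intros Hlt.
  pose proof (front_strict F Hlt) as Hphi.
  pose (q := (phi a - phi b) / 3). assert (Hq : 0 < q) by (unfold q; lra).
  destruct (Ha q Hq) as [T1 [HT1 H1]]. destruct (Hb q Hq) as [T2 [HT2 H2]].
  specialize (H1 (T1 + T2) 0 ltac:(lra)). specialize (H2 (T1 + T2) 0 ltac:(lra)).
  rewrite Rplus_0_l in *. pose proof (eta_le1 l a). pose proof (eta_le1 l b).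
  assert (q * eta l a <= q * 1) by (apply Rmult_le_compat_l; lra).
  assert (q * eta l b <= q * 1) by (apply Rmult_le_compat_l; lra).
  unfold q in *. lra.
Qed.

(** Both extremal shifts are attained, since a small translation of phi costs a small multiple of
    the weight. *)
Lemma convergence {g kappa p L c h l phi phi1 w} a0 b0 :
  monostable g kappa p L -> front g kappa c h l phi phi1 -> 0 < c -> 0 <= h -> 0 < l ->
  symbol p c h l < 0 -> evolution g kappa c h w ->
  eventually_above phi l w a0 -> eventually_below phi l w b0 ->
  exists z0, eventually_above phi l w z0 /\ eventually_below phi l w z0.
Proof.
  intros Hg F Hc Hh Hl Hs E Ha0 Hb0.
  destruct (front_increment Hl F) as [Cp [HCp Hinc]].
  destruct (completeness (eventually_above phi l w)) as [a [Hua Hla]].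
  { exists b0. intros x Hx. apply (eventually_ordered w x b0 F Hx Hb0). }
  { exists a0. exact Ha0. }
  destruct (completeness (fun x => eventually_below phi l w (- x))) as [b' [Hub Hlb]].
  { exists (- a0). intros x Hx. pose proof (eventually_ordered w a0 (- x) F Ha0 Hx). lra. }
  { exists (- b0). rewrite Ropp_involutive. exact Hb0. }
  pose (b := - b').
  assert (HA : eventually_above phi l w a).
  { intros q Hq. pose (d := q / (2 * Cp)). assert (Hd : 0 < d) by (apply Rdiv_lt_0_compat; lra).
    destruct (is_lub_approx _ a d (conj Hua Hla) Hd) as [x [Hx Hxd]]. specialize (Hua x Hx).
    destruct (Hx (q / 2) ltac:(lra)) as [T [HT HTw]]. exists T. split; [exact HT|]. intros t z Ht.
    specialize (HTw t z Ht). specialize (Hinc (z + x) (z + a) ltac:(lra)).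
    assert (Hm : eta l (z + x) <= eta l (z + a)) by (apply eta_mono; lra).
    pose proof (eta_pos l (z + a)).
    assert (Cp * (z + a - (z + x)) * eta l (z + a) <= q / 2 * eta l (z + a)).
    { apply Rmult_le_compat_r; [lra|].
      apply Rle_trans with (Cp * d); [apply Rmult_le_compat_l; lra|]. unfold d. right; field; lra. }
    assert (q / 2 * eta l (z + x) <= q / 2 * eta l (z + a)) by (apply Rmult_le_compat_l; lra).
    lra. }
  assert (HB : eventually_below phi l w b).
  { intros q Hq. pose (q2 := q * exp (- l) / 2).
    assert (Hq2 : 0 < q2) by (assert (0 < q * exp (- l)) by pos; unfold q2; lra).
    destruct (small_factor Cp 1 q2) as (d & Hd & HCd); [lra|lra|exact Hq2|].
    destruct (is_lub_approx _ b' d (conj Hub Hlb) ltac:(lra)) as [y [Hx Hxd]].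
    assert (Hbx : y <= b') by (apply Hub, Hx).
    set (x := - y) in *.
    assert (Hbx' : b <= x < b + d) by (unfold b, x; lra).
    destruct (Hx q2 Hq2) as [T [HT HTw]]. exists T. split; [exact HT|]. intros t z Ht.
    specialize (HTw t z Ht). specialize (Hinc (z + b) (z + x) ltac:(lra)).
    assert (Hsh := eta_shift l (z + x) (x - b) Hl ltac:(lra)).
    replace (z + x - (x - b)) with (z + b) in Hsh by ring.
    pose proof (eta_pos l (z + x)).
    assert (exp (- l) * eta l (z + x) <= eta l (z + b)).
    { eapply Rle_trans; [|exact Hsh]. apply Rmult_le_compat_r; [lra|]. apply exp_mono. nra. }
    assert (Cp * (z + x - (z + b)) * eta l (z + x) <= q2 * eta l (z + x)).
    { apply Rmult_le_compat_r; [lra|].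
      apply Rle_trans with (Cp * d); [apply Rmult_le_compat_l; lra|exact HCd]. }
    assert (q * (exp (- l) * eta l (z + x)) <= q * eta l (z + b)) by (apply Rmult_le_compat_l; lra).
    assert (q * (exp (- l) * eta l (z + x)) = 2 * (q2 * eta l (z + x))) by (unfold q2; field).
    lra. }
  pose proof (eventually_ordered w a b F HA HB) as Hab.
  destruct (Req_dec a b) as [Heq|Hne]; [exists a; split; [exact HA|rewrite Heq; exact HB]|exfalso].
  pose proof (front_strict (x := a) (y := b) F ltac:(lra)) as Hphi.
  (* With half of the gap one alternative always holds: w(t, 0) is at or above the middle value at
     arbitrarily late times, or below it from some time on. *)
  pose (m := (phi b - phi a) / 2). assert (Hm : 0 < m) by (unfold m; lra).
  destruct (classic (forall T, exists t0, T <= t0 /\ phi a + m <= w t0 0)) as [Hi|Hn].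
  - destruct (improve_above a m Hg F Hc Hh Hl Hs E Hm HA Hi) as [nu [Hnu Hnew]].
    specialize (Hua _ Hnew). lra.
  - apply not_all_ex_not in Hn as [T0 Hn].
    destruct (improve_below b m Hg F Hc Hh Hl Hs E Hm HB) as [nu [Hnu Hnew]].
    + intros T. exists (Rmax T T0). split; [apply Rmax_l|].
      apply Rnot_lt_le; intros Hlt. apply Hn. exists (Rmax T T0). split; [apply Rmax_r|]. unfold m in *. lra.
    + assert (- (b - nu) <= b') by (apply Hub; rewrite Ropp_involutive; exact Hnew). unfold b in *. lra.
Qed.

(** * Convergence for the given initial data *)

Theorem theorem4 (g : R -> R) (kappa h c : R) (phi : R -> R)
  (w0 : R -> R -> R) (A B sigma mu lam1 lam2 lam : R) :
  (forall x y, x <= y -> g x <= g y) ->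
  hypH g kappa ->
  0 <= h ->
  is_wavefront g kappa h c phi ->
  is_min_speed g kappa h c ->
  (exists cs, is_c_sharp g h cs /\ cs < c) ->
  (* lam1 = lambda_1(c) < lam2 = lambda_2(c): the positive zeros of chi(.,c) *)
  0 < lam1 -> lam1 < lam2 ->
  chi g h lam1 c = 0 -> chi g h lam2 c = 0 ->
  (forall z, 0 < z -> chi g h z c = 0 -> z = lam1 \/ z = lam2) ->
  admissible_w0 h w0 ->
  0 < A -> 0 < B -> 0 < sigma < kappa -> lam1 < mu ->
  IC h kappa A B sigma mu w0 ->
  lam1 < lam < lam2 -> lam < mu ->
  forall w : R -> R -> R,
  classical_solution g h c w0 w ->
  exists z0 : R,
    forall eps, 0 < eps -> exists T, forall t, T <= t ->
      Rbar_le (wnorm lam (fun z => w t z - phi (z + z0))) (Finite eps).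
Proof.
  intros Hmono HH Hh Hphi Hmin [cs [Hcs Hcsc]] Hl1 Hl12 Hz1 Hz2 _ _ HA HB Hsig _ HIC Hlam Hlmu w Hw.
  destruct (hypH_monostable g kappa Hmono HH) as [L Hg].
  pose proof (ms_kappa Hg) as Hk. pose proof (ms_p Hg) as Hp.
  set (p := Derive g 0) in *.
  assert (Hc : 0 < c) by (pose proof (c_sharp_pos g h cs Hh Hp Hcs); lra).
  assert (W := wavefront_wave c h phi Hg Hphi).
  set (phi1 := Derive phi) in *.
  assert (Hneg : forall l, lam1 < l < lam2 -> symbol p c h l < 0).
  { intros l Hl. apply (symbol_neg_between p c h lam1 lam2); auto. lra. }
  (* A second exponent in the range of negative symbol, strictly above lam, as the dichotomy
     requires. *)
  pose (l' := (lam + lam2) / 2).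
  assert (Hch : 0 <= c * h) by (apply Rmult_le_pos; lra).
  assert (HF : front g kappa c h lam phi phi1).
  { destruct (wave_dichotomy lam l' Hg W Hch) as [[M [HM HMz]]|[d [Hd Hdz]]];
      try (unfold l'; lra); try (apply Hneg; unfold l'; lra).
    - apply (fast_wave_front lam l' M Hg W); auto; try (unfold l'; lra).
    - exfalso.
      destruct (slow_front_not_minimal lam l' d Hg W) as (s & f & Hs & Hf); auto;
        try (unfold l'; lra); try (apply Hneg; unfold l'; lra).
      destruct Hmin as [_ Hmin]. specialize (Hmin s (ex_intro _ f Hf)). lra. }
  assert (Hinit : forall t z, - h <= t <= 0 -> w t z = w0 t (z - c * t)) by apply Hw.
  assert (Hct : forall t, - h <= t <= 0 -> 0 <= - (c * t) <= c * h).
  { intros t Ht. split; nra. }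
  assert (E := classical_evolution h c w0 w Hg Hh ltac:(lra) Hw
    ltac:(intros t z Ht; rewrite Hinit by exact Ht; apply (HIC t (z - c * t) Ht))).
  set (w' := fun t z => w (Rmax t (- h)) z) in *.
  assert (Hin : forall t z, - h <= t -> w' t z = w t z).
  { intros t z Ht. unfold w'. rewrite Rmax_left by lra. reflexivity. }
  (* The data are evaluated at z - c s, which exceeds z by at most c h; hence the factor e^(mu c
     h). *)
  destruct (initial_above mu (A * exp (mu * (c * h))) HF Hk ltac:(lra) Hlmu ltac:(pos) E) as [b Hb].
  { intros t z Ht. rewrite Hin, Hinit by lra. destruct (HIC t (z - c * t) Ht) as (_ & H & _).
    eapply Rle_trans; [exact H|]. rewrite Rmult_assoc, <- exp_plus. apply Rmult_le_compat_l; [lra|].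
    apply exp_mono. specialize (Hct t Ht).
    assert (mu * (- (c * t)) <= mu * (c * h)) by (apply Rmult_le_compat_l; lra). lra. }
  (* The initial perturbation above has the full size kappa. *)
  destruct (eventually_below_of_start kappa Hg HF Hc Hh ltac:(lra) (Hneg lam Hlam) Hk)
    as (K1 & HK1 & Hst1).
  assert (HUB := Hst1 w' 0 b kappa E ltac:(lra) ltac:(lra) ltac:(intros t z Ht; apply Hb; lra)).
  destruct (eventually_above_of_start Hg HF Hc Hh ltac:(lra) (Hneg lam Hlam))
    as (K2 & qb & HK2 & Hqb & Hst2).
  destruct (initial_below (kappa - sigma) B qb Hg HF Hc Hh ltac:(lra) E ltac:(lra))
    as (T2 & a & HT2 & Ha); [|exact Hqb|].
  { intros t z Ht Hz. rewrite Hin, Hinit by lra. destruct (HIC t (z - c * t) Ht) as (_ & _ & H).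
    left. apply H. specialize (Hct t Ht). lra. }
  assert (HLA := Hst2 w' T2 a qb E ltac:(lra) ltac:(lra) Ha).
  destruct (convergence _ _ Hg HF Hc Hh ltac:(lra) (Hneg lam Hlam) E HLA HUB)
    as [z0 [Hz0a Hz0b]].
  exists z0. intros eps Heps.
  (* The factor pays for moving the centre of the weight from z + z0 back to z. *)
  pose (q := eps * exp (- lam * Rabs z0)).
  assert (Hq : 0 < q) by (apply Rmult_lt_0_compat; [exact Heps|apply exp_pos]).
  destruct (Hz0a q Hq) as [Ta [HTa Hta]]. destruct (Hz0b q Hq) as [Tb [HTb Htb]].
  exists (Ta + Tb). intros t Ht.
  unfold wnorm. destruct (Lub_Rbar_correct (fun r => exists z, r = Rabs (w t z - phi (z + z0)) / eta lam z)) as [_ Hlub].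
  apply Hlub. intros r [z ->]. simpl.
  pose proof (eta_pos lam z) as Hez.
  specialize (Hta t z ltac:(lra)). specialize (Htb t z ltac:(lra)). rewrite Hin in Hta, Htb by lra.
  assert (Hsh : q * eta lam (z + z0) <= eps * eta lam z).
  { assert (H1 := eta_shift lam (z + Rabs z0) (Rabs z0) ltac:(lra) (Rabs_pos z0)).
    replace (z + Rabs z0 - Rabs z0) with z in H1 by ring.
    assert (H2 : eta lam (z + z0) <= eta lam (z + Rabs z0)).
    { apply eta_mono; [lra|]. pose proof (Rle_abs z0). lra. }
    unfold q. rewrite Rmult_assoc. apply Rmult_le_compat_l; [lra|].
    eapply Rle_trans; [|exact H1]. apply Rmult_le_compat_l; [left; apply exp_pos|exact H2]. }
  assert (Rabs (w t z - phi (z + z0)) <= eps * eta lam z) by (apply Rabs_le; lra).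
  apply Rmult_le_reg_r with (eta lam z); [exact Hez|].
  replace (Rabs (w t z - phi (z + z0)) / eta lam z * eta lam z) with (Rabs (w t z - phi (z + z0))) by (field; lra).
  exact H.
Qed.
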